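(* Let $n,m\geqslant 1$ be integers and let $\mathbb{T}^m=\mathbb{C}^m/\Gamma$ be a complex $m$-torus, where $\Gamma\subset\mathbb{C}^m$ is a lattice of full rank $2m$. Let $\psi:\mathbb{R}_{\geqslant 1}\to\mathbb{R}_+$ be a continuous nondecreasing function tending to infinity, and let $\{\theta_i\}_{i\geqslant 1}$ be countably many directions in the unit sphere $\mathbb{S}^{2n-1}\subset\mathbb{C}^n$. Then there exists a universal holomorphic map $F:\mathbb{C}^n\to\mathbb{T}^m$ with slow growth $$T_F(r)\leqslant r^{\psi(r)}\qquad(\forall\, r\geqslant 1),$$ such that the hypercyclic directions of $F$ contain $\{\theta_i\}_{i\geqslant 1}$.
   Context: $\mathbb{R}_+=(0,\infty)$; $\|\cdot\|$ is the Euclidean norm; $\mathbb{B}(t)\subset\mathbb{C}^n$ is the ball of radius $t$ centered at the origin; $\mathrm{d}^c=\frac{\sqrt{-1}}{4\pi}(\bar\partial-\partial)$. For a holomorphic map $F:\mathbb{C}^n\to\mathbb{T}^m$, $$T_F(r):=\int_1^r\frac{\mathrm{d}t}{t^{2n-1}}\int_{\mathbb{B}(t)}F^*\omega_{\mathsf{std}}\wedge\alpha^{n-1},$$ where $\alpha:=\mathrm{d}\mathrm{d}^c\|z\|^2$ on $\mathbb{C}^n$ and $\omega_{\mathsf{std}}$ is the positive $(1,1)$-form on $\mathbb{T}^m$ induced by $\mathrm{d}\mathrm{d}^c\|w\|^2$ on $\mathbb{C}^m$. The space $\mathsf{Hol}(\mathbb{C}^n,\mathbb{T}^m)$ of holomorphic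 maps carries the compact-open topology. For $a\in\mathbb{C}^n\setminus\{\mathbf{0}\}$, the translation operator is $\mathsf{T}_a(f)(\bullet)=f(\bullet+a)$. An element $f$ is hypercyclic for $\mathsf{T}_a$ if the orbit $\{f,\mathsf{T}_a(f),\mathsf{T}_a^{2}(f),\dots\}$ is dense in $\mathsf{Hol}(\mathbb{C}^n,\mathbb{T}^m)$. The hypercyclic directions of $F$ are the $a\in\mathbb{S}^{2n-1}$ such that $F$ is hypercyclic for $\mathsf{T}_a$. A map $F$ is universal if every $H\in\mathsf{Hol}(\mathbb{C}^n,\mathbb{T}^m)$ is a limit (uniform on compact sets) of translates $F(\bullet+a_i)$ for some sequence $\{a_i\}$ in $\mathbb{C}^n$. *)

(* Defs.v *)
From HB Require Import structures.
From mathcomp Require Import all_boot all_order all_algebra.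
From mathcomp Require Import fingroup perm complex generic_quotient.
From mathcomp Require Import all_classical all_reals all_analysis.

Set Implicit Arguments.
Unset Strict Implicit.
Unset Printing Implicit Defensive.

Import Order.TTheory GRing.Theory Num.Theory.
Import numFieldNormedType.Exports.

Local Open Scope classical_set_scope.
Local Open Scope ring_scope.
Local Open Scope quotient_scope.
Local Open Scope complex_scope.

(* The standard topology and norm of the field R[i]. *)
HB.instance Definition _ (R : realType) := PseudoPointedMetric.copy R[i] R[i]^o.
HB.instance Definition _ (R : realType) := NormedModule.copy R[i] R[i]^o.

(* C^n, with the sup-norm topology of row vectors. *)
Notation Cn R n := 'rV[R[i]]_n.

Definition sqnorm (R : realType) (n : nat) (z : Cn R n) : R :=
  \sum_(j < n) (complex.Re (z ord0 j) ^+ 2 + complex.Im (z ord0 j) ^+ 2).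

Definition enorm (R : realType) (n : nat) (z : Cn R n) : R :=
  Num.sqrt (sqnorm z).

Definition eball (R : realType) (n : nat) (t : R) : set (Cn R n) :=
  [set z | enorm z < t].

Definition real_free (R : realType) (m k : nat) (b : 'I_k -> Cn R m) : Prop :=
  forall c : 'I_k -> R, \sum_i (c i)%:C *: b i = 0 -> forall i, c i = 0.

Record lattice (R : realType) (m : nat) := Lattice {
  lattice_set : set (Cn R m);
  lattice_full_rank : exists b : 'I_(2 * m) -> Cn R m,
    real_free b /\
    lattice_set = [set \sum_i b i *~ k i | k in [set: 'I_(2 * m) -> int]] }.

Section torus.
Variables (R : realType) (m : nat) (L : lattice R m).

Definition lattice_rel (w w' : Cn R m) : bool := `[< lattice_set L (w - w') >].

Lemma lattice_rel_equiv : equiv_class_of lattice_rel.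
Proof.
have [b [_ Lb]] := lattice_full_rank L.
split.
- by move=> w; apply/asboolP; rewrite subrr Lb; exists (fun=> 0) => //;
    rewrite big1// => i _; rewrite mulr0z.
- have sym w w' : lattice_rel w w' -> lattice_rel w' w.
    move=> /asboolP; rewrite Lb => -[k _ kE]; apply/asboolP.
    rewrite Lb; exists (fun i => - k i) => //.
    by rewrite -opprB -kE -sumrN; apply: eq_bigr => i _; rewrite mulrNz.
  by move=> w w'; apply/idP/idP; exact: sym.
- move=> w2 w1 w3 /asboolP; rewrite Lb => -[k _ kE] /asboolP.
  rewrite Lb => -[l _ lE]; apply/asboolP; rewrite Lb.
  exists (fun i => k i + l i) => //.
  rewrite -[w1](subrK w2) -addrA -kE -lE -big_split/=.
  by apply: eq_bigr => i _; rewrite mulrzDr.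
Qed.

Definition lattice_equiv : equiv_rel (Cn R m) := EquivRelPack lattice_rel_equiv.

Definition torus : Type := quotient_topology {eq_quot lattice_equiv}.

Definition torus_proj (w : Cn R m) : torus :=
  \pi_({eq_quot lattice_equiv}) w.

(* The flat distance on C^m / Gamma. *)
Definition torus_dist (x y : torus) : R :=
  inf [set d | exists w w' : Cn R m,
    [/\ torus_proj w = x, torus_proj w' = y & d = enorm (w - w')]].

End torus.

Section holomorphic_maps.
Variables (R : realType) (n m : nat) (L : lattice R m).
Implicit Types (F H : Cn R n -> torus L) (a : Cn R n).

(* The charts of the torus are the local inverses of torus_proj, so F is
   holomorphic at z0 iff it has a holomorphic lift f to C^m near z0.
   Differentiability is over the field R[i], i.e. complex differentiability. *)
Definition lift_near F (z0 : Cn R n) (f : Cn R n -> Cn R m) : Prop :=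
  (\forall z \near z0, differentiable f z) /\
  (\forall z \near z0, F z = torus_proj L (f z)).

Definition holomorphic_torus F : Prop :=
  forall z0, exists f, lift_near F z0 f.

Definition Hol : set {compact-open, Cn R n -> torus L} :=
  [set F | holomorphic_torus F].

Definition translate a F : Cn R n -> torus L := fun z => F (z + a).

Definition translation_orbit a F : set {compact-open, Cn R n -> torus L} :=
  [set iter k (translate a) F | k in [set: nat]].

(* Translation preserves Hol, so the orbit of F in Hol lies in Hol, and it is
   dense in Hol for the subspace topology iff its closure contains Hol. *)
Definition hypercyclic a F : Prop :=
  Hol F /\ Hol `<=` closure (translation_orbit a F).

Definition hypercyclic_directions F : set (Cn R n) :=
  [set a | enorm a = 1 /\ hypercyclic a F].

Definition universal F : Prop :=
  forall H, Hol H -> exists a : nat -> Cn R n,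
    forall K : set (Cn R n), compact K ->
    forall e : R, 0 < e ->
    \forall k \near \oo, forall z, K z ->
      torus_dist (translate (a k) F z) (H z) < e.

End holomorphic_maps.

(* Real k-forms, as alternating functions of k real tangent vectors; alternation
   is not part of the type, but all the operations below preserve it. *)
Definition form (R : realType) (n k : nat) :=
  Cn R n -> ('I_k -> Cn R n) -> R.

Section forms.
Variables (R : realType) (n : nat).

Definition wedge (k l : nat) (eta : form R n k) (zeta : form R n l)
    : form R n (k + l) := fun z v =>
  (k`! * l`!)%:R^-1 * \sum_(s : 'S_(k + l)) (-1) ^+ s *
    (eta z (fun i => v (s (lshift l i))) * zeta z (fun j => v (s (rshift k j)))).

Fixpoint wedge_exp (eta : form R n 2) (p : nat) : form R n (p * 2) :=
  match p with
  | 0 => fun _ _ => 1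
  | q.+1 => wedge eta (@wedge_exp eta q)
  end.

(* Derivative of phi at z in the real direction v. *)
Definition rderive (phi : Cn R n -> R) (z v : Cn R n) : R :=
  derive1 (fun t : R => phi (z + t%:C *: v)) 0.

Definition dform (k : nat) (eta : form R n k) : form R n k.+1 := fun z v =>
  \sum_(i < k.+1)
    (-1) ^+ i * rderive (fun x => eta x (fun j => v (lift i j))) z (v i).

(* The (1,0) and (0,1) parts of d phi. *)
Definition del (phi : Cn R n -> R) (z v : Cn R n) : R[i] :=
  ((rderive phi z v)%:C - 'i * (rderive phi z ('i *: v))%:C) / 2%:R.

Definition delbar (phi : Cn R n -> R) (z v : Cn R n) : R[i] :=
  ((rderive phi z v)%:C + 'i * (rderive phi z ('i *: v))%:C) / 2%:R.

(* d^c = i / (4 pi) (delbar - del), which is real on real functions. *)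
Definition dc (phi : Cn R n -> R) : form R n 1 := fun z v =>
  complex.Re ('i / (4%:R * pi)%:C * (delbar phi z (v ord0) - del phi z (v ord0))).

Definition ddc (phi : Cn R n -> R) : form R n 2 := dform (dc phi).

(* C^n is identified with R^(2n) by z_j = x_(2j) + i x_(2j+1). *)
Definition real_point (x : (n * 2).-tuple (measurableTypeR R)) : Cn R n :=
  \row_(j < n) (nth 0 x j.*2 +i* nth 0 x j.*2.+1).

Definition real_frame (i : 'I_(n * 2)) : Cn R n :=
  \row_(j < n) (if j == i./2 :> nat then (if odd i then 'i else 1) else 0).

End forms.
Arguments wedge_exp {R n} eta p.
Arguments real_point {R} n x.
Arguments real_frame {R} n.

(* Lebesgue measure on R^k, as an iterated product. *)
Fixpoint lebesgue_tuple (R : realType) (k : nat)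
    : set (k.-tuple (measurableTypeR R)) -> \bar R :=
  match k with
  | 0 => dirac [tuple]
  | l.+1 => pushforward (lebesgue_measure \x @lebesgue_tuple R l)%E
      (fun p : measurableTypeR R * l.-tuple (measurableTypeR R) =>
         [tuple of p.1 :: p.2])
  end.

(* Integral over D of a form of top degree, for the orientation
   dx_0 dx_1 ... dx_(2n-1) of C^n. *)
Definition form_integral (R : realType) (n : nat) (D : set (Cn R n))
    (eta : form R n (n * 2)) : \bar R :=
  (\int[@lebesgue_tuple R (n * 2)]_(x in real_point n @^-1` D)
     (eta (real_point n x) (real_frame n))%:E)%E.

Definition pullback (R : realType) (n m k : nat) (f : Cn R n -> Cn R m)
    (eta : form R m k) : form R n k :=
  fun z v => eta (f z) (fun i => 'd f z (v i)).

(* A lift of F near z, unique up to a translation in the lattice. *)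
Definition local_lift (R : realType) (n m : nat) (L : lattice R m)
    (F : Cn R n -> torus L) (z : Cn R n) : Cn R n -> Cn R m :=
  xget (fun=> 0) [set f | lift_near F z f].

(* The form dd^c ||w||^2 on C^m is translation invariant, and omega_std is the
   form on the torus that it induces: the pull-back of omega_std under torus_proj
   is dd^c ||w||^2.  So F^* omega_std = f^* (dd^c ||w||^2) for any lift f of F. *)
Definition pullback_omega_std (R : realType) (n m : nat) (L : lattice R m)
    (F : Cn R n -> torus L) : form R n 2 :=
  fun z v => pullback (local_lift F z) (ddc (@sqnorm R m)) z v.

(* The order function T_F(r).  The source is C^N with N = n.+1, so that the
   power of alpha is N - 1 = n.  The integrals take values in [0, +oo]. *)
Definition characteristic (R : realType) (n m : nat) (L : lattice R m)
    (F : Cn R n.+1 -> torus L) (r : R) : \bar R :=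
  (\int[@lebesgue_measure R]_(t in `[1%R, r])
     ((t ^- (2 * n.+1 - 1))%R%:E *
      form_integral (eball t)
        (wedge (pullback_omega_std F) (wedge_exp (ddc (@sqnorm R n.+1)) n))))%E.

(* Main.v *)
From HB Require Import structures.
Require Import Defs.
From mathcomp Require Import all_boot all_order all_algebra.
From mathcomp Require Import fingroup perm complex generic_quotient.
From mathcomp Require Import all_classical all_reals all_analysis.
From mathcomp Require Import ring lra.

(** The idea is to find one entire map f : C^n -> C^m of slow growth such that, for
every i, the translates f(z + N theta_i) approximate all entire maps uniformly
on balls. Since C^n is simply connected, every holomorphic map into the torus is
the projection of an entire map ([lift_entire]), so the projection F of f is
hypercyclic in each direction theta_i, and universal because of any one of them.

The map f is a sum of small corrections. Let S be the sum of the first ones and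
let Q be the next target, both of polynomial growth, and let l be a linear form
with l(theta) = 1. For d large there is a polynomial E in one variable with
E = 1 mod x^d and E = 0 mod (1 - x)^d, and then
  S(z) E(l(z) / N) + Q(z - N theta) (1 - E(l(z) / N))
is close to S near 0 and close to Q(z - N theta) near N theta. The correction,
its difference with S, is (1 - E(l(z) / N)) (Q(z - N theta) - S(z)). The first
factor is of order N^-d and the second one of order N^(d-1), so the correction
is at most (C / N) (1 + |z|)^D with an exponent D that does not depend on N
([translation_step]). Thus D is known before the size of the correction has to
be chosen. This gives the slow growth: if g beats all powers, a small multiple
of (1 + r)^D lies below g for each D ([growth_majorant]), so the k-th correction
can be taken below g / 2^(k+1), and also so small on a large ball that it spoils
none of the approximations reached before ([slow_universal]).

The targets must be countably many and dense among the entire maps; they are the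
polynomial maps with coefficients in Q(i). Holomorphy means differentiability at
each point, so density rests on the Goursat argument ([rectangle_bisection]),
which gives the Cauchy formula on a circle when it is applied to the contraction
of that circle to a point ([cauchy_circle]). A Riemann sum of the Cauchy formula
writes f, up to a small error, as a combination of its values at finitely many
values of one coordinate, with polynomial coefficients in that coordinate
([taylor_step], [coord_approx]). After all coordinates have been treated only
constants and polynomials remain ([approximable_entire]).

For the lifting, a cube is cut into small convex pieces where local lifts exist,
and these are glued along hyperplanes: two lifts differ by a continuous map into
the countable group Gamma, which is constant on convex sets
([contin_lattice_const], [liftable_glue]).

For the growth, only an upper bound of the order function is at stake. Its
integrand is at most a constant times the square of the norm of df, and the
volume of a ball is at most that of a cube, so the order function is at most
c r^e g(r)^2 with c and e depending on the dimensions ([characteristic_le]).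
The function g is chosen to make this equal to r^psi(r). *)

Set Implicit Arguments.
Unset Strict Implicit.
Unset Printing Implicit Defensive.

Import Order.TTheory GRing.Theory Num.Theory.
Import numFieldNormedType.Exports.

Local Open Scope classical_set_scope.
Local Open Scope ring_scope.
Local Open Scope quotient_scope.
Local Open Scope complex_scope.

(** * Real-valued norms, differentiability and compactness *)

Section RealNorm.
Variable R : realType.

(** The norm of a complex normed space takes its values in R[i]; this is the same
number in R, where inequalities can be handled by linear arithmetic. *)
Definition rn (V : normedZmodType R[i]) (v : V) : R := complex.Re `|v|.

Lemma normrn (V : normedZmodType R[i]) (v : V) : `|v| = (rn v)%:C.
Proof.
have := normr_ge0 v; rewrite lecE /= => /andP[/eqP h _].
by rewrite /rn [LHS]complexE h mulr0 addr0.
Qed.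

Section Zmod.
Variable V : normedZmodType R[i].
Implicit Types u v : V.

Lemma rn_ge0 v : 0 <= rn v.
Proof. by rewrite -ler0c -normrn. Qed.

Lemma rn0 : rn (0 : V) = 0.
Proof. by rewrite /rn normr0. Qed.

Lemma rn0_eq0 v : rn v = 0 -> v = 0.
Proof. by move=> v0; apply/normr0_eq0; rewrite normrn v0. Qed.

Lemma rnN v : rn (- v) = rn v.
Proof. by rewrite /rn normrN. Qed.

Lemma rn_distC u v : rn (u - v) = rn (v - u).
Proof. by rewrite -rnN opprB. Qed.

Lemma rnD u v : rn (u + v) <= rn u + rn v.
Proof. by rewrite -lecR rmorphD /= -!normrn ler_normD. Qed.

Lemma rnB u v : rn (u - v) <= rn u + rn v.
Proof. by rewrite -(rnN v) rnD. Qed.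

Lemma rn_tri w u v : rn (u - v) <= rn (u - w) + rn (w - v).
Proof. by apply: le_trans (rnD _ _); rewrite addrA subrK. Qed.

Lemma rn_sum (I : Type) (r : seq I) (P : pred I) (F : I -> V) :
  rn (\sum_(i <- r | P i) F i) <= \sum_(i <- r | P i) rn (F i).
Proof.
elim/big_ind2: _ => [|x1 x2 y1 y2 h1 h2|//]; first by rewrite rn0.
by apply: le_trans (rnD _ _) _; apply: lerD.
Qed.

End Zmod.

Lemma rn1 : rn (1 : R[i]) = 1.
Proof. by rewrite /rn normr1. Qed.

Lemma rnM (a b : R[i]) : rn (a * b) = rn a * rn b.
Proof. by apply: complexI; rewrite rmorphM /= -!normrn normrM. Qed.

Lemma rnX (a : R[i]) k : rn (a ^+ k) = rn a ^+ k.
Proof. by elim: k => [|k ih]; rewrite ?expr0 ?rn1// !exprS rnM ih. Qed.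

Lemma rnV (a : R[i]) : rn a^-1 = (rn a)^-1.
Proof.
by apply: complexI; rewrite -normrn normfV normrn fmorphV.
Qed.

Lemma rnZ (V : normedModType R[i]) (a : R[i]) (v : V) :
  rn (a *: v) = rn a * rn v.
Proof. by apply: complexI; rewrite rmorphM /= -!normrn normrZ. Qed.

Lemma rn_normc (a : R[i]) :
  rn a = Num.sqrt (complex.Re a ^+ 2 + complex.Im a ^+ 2).
Proof. by rewrite /rn normc_def. Qed.

Lemma rn_real (x : R) : rn x%:C = `|x|.
Proof. by rewrite rn_normc /= expr0n /= addr0 sqrtr_sqr. Qed.

Lemma rn_nat k : rn (k%:R : R[i]) = k%:R.
Proof. by rewrite -(rmorph_nat (real_complex R)) rn_real ger0_norm. Qed.

Lemma rn_i : rn ('i : R[i]) = 1.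
Proof. by rewrite rn_normc /= expr0n /= add0r expr1n sqrtr1. Qed.

Lemma Re_le_rn (a : R[i]) : `|complex.Re a| <= rn a.
Proof.
by rewrite rn_normc -sqrtr_sqr ler_wsqrtr// lerDl sqr_ge0.
Qed.

Lemma Im_le_rn (a : R[i]) : `|complex.Im a| <= rn a.
Proof.
by rewrite rn_normc -sqrtr_sqr ler_wsqrtr// lerDr sqr_ge0.
Qed.

Lemma rn_le_ReIm (a : R[i]) : rn a <= `|complex.Re a| + `|complex.Im a|.
Proof.
rewrite [X in rn X]complexE; apply: le_trans (rnD _ _) _.
by rewrite rnM rn_i mul1r !rn_real.
Qed.

Lemma rn_coord n (z : Cn R n) i j : rn (z i j) <= rn z.
Proof.
rewrite -lecR -!normrn [leRHS]/Num.Def.normr /= mx_normE -[leLHS]nngE num_le.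
exact: (le_bigmax _ _ (i, j)).
Qed.

Lemma rn_rV_le n (z : Cn R n) M : 0 <= M ->
  (forall j, rn (z ord0 j) <= M) -> rn z <= M.
Proof.
move=> M0 zM; rewrite /rn -[`|z|]/(mx_norm z).
have [->//|/mx_norm_neq0 [[i j]]] := eqVneq (mx_norm z) 0.
by move=> zij; rewrite zij /= ord1; exact: zM.
Qed.

Lemma near_rnP (V : normedModType R[i]) (P : set V) (z0 : V) :
  (\forall z \near z0, P z) <->
  exists2 d : R, 0 < d & forall z, rn (z - z0) < d -> P z.
Proof.
split => [/nbhs_normP [e /= e0 eP]|[d d0 dP]].
  have eE : e = (complex.Re e)%:C.
    by move: e0; rewrite ltcE /= => /andP[/eqP h _]; rewrite [LHS]complexE h mulr0 addr0.
  exists (complex.Re e); first by rewrite -ltcR -eE.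
  move=> z zd; apply: eP; rewrite /ball_ /= eE normrn ltcR.
  by rewrite rn_distC.
apply/nbhs_normP; exists d%:C => /=; first by rewrite ltcR.
move=> z; rewrite /ball_ /= normrn ltcR rn_distC; exact: dP.
Qed.

Lemma differentiable_rn (V W : normedModType R[i]) (f : V -> W) (z : V) :
  differentiable f z -> forall e : R, 0 < e -> exists2 d : R, 0 < d &
    forall h, rn h < d -> rn (f (z + h) - f z - 'd f z h) <= e * rn h.
Proof.
move=> /diff_locally /eqaddoP df e e0.
have e0' : 0 < e%:C :> R[i] by rewrite ltcR.
have /near_rnP [d d0 dP] := df _ e0'; exists d => // h hd.
have /= := dP h; rewrite subr0 => /(_ hd).
rewrite !normrn -rmorphM lecR.
by rewrite [z + h]addrC -addrA -opprD.
Qed.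

Lemma rn_differentiable_continuous (V W : normedModType R[i]) (f : V -> W) (z : V)
    (J : {linear V -> W}) : continuous J ->
  (forall e : R, 0 < e -> exists2 d : R, 0 < d &
    forall h, rn h < d -> rn (f (z + h) - f z - J h) <= e * rn h) ->
  differentiable f z /\ 'd f z = J :> (V -> W).
Proof.
move=> Jc fJ.
have E : f \o shift z = cst (f z) + J +o_ 0 id.
  apply/eqaddoP => e e0.
  have eE : e = (complex.Re e)%:C.
    by move: e0; rewrite ltcE /= => /andP[/eqP h _]; rewrite [LHS]complexE h mulr0 addr0.
  have [|d d0 dP] := fJ (complex.Re e); first by rewrite -ltcR -eE.
  apply/near_rnP; exists d => // h; rewrite subr0 => /dP.
  rewrite !normrn eE -rmorphM lecR /=.
  by rewrite [z + h]addrC -addrA -opprD.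
have dE := diff_unique Jc E.
by split=> //; apply/diff_locallyP; rewrite dE.
Qed.

Lemma rn_differentiable (V W : normedModType R[i]) (f : V -> W) (z : V)
    (J : {linear V -> W}) (K : R) : 0 <= K ->
  (forall h, rn (J h) <= K * rn h) ->
  (forall e : R, 0 < e -> exists2 d : R, 0 < d &
    forall h, rn h < d -> rn (f (z + h) - f z - J h) <= e * rn h) ->
  differentiable f z /\ 'd f z = J :> (V -> W).
Proof.
move=> K0 JK; apply: rn_differentiable_continuous.
apply/linear_bounded_continuous/bounded_funP => r.
exists (K * complex.Re r)%:C => x.
rewrite normrn lecE /= => /andP[_ xr]; rewrite normrn lecR.
by apply: le_trans (JK x) _; apply: ler_wpM2l xr.
Qed.

Lemma continuous_rnP (V W : normedModType R[i]) (f : V -> W) (z : V) :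
  {for z, continuous f} <-> forall e : R, 0 < e -> exists2 d : R, 0 < d &
    forall z', rn (z' - z) < d -> rn (f z' - f z) < e.
Proof.
split=> [fc e e0|fe].
  have /fc /near_rnP : nbhs (f z) [set w | rn (w - f z) < e] by apply/near_rnP; exists e.
  by [].
move=> A /near_rnP [e e0 eA]; have [d d0 dP] := fe e e0.
apply/near_rnP; exists d => // z' /dP /eA //.
Qed.

(** Lebesgue number principle: a positive radius that depends on the point can be
chosen uniformly on a compact set. It is used with [P d x] saying that something
works on the ball of radius [d] around [x]. *)
Lemma compact_uniform (V : normedModType R[i]) (K : set V)
    (P : R -> V -> Prop) : compact K ->
  (forall d d' x, d' <= d -> P d x -> P d' x) ->
  (forall x, K x -> exists2 d : R, 0 < d & forall x', rn (x' - x) < d -> P d x') ->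
  exists2 d : R, 0 < d & forall x, K x -> P d x.
Proof.
move=> /compact_near_coveringP cK Panti Ploc.
have Kn : forall x, K x -> \forall x' \near x & i \near (0 : R)^'+, P i x'.
  move=> x /Ploc [d d0 dP].
  exists ([set x' | rn (x' - x) < d], [set i | i < d]) => /=.
    split; first by apply/near_rnP; exists d.
    exact: nbhs_right_lt.
  by move=> [x' i] /= [/dP + /ltW id]; exact: Panti.
have {}Kn := cK R _ P (at_right_proper_filter 0) Kn.
have FF := at_right_proper_filter (0 : R).
have := @filterI _ _ (@filter_filter _ _ FF) _ _ Kn (nbhs_right_gt (0 : R)).
move=> /(@filter_ex _ _ FF)[d [dP d0]].
by exists d.
Qed.

Lemma compact_rn_bounded (V : normedModType R[i]) (K : set V) : compact K ->
  exists M : nat, forall z, K z -> rn z <= M%:R.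
Proof.
move=> cK.
have [d d0 dP] : exists2 d : R, 0 < d &
    forall x, K x -> 0 < d -> rn x <= d^-1.
  apply: compact_uniform cK _ _.
    move=> d d' x d'd xd d'0; have d0 := lt_le_trans d'0 d'd.
    by apply: le_trans (xd d0) _; rewrite lef_pV2.
  move=> x _; have x1 : 0 < rn x + 1 by rewrite ltr_wpDl ?rn_ge0.
  exists (rn x + 1)^-1; first by rewrite invr_gt0.
  move=> x' x'x _; rewrite invrK -{1}(subrK x x').
  apply: le_trans (rnD _ _) _; rewrite addrC lerD2l.
  by apply: le_trans (ltW x'x) _; rewrite invf_le1// lerDr rn_ge0.
exists (Num.bound d^-1) => z Kz; apply: le_trans (dP z Kz d0) _.
by apply/ltW/archi_boundP; rewrite invr_ge0 ltW.
Qed.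

(** A product of closed squares is compact and contains a given ball. *)
Lemma polydisc_compact n (M : R) :
  exists2 K : set (Cn R n), compact K & forall z, rn z <= M -> K z.
Proof.
pose sq := [set x +i* y | x in `[- M, M] & y in `[- M, M]]%classic.
have sqc : compact (sq : set R[i]).
  have -> : sq = (fun p : R * R => p.1 +i* p.2) @` (`[- M, M] `*` `[- M, M]).
    apply/seteqP; split => [_ [x xM [y yM <-]]|_ [[x y] [/= xM yM] <-]].
      by exists (x, y).
    by exists x => //; exists y.
  apply: continuous_compact; last first.
    by apply: compact_setX; exact: segment_compact.
  apply: continuous_subspaceT => -[x y] A /near_rnP [d d0 dA].
  have d20 : 0 < d / 2 by rewrite divr_gt0.
  apply: filterS (_ : nbhs (x, y) (ball (x, y) (d / 2))); last exact: nbhsx_ballx.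
  move=> [x' y'] /= [/= xx' yy']; apply: dA => /=.
  apply: le_lt_trans (rn_le_ReIm _) _ => /=.
  rewrite /ball/= in xx' yy'.
  by rewrite [d]splitr; apply: ltrD; rewrite distrC.
exists [set z : Cn R n | forall j, sq (z ord0 j)].
  exact: (@rV_compact R[i] n (fun=> sq) (fun=> sqc)).
move=> z zM j.
have zjM := le_trans (rn_coord z ord0 j) zM.
exists (complex.Re (z ord0 j)) => /=.
  by rewrite in_itv /= -ler_norml; exact: le_trans (Re_le_rn _) zjM.
exists (complex.Im (z ord0 j)) => /=.
  by rewrite in_itv /= -ler_norml; exact: le_trans (Im_le_rn _) zjM.
by case: (z ord0 j).
Qed.

End RealNorm.

(** * Maps of polynomial growth *)

Ltac pos := repeat first
  [ done | exact: rn_ge0 | exact: ler01 | exact: ler0n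
  | apply: mulr_ge0 | apply: addr_ge0 | apply: exprn_ge0 ].

Section Tame.
Variables (R : realType) (n : nat).
Local Notation C := (R[i]).
Implicit Types (V : normedModType R[i]) (z h a : Cn R n).

(** Polynomial growth of a map, of its differential [J], and of the remainder of
order two. Controlling the remainder as well makes it possible to differentiate
series of such maps term by term, without Cauchy estimates. The exponent [D]
need not be the least one. *)
Definition tame_diff V D (K : R) (f : Cn R n -> V) (J : Cn R n -> Cn R n -> V) :=
  [/\ forall z, linear (J z),
      forall z, rn (f z) <= K * (1 + rn z) ^+ D,
      forall z h, rn (J z h) <= K * (1 + rn z) ^+ D * rn h
    & forall z h, rn (f (z + h) - f z - J z h)
        <= K * (1 + rn z + rn h) ^+ D * rn h ^+ 2].

Definition tame V D K (f : Cn R n -> V) := exists J, tame_diff D K f J.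

Lemma tame_K0 V D K (f : Cn R n -> V) : tame D K f -> 0 <= K.
Proof.
move=> [J [_ + _ _]] => /(_ 0); rewrite rn0 addr0 expr1n mulr1.
exact: le_trans (rn_ge0 _).
Qed.

Lemma tame_le V D K D' K' (f : Cn R n -> V) : (D <= D')%N -> K <= K' ->
  tame D K f -> tame D' K' f.
Proof.
move=> DD KK /[dup] /tame_K0 K0 [J [Jl fK JK fJ]].
have le z t : 0 <= t -> K * (1 + rn z + t) ^+ D <= K' * (1 + rn z + t) ^+ D'.
  move=> t0; have ge1 : 1 <= 1 + rn z + t by rewrite -addrA lerDl addr_ge0 ?rn_ge0.
  apply: ler_pM => //; first by rewrite exprn_ge0// (le_trans _ ge1).
  by rewrite ler_weXn2l.
have le0 z : K * (1 + rn z) ^+ D <= K' * (1 + rn z) ^+ D'.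
  by have := le z 0 (lexx _); rewrite addr0.
exists J; split=> // [z|z h|z h].
- exact: le_trans (fK z) (le0 z).
- by apply: le_trans (JK z h) _; rewrite ler_wpM2r ?rn_ge0.
- apply: le_trans (fJ z h) _; rewrite ler_wpM2r ?exprn_ge0 ?rn_ge0//.
  by apply: le; rewrite rn_ge0.
Qed.

Lemma tame_cst V (c : V) : tame 0 (rn c) (fun=> c).
Proof.
exists (fun _ _ => 0); split => [z a u v|z|z h|z h].
- by rewrite scaler0 addr0.
- by rewrite mulr1.
- by rewrite rn0; pos.
- by rewrite subrr subr0 rn0; pos.
Qed.

Lemma tame_linear V (l : Cn R n -> V) K : linear l -> 0 <= K ->
  (forall z, rn (l z) <= K * rn z) -> tame 1 K l.
Proof.
move=> ll K0 lK; exists (fun _ => l); split => [//|z|z h|z h].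
- by apply: le_trans (lK z) _; rewrite ler_wpM2l// expr1 lerDr.
- apply: le_trans (lK h) _; rewrite ler_wpM2r ?rn_ge0// ler_peMr//.
  by rewrite expr1 lerDl rn_ge0.
- have -> : l (z + h) = l z + l h by rewrite -[z in LHS]scale1r ll scale1r.
  by rewrite [l z + _]addrC addrK subrr rn0; pos.
Qed.

Lemma tame_add V D K1 K2 (f g : Cn R n -> V) :
  tame D K1 f -> tame D K2 g -> tame D (K1 + K2) (fun z => f z + g z).
Proof.
move=> [J1 [Jl1 fK1 JK1 fJ1]] [J2 [Jl2 fK2 JK2 fJ2]].
exists (fun z h => J1 z h + J2 z h); split => [z a u v|z|z h|z h].
- by rewrite Jl1 Jl2 scalerDr addrACA.
- by rewrite mulrDl; apply: le_trans (rnD _ _) _; apply: lerD.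
- by rewrite !mulrDl; apply: le_trans (rnD _ _) _; apply: lerD.
- rewrite !mulrDl; apply: le_trans (lerD (fJ1 z h) (fJ2 z h)).
  have E (a b c d e k : V) : a + b - (c + d) - (e + k) = (a - c - e) + (b - d - k).
    by rewrite !opprD [a + b + _]addrACA [LHS]addrACA.
  by rewrite E; exact: rnD.
Qed.

Lemma tame_scale V D K (c : C) (f : Cn R n -> V) :
  tame D K f -> tame D (rn c * K) (fun z => c *: f z).
Proof.
move=> [J [Jl fK JK fJ]]; exists (fun z h => c *: J z h); split => [z a u v|z|z h|z h].
- by rewrite Jl scalerDr !scalerA mulrC.
- by rewrite rnZ -mulrA ler_wpM2l ?rn_ge0.
- by rewrite rnZ -!mulrA ler_wpM2l ?rn_ge0// mulrA.
- by rewrite -!scalerBr rnZ -!mulrA ler_wpM2l ?rn_ge0// mulrA.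
Qed.

Lemma tame_translate V D K a (f : Cn R n -> V) :
  tame D K f -> tame D (K * (1 + rn a) ^+ D) (fun z => f (z + a)).
Proof.
move=> /[dup] /tame_K0 K0 [J [Jl fK JK fJ]].
have le z t : 0 <= t -> K * (1 + rn (z + a) + t) ^+ D
    <= K * (1 + rn a) ^+ D * (1 + rn z + t) ^+ D.
  move=> t0; rewrite -mulrA ler_wpM2l// -exprMn lerXn2r ?nnegrE//.
  - by rewrite !addr_ge0 ?rn_ge0.
  - by rewrite !mulr_ge0 ?addr_ge0 ?rn_ge0.
  have := rnD z a; have := rn_ge0 z; have := rn_ge0 a; nra.
have le0 z : K * (1 + rn (z + a)) ^+ D <= K * (1 + rn a) ^+ D * (1 + rn z) ^+ D.
  by have := le z 0 (lexx _); rewrite !addr0.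
exists (fun z => J (z + a)); split => [//|z|z h|z h].
- exact: le_trans (fK _) (le0 z).
- by apply: le_trans (JK _ h) _; rewrite ler_wpM2r ?rn_ge0.
- rewrite [z + h + a]addrAC; apply: le_trans (fJ _ h) _.
  by rewrite ler_wpM2r ?exprn_ge0 ?rn_ge0//; apply: le; rewrite rn_ge0.
Qed.

(** The product of the two increments produces a remainder term of order three in
[h]; one factor |h| is absorbed in an additional power of 1 + |z| + |h|. *)
Lemma tame_mul V D1 D2 K1 K2 (u : Cn R n -> C) (f : Cn R n -> V) :
  tame D1 K1 u -> tame D2 K2 f ->
  tame (D1 + D2).+1 (4 * K1 * K2) (fun z => u z *: f z).
Proof.
move=> /[dup] /tame_K0 K10 [J1 [Jl1 fK1 JK1 fJ1]].
move=> /[dup] /tame_K0 K20 [J2 [Jl2 fK2 JK2 fJ2]].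
have B1 z : 1 <= 1 + rn z by rewrite lerDl rn_ge0.
have ge0 D K z : 0 <= K -> 0 <= K * (1 + rn z) ^+ D.
  by move=> ?; rewrite mulr_ge0// exprn_ge0// (le_trans _ (B1 z)).
have up z : K1 * (1 + rn z) ^+ D1 * (K2 * (1 + rn z) ^+ D2)
    <= K1 * K2 * (1 + rn z) ^+ (D1 + D2).+1.
  rewrite mulrACA -exprD ler_wpM2l ?mulr_ge0//.
  by apply: ler_weXn2l => //; exact: leqnSn.
exists (fun z h => u z *: J2 z h + J1 z h *: f z); split => [z a v w|z|z h|z h].
- rewrite Jl1 Jl2 scalerDr scalerDl !scalerA [u z * a]mulrC.
  by rewrite scalerDr !scalerA addrACA.
- rewrite rnZ; apply: le_trans (ler_pM (rn_ge0 _) (rn_ge0 _) (fK1 z) (fK2 z)) _.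
  apply: le_trans (up z) _; rewrite -!mulrA ler_peMl ?ler1n//.
  by rewrite mulrA ge0 ?mulr_ge0.
- apply: le_trans (rnD _ _) _; rewrite !rnZ.
  have e1 := ler_pM (rn_ge0 _) (rn_ge0 _) (fK1 z) (JK2 z h).
  have e2 := ler_pM (rn_ge0 _) (rn_ge0 _) (JK1 z h) (fK2 z).
  have e3 := ler_wpM2r (rn_ge0 h) (up z).
  have e4 : 0 <= K1 * K2 * (1 + rn z) ^+ (D1 + D2).+1 * rn h.
    by rewrite mulr_ge0 ?ge0 ?mulr_ge0 ?rn_ge0.
  lra.
- set t := 1 + rn z + rn h.
  have t1 : 1 <= t by rewrite /t -addrA lerDl addr_ge0 ?rn_ge0.
  have t0 : 0 <= t by rewrite (le_trans _ t1).
  have ht : rn h <= t by rewrite /t lerDr addr_ge0 ?rn_ge0.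
  have zt : 1 + rn z <= t by rewrite /t lerDl rn_ge0.
  have zht : 1 + rn (z + h) <= t by rewrite /t -addrA lerD2l rnD.
  have mono D K s : 0 <= K -> 0 <= s -> s <= t -> K * s ^+ D <= K * t ^+ D.
    by move=> ? ? ?; rewrite ler_wpM2l// lerXn2r ?nnegrE.
  have z0 : 0 <= 1 + rn z by rewrite addr_ge0 ?rn_ge0.
  have zh0 : 0 <= 1 + rn (z + h) by rewrite addr_ge0 ?rn_ge0.
  have Z (A B c d X Y : V) : A - B - (c + d) = A - X - Y + (X - B - c + (Y - d)).
    rewrite -[A - X - Y]addrA -opprD.
    have -> : X - B - c + (Y - d) = (X + Y) - (B + (c + d)).
      by rewrite -[X - B - c]addrA -opprD addrACA -opprD addrA.
    by rewrite [RHS]addrA subrK [in RHS]opprD [RHS]addrA.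
  have -> : u (z + h) *: f (z + h) - u z *: f z - (u z *: J2 z h + J1 z h *: f z)
    = (u (z + h) - u z - J1 z h) *: f (z + h)
      + (u z *: (f (z + h) - f z - J2 z h) +
         (J1 z h *: (J2 z h) + J1 z h *: (f (z + h) - f z - J2 z h))).
    rewrite -[in RHS]scalerDr [J2 z h + _]addrC subrK !scalerBr !scalerBl; exact: Z.
  have r1 := le_trans (fK2 (z + h)) (mono D2 _ _ K20 zh0 zht).
  have r2 := le_trans (fK1 z) (mono D1 _ _ K10 z0 zt).
  have r3 := le_trans (JK1 z h) (ler_wpM2r (rn_ge0 h) (mono D1 _ _ K10 z0 zt)).
  have r4 := le_trans (JK2 z h) (ler_wpM2r (rn_ge0 h) (mono D2 _ _ K20 z0 zt)).
  have e1 := ler_pM (rn_ge0 _) (rn_ge0 _) (fJ1 z h) r1.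
  have e2 := ler_pM (rn_ge0 _) (rn_ge0 _) r2 (fJ2 z h).
  have e3 := ler_pM (rn_ge0 _) (rn_ge0 _) r3 r4.
  have e4 := ler_pM (rn_ge0 _) (rn_ge0 _) r3 (fJ2 z h).
  rewrite -!rnZ in e1 e2 e3 e4.
  apply: le_trans (rnD _ _) _.
  apply: le_trans (lerD (lexx _) (rnD _ _)) _.
  apply: le_trans (lerD (lexx _) (lerD (lexx _) (rnD _ _))) _.
  apply: le_trans (lerD e1 (lerD e2 (lerD e3 e4))) _.
  rewrite -/t [t ^+ _.+1]exprS [t ^+ (_ + _)]exprD.
  have P0 : 0 <= K1 * K2 * t ^+ D1 * t ^+ D2 * rn h ^+ 2 by pos.
  have p1 := ler_wpM2l P0 t1; have p2 := ler_wpM2l P0 ht.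
  rewrite [leLHS](_ : _ = K1 * K2 * t ^+ D1 * t ^+ D2 * rn h ^+ 2 * 3 +
     K1 * K2 * t ^+ D1 * t ^+ D2 * rn h ^+ 2 * rn h); last by ring.
  rewrite [leRHS](_ : _ = K1 * K2 * t ^+ D1 * t ^+ D2 * rn h ^+ 2 * t * 4); last by ring.
  lra.
Qed.

(** The degree and the constant depend on the polynomial and on [K0] only: this is
what makes the estimates for p(l / N) uniform in N. *)
Lemma tame_horner (p : {poly C}) (K0 : R) : exists D K, forall l : Cn R n -> C,
  tame 1 K0 l -> tame D K (fun z => p.[l z]).
Proof.
elim/poly_ind: p => [|p c [D [K ih]]].
  exists 0%N, 0 => l _.
  have -> : (fun z => (0 : {poly C}).[l z]) = (fun=> 0) by apply/funext => z; rewrite horner0.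
  by have := tame_cst (0 : C); rewrite rn0.
exists (D + 1).+1, (4 * K * K0 + rn c) => l lt.
have -> : (fun z => (p * 'X + c%:P).[l z]) = (fun z => p.[l z] *: l z + c).
  by apply/funext => z; rewrite hornerMXaddC.
apply: tame_add; first by apply: tame_mul => //; exact: ih.
exact: tame_le (tame_cst c).
Qed.

End Tame.

(** * Moving a target far away by a small correction *)

Section Step.
Variables (R : realType) (n m : nat).
Local Notation C := (R[i]).

Lemma bezout_Xn_1BXn (d : nat) : exists A B : {poly C},
  (1 - 'X) ^+ d * A + 'X^d * B = 1.
Proof.
have : coprimep ((1 - 'X : {poly C}) ^+ d) ('X^d).
  apply: coprimep_expl; apply: coprimep_expr.
  by apply/Bezout_eq1_coprimepP; exists (1, 1); rewrite !mul1r subrK.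
move=> /Bezout_eq1_coprimepP [[A B] /= E]; exists A, B.
by rewrite -[RHS]E mulrC ['X^d * _]mulrC.
Qed.

Lemma poly_bounded (p : {poly C}) (M : R) :
  exists2 K : R, 0 <= K & forall x : C, rn x <= M -> rn p.[x] <= K.
Proof.
elim/poly_ind: p => [|p c [K K0 ih]].
  by exists 0 => // x _; rewrite horner0 rn0.
exists (K * `|M| + rn c) => [|x xM]; first by pos; exact: normr_ge0.
rewrite hornerMXaddC; apply: le_trans (rnD _ _) _; rewrite lerD2r rnM.
by apply: ler_pM; rewrite ?rn_ge0 ?ih// (le_trans xM)// ler_norm.
Qed.

Lemma exists_nat_ge (x : R) : exists2 N : nat, (0 < N)%N & x <= N%:R.
Proof.
exists (Num.bound `|x|).+1 => //; apply: le_trans (ler_norm x) _.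
apply/ltW; apply: lt_le_trans (archi_boundP (normr_ge0 x)) _.
by rewrite ler_nat.
Qed.

(** The degree [D] comes before the bound [e]: however small the correction is
required to be, its growth exponent stays the same. *)
Lemma translation_step (th : Cn R n) (S Q : Cn R n -> Cn R m)
    DS KS DQ KQ (dl rho : R) :
  th != 0 -> tame DS KS S -> tame DQ KQ Q -> 0 < dl ->
  exists D, forall e : R, 0 < e -> exists (N : nat) (P : Cn R n -> Cn R m),
    tame D e P /\
    forall y, rn y <= rho ->
      rn (S (y + th *+ N) + P (y + th *+ N) - Q y) <= dl.
Proof.
move=> th0 St0 Qt0 dl0.
have [j thj] : exists j, th ord0 j != 0.
  by apply/rV0Pn : th0.
pose l (z : Cn R n) : C := z ord0 j / th ord0 j.
pose c0 := (rn (th ord0 j))^-1.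
have c00 : 0 <= c0 by rewrite invr_ge0 rn_ge0.
have lth : l th = 1 by rewrite /l divff.
have ll : linear (l : Cn R n -> C^o).
  by move=> a u v; rewrite /l !mxE mulrDl -mulrA.
have lc z : rn (l z) <= c0 * rn z.
  by rewrite rnM rnV mulrC ler_wpM2l// rn_coord.
pose D0 := maxn DS DQ; pose K0 := Num.max KS KQ.
have St : tame D0 K0 S by apply: tame_le St0; rewrite ?leq_maxl// le_max lexx.
have Qt : tame D0 K0 Q by apply: tame_le Qt0; rewrite ?leq_maxr// le_max lexx orbT.
have K00 := tame_K0 St.
(* With d > D0, the factor N^-d outweighs the growth N^D0 of the data. *)
pose d := D0.+1; have [A [B AB]] := bezout_Xn_1BXn d.
have lt : tame 1 c0 (l : Cn R n -> C^o) by exact: tame_linear.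
have [D1 [K1 BlN]] := @tame_horner R n B c0.
have [D2 [K2 /(_ _ lt) ld]] := @tame_horner R n 'X^d c0.
pose T := 1 + rn th.
have T0 : 0 <= T by rewrite /T; pos.
pose cP := 4 * (4 * K2 * K1) * (K0 * T ^+ D0 + K0).
exists ((D2 + D1).+1 + D0).+1 => e e0.
have [KA KA0 Abound] := poly_bounded A (1 + c0 * `|rho|).
pose r0 := `|rho|.
pose cQ := (c0 * r0) ^+ d * KA * (K0 * (T + r0) ^+ D0 + K0 * (1 + r0) ^+ D0).
have [N N0 NcP] := exists_nat_ge (Num.max (cP / e) (cQ / dl)).
move: NcP; rewrite ge_max => /andP[NcP NcQ].
have NR0 : 0 < (N%:R : R) by rewrite ltr0n.
have NR1 : 1 <= (N%:R : R) by rewrite ler1n.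
have NC0 : (N%:R : C) != 0 by rewrite pnatr_eq0 -lt0n.
have rnth : rn (th *+ N) = N%:R * rn th by rewrite -scaler_nat rnZ rn_nat.
have adX : N%:R^-1 ^+ d * N%:R ^+ D0 = N%:R^-1 :> R.
  by rewrite /d exprS -mulrA -exprMn mulVf ?gt_eqF// expr1n mulr1.
pose u (z : Cn R n) : C := N%:R^-1 * l z.
have ut : tame 1 c0 (u : Cn R n -> C^o).
  apply: tame_le (tame_scale (N%:R^-1) lt) => //.
  by rewrite rnV rn_nat ler_piMl// invf_le1.
(* With E := (1 - X)^d A one has 1 - E = X^d B, so w = 1 - E(l / N). *)
pose w (z : Cn R n) : C := (N%:R^-1 ^+ d * 'X^d.[l z]) * B.[u z].
have wE z : w z = (u z) ^+ d * B.[u z] by rewrite /w hornerXn -exprMn.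
have wt := tame_mul (tame_scale (N%:R^-1 ^+ d) ld) (BlN _ ut).
have dt := tame_add (tame_translate (- (th *+ N)) Qt) (tame_scale (-1) St).
have Pt := tame_mul wt dt.
exists N, (fun z => w z *: (Q (z - th *+ N) + -1 *: S z)); split.
  apply: tame_le Pt => //.
  rewrite rnX rnV rn_nat !rnN rn1 mul1r.
  apply: le_trans (_ : cP / N%:R <= _); last first.
    by rewrite ler_pdivrMr// mulrC -ler_pdivrMr.
  rewrite [leLHS](_ : _ = 4 * (4 * K2 * K1) *
    (N%:R^-1 ^+ d * (K0 * (1 + rn (th *+ N)) ^+ D0 + K0))); last by ring.
  rewrite /cP -!mulrA !ler_wpM2l ?(tame_K0 ld) ?(tame_K0 (BlN _ ut))//.
  rewrite [leRHS]mulrC; apply: le_trans (_ : N%:R^-1 ^+ d * (N%:R ^+ D0 *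
    (K0 * T ^+ D0 + K0)) <= _); last by rewrite mulrA adX.
  rewrite ler_wpM2l ?exprn_ge0 ?invr_ge0// mulrDr; apply: lerD; last first.
    by rewrite ler_peMl// exprn_ege1.
  rewrite mulrCA ler_wpM2l// -exprMn lerXn2r ?nnegrE//; try by pos.
  by rewrite rnth /T mulrDr mulr1 lerD2r.
move=> y yrho.
have yr0 : rn y <= r0 by apply: le_trans yrho _; exact: ler_norm.
set z := y + th *+ N.
have uz : u z = 1 + N%:R^-1 * l y.
  have lz : l z = N%:R *: (1 : C^o) + l y by rewrite /z addrC -scaler_nat ll lth.
  by rewrite /u lz mulrDr [_%:R *: _]mulr1 mulVf.
have r00 : 0 <= r0 by exact: normr_ge0.
rewrite addrK.
(* The error is E(1 + l(y) / N) (S(z) - Q(y)), and E vanishes to order d at 1. *)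
have -> : S z + w z *: (Q y + -1 *: S z) - Q y =
    ((1 - u z) ^+ d * A.[u z]) *: (S z - Q y).
  have E : (1 - u z) ^+ d * A.[u z] = 1 - w z.
    have /(congr1 (horner^~ (u z))) := AB.
    by rewrite /= !hornerE wE => E; rewrite -[in RHS]E addrK.
  rewrite E scaleN1r scalerBl scale1r addrAC; congr (_ + _).
  by rewrite -scalerN opprB.
rewrite rnZ rnM rnX.
have e1 : rn (1 - u z) <= N%:R^-1 * (c0 * r0).
  rewrite uz opprD addNKr rnN rnM rnV rn_nat ler_wpM2l ?invr_ge0//.
  by apply: le_trans (lc y) _; rewrite ler_wpM2l.
have e2 : rn A.[u z] <= KA.
  apply: Abound; rewrite uz; apply: le_trans (rnD _ _) _; rewrite rn1 lerD2l.
  rewrite rnM rnV rn_nat; apply: le_trans (_ : rn (l y) <= _).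
    by rewrite ler_piMl ?rn_ge0// invf_le1.
  by apply: le_trans (lc y) _; rewrite ler_wpM2l.
have e3 : rn (S z - Q y) <= N%:R ^+ D0 * (K0 * (T + r0) ^+ D0 + K0 * (1 + r0) ^+ D0).
  apply: le_trans (rnB _ _) _; rewrite mulrDr.
  have [JS [_ SK _ _]] := St; have [JQ [_ QK _ _]] := Qt.
  apply: lerD.
    apply: le_trans (SK _) _; rewrite mulrCA ler_wpM2l// -exprMn.
    rewrite lerXn2r ?nnegrE//; try by pos.
    apply: le_trans (_ : 1 + (rn y + N%:R * rn th) <= _).
      by rewrite lerD2l -rnth rnD.
    rewrite /T !mulrDr mulr1 addrCA [leRHS]addrC lerD//.
      by apply: le_trans yr0 _; rewrite ler_peMl.
    by rewrite lerD2r.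
  apply: le_trans (QK _) _; rewrite [leRHS]mulrCA ler_wpM2l//.
  apply: le_trans (_ : (1 + r0) ^+ D0 <= _).
    by rewrite lerXn2r ?nnegrE ?lerD2l//; pos.
  by rewrite ler_peMl ?exprn_ege1//; pos.
apply: le_trans (_ : cQ / N%:R <= _); last first.
  by rewrite ler_pdivrMr// mulrC -ler_pdivrMr.
have e1' : rn (1 - u z) ^+ d <= (N%:R^-1 * (c0 * r0)) ^+ d.
  by rewrite lerXn2r ?nnegrE ?rn_ge0//; pos; rewrite invr_ge0.
have e12 := ler_pM (exprn_ge0 _ (rn_ge0 _)) (rn_ge0 _) e1' e2.
have := ler_pM (mulr_ge0 (exprn_ge0 _ (rn_ge0 _)) (rn_ge0 _)) (rn_ge0 _) e12 e3.
move/le_trans; apply; rewrite /cQ exprMn.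
rewrite [leRHS](_ : _ = (N%:R^-1 ^+ d * N%:R ^+ D0) * ((c0 * r0) ^+ d * KA *
  (K0 * (T + r0) ^+ D0 + K0 * (1 + r0) ^+ D0))); last by rewrite adX mulrC.
by rewrite le_eqVlt; apply/orP; left; apply/eqP; ring.
Qed.
End Step.

(** * Termwise differentiation of series *)

Section Series.
Variables (R : realType).
Local Notation C := (R[i]).

(** The limit is the infimum of the numbers x_j + b / 2^j: this sequence does not
increase, and it stays above each x_k - b / 2^k. *)
Lemma real_geometric_limit (b : R) (x : nat -> R) : 0 <= b ->
  (forall k, `|x k.+1 - x k| <= b / 2 ^+ k.+1) ->
  exists L, forall k, `|L - x k| <= b / 2 ^+ k.
Proof.
move=> b0 xb.
have half k : b / 2 ^+ k = b / 2 ^+ k.+1 + b / 2 ^+ k.+1.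
  by rewrite exprS invfM mulrCA [2^-1 * _]mulrC -splitr.
have bk k : 0 <= b / 2 ^+ k by rewrite divr_ge0// exprn_ge0.
have anti k j : x (k + j)%N + b / 2 ^+ (k + j) <= x k + b / 2 ^+ k.
  elim: j => [|j ih]; first by rewrite addn0.
  apply: le_trans ih; rewrite addnS [b / 2 ^+ (k + j)]half addrA lerD2r.
  by have := xb (k + j)%N; rewrite ler_norml => /andP[_]; rewrite lerBlDl.
have mono k j : x k - b / 2 ^+ k <= x (k + j)%N - b / 2 ^+ (k + j).
  elim: j => [|j ih]; first by rewrite addn0.
  apply: (le_trans ih); rewrite addnS [b / 2 ^+ (k + j)]half.
  have := xb (k + j)%N; rewrite ler_norml => /andP[h _].
  lra.
have cross k j : x k - b / 2 ^+ k <= x j + b / 2 ^+ j.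
  have := anti j k; have := mono k j; have := bk (j + k)%N; rewrite [(k + j)%N]addnC.
  lra.
pose E := [set x j + b / 2 ^+ j | j in [set: nat]].
have lbE k : lbound E (x k - b / 2 ^+ k) by move=> _ [j _ <-].
exists (inf E) => k; rewrite ler_distl; apply/andP; split.
  by apply: lb_le_inf (lbE k); exists (x 0%N + b / 2 ^+ 0); exists 0%N.
by apply: ge_inf; [exists (x 0%N - b / 2 ^+ 0) | exists k].
Qed.

Lemma geometric_limit m (b : R) (S : nat -> Cn R m) : 0 <= b ->
  (forall k, rn (S k.+1 - S k) <= b / 2 ^+ k.+1) ->
  exists L, forall k, rn (L - S k) <= 2 * b / 2 ^+ k.
Proof.
move=> b0 Sb.
have bk k : 0 <= 2 * b / 2 ^+ k by rewrite divr_ge0 ?mulr_ge0// exprn_ge0.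
have ex j : exists Lj : C, forall k, rn (Lj - S k ord0 j) <= 2 * b / 2 ^+ k.
  have Sj k : rn (S k.+1 ord0 j - S k ord0 j) <= b / 2 ^+ k.+1.
    by apply: le_trans (Sb k); have := rn_coord (S k.+1 - S k) ord0 j; rewrite !mxE.
  have [|Lr Lrp] := @real_geometric_limit b (fun k => complex.Re (S k ord0 j)) b0.
    by move=> k; apply: le_trans (Sj k); rewrite -raddfB; exact: Re_le_rn.
  have [|Li Lip] := @real_geometric_limit b (fun k => complex.Im (S k ord0 j)) b0.
    by move=> k; apply: le_trans (Sj k); rewrite -raddfB; exact: Im_le_rn.
  exists (Lr +i* Li) => k; apply: le_trans (rn_le_ReIm _) _.
  rewrite !raddfB /= -mulrA mulr_natl mulr2n; exact: lerD.
have [L LP] := choice ex.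
exists (\row_j L j) => k; apply: rn_rV_le => // j.
by rewrite !mxE; exact: LP.
Qed.

Lemma le_geometric (x y c : R) : (forall k, x <= y + c / 2 ^+ k) -> x <= y.
Proof.
move=> xy; apply/ler_addgt0Pr => e e0.
have [N N0 Nc] := exists_nat_ge (c / e).
apply: le_trans (xy N) _; rewrite lerD2l ler_pdivrMr ?exprn_gt0//.
rewrite mulrC -ler_pdivrMr//; apply: le_trans Nc _.
by rewrite -natrX ler_nat ltnW// ltn_expl.
Qed.

Lemma geometric_limit_bound (V : normedModType C) (L : V) (S : nat -> V) (x b : R) :
  (forall k, rn (L - S k) <= b / 2 ^+ k) -> (forall k, rn (S k) <= x) -> rn L <= x.
Proof.
move=> LS Sx; apply: (@le_geometric _ _ b) => k.
rewrite -[L](subrK (S k)); apply: le_trans (rnD _ _) _.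
by rewrite [leRHS]addrC lerD.
Qed.

Lemma sum_half (N : nat) : \sum_(k < N) (2 ^+ k.+1)^-1 <= 1 :> R.
Proof.
suff : \sum_(k < N) (2 ^+ k.+1)^-1 + (2 ^+ N)^-1 = 1 :> R.
  by move=> E; rewrite -[leRHS]E lerDl invr_ge0 exprn_ge0.
elim: N => [|N ih]; first by rewrite big_ord0 expr0 invr1 add0r.
by rewrite big_ord_recr /= -[RHS]ih -addrA exprS invfM; congr (_ + _); lra.
Qed.

Variables (n m : nat) (g : R -> R) (D : nat -> nat) (e : nat -> R).
Variables (P : nat -> Cn R n -> Cn R m) (J : nat -> Cn R n -> Cn R n -> Cn R m).
Hypothesis Pt : forall k, tame_diff (D k) (e k) (P k) (J k).
Hypothesis small : forall k r, 0 <= r -> e k * (1 + r) ^+ D k <= g r / 2 ^+ k.+1.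

Let g0 r : 0 <= r -> 0 <= g r.
Proof.
move=> r0; have := small 0%N r0.
have e0 : 0 <= e 0%N by apply: (@tame_K0 _ _ _ _ _ (P 0%N)); exists (J 0%N).
have : 0 <= e 0%N * (1 + r) ^+ D 0%N by pos.
by move=> /le_trans /[apply]; rewrite pmulr_lge0// invr_gt0 exprn_gt0.
Qed.

(** The bound for the differential at [z] holds with every [rho >= |z|], although
[g] need not be monotone, because the majorants e_k (1 + r)^(D_k) are. *)
Lemma tame_series : exists f Jf,
  [/\ forall z k, rn (f z - \sum_(i < k) P i z) <= 2 * g (rn z) / 2 ^+ k,
      forall z, linear (Jf z),
      forall z h rho, rn z <= rho -> rn (Jf z h) <= g rho * rn h,
      forall z, differentiable f z
    & forall z, 'd f z = Jf z :> (_ -> _)].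
Proof.
have exf z : exists L, forall k, rn (L - \sum_(i < k) P i z) <= 2 * g (rn z) / 2 ^+ k.
  apply: geometric_limit; first by rewrite g0 ?rn_ge0.
  move=> k; rewrite big_ord_recr /= addrAC subrr add0r.
  by have [_ Pk _ _] := Pt k; apply: le_trans (Pk z) (small k (rn_ge0 z)).
have exJ zh : exists L, forall k, rn (L - \sum_(i < k) J i zh.1 zh.2) <=
    2 * (g (rn zh.1) * rn zh.2) / 2 ^+ k.
  case: zh => z h /=; apply: geometric_limit; first by rewrite mulr_ge0 ?g0 ?rn_ge0.
  move=> k; rewrite big_ord_recr /= addrAC subrr add0r.
  have [_ _ Jk _] := Pt k; apply: le_trans (Jk z h) _.
  by rewrite [leRHS]mulrAC ler_wpM2r ?rn_ge0// small ?rn_ge0.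
have [f fP] := choice exf; have [Jf' JP'] := choice exJ.
pose Jf z h := Jf' (z, h).
have JP z h k : rn (Jf z h - \sum_(i < k) J i z h) <= 2 * (g (rn z) * rn h) / 2 ^+ k.
  exact: (JP' (z, h)).
have Jlin z : linear (Jf z).
  move=> a u v; apply/eqP; rewrite -subr_eq0; apply/eqP/rn0_eq0/eqP.
  rewrite eq_le rn_ge0 andbT.
  apply: (@geometric_limit_bound _ _ (fun=> 0) 0
    (2 * (g (rn z) * rn (a *: u + v)) + (rn a * (2 * (g (rn z) * rn u)) +
       2 * (g (rn z) * rn v)))); last by move=> _; rewrite rn0.
  move=> k; rewrite subr0.
  have E : \sum_(i < k) J i z (a *: u + v) =
      a *: \sum_(i < k) J i z u + \sum_(i < k) J i z v.
    rewrite scaler_sumr -big_split /=; apply: eq_bigr => i _.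
    by have [Jl _ _ _] := Pt i; rewrite Jl.
  apply: le_trans (rn_tri (\sum_(i < k) J i z (a *: u + v)) _ _) _.
  rewrite mulrDl; apply: lerD; first exact: JP.
  rewrite E opprD addrACA -scalerBr mulrDl; apply: le_trans (rnD _ _) _.
  apply: lerD; last by rewrite rn_distC; exact: JP.
  by rewrite rnZ -mulrA ler_wpM2l ?rn_ge0// rn_distC JP.
have Jb z h rho : rn z <= rho -> rn (Jf z h) <= g rho * rn h.
  move=> zr; have rho0 := le_trans (rn_ge0 z) zr.
  apply: geometric_limit_bound (JP z h) _ => k.
  apply: le_trans (rn_sum _ _ _) _.
  apply: le_trans (_ : \sum_(i < k) (g rho * rn h) * (2 ^+ i.+1)^-1 <= _).
    apply: ler_sum => i _; have [_ _ Ji _] := Pt i; apply: le_trans (Ji z h) _.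
    rewrite [leRHS]mulrAC ler_wpM2r ?rn_ge0//.
    apply: le_trans (small i rho0); rewrite ler_wpM2l//.
      by apply: (@tame_K0 _ _ _ _ _ (P i)); exists (J i).
    by rewrite lerXn2r ?nnegrE ?addr_ge0 ?rn_ge0// lerD2l.
  rewrite -mulr_sumr ler_piMr ?sum_half//.
  by rewrite mulr_ge0 ?g0 ?rn_ge0.
have rem z h : rn h <= 1 ->
    rn (f (z + h) - f z - Jf z h) <= g (rn z + 1) * rn h ^+ 2.
  move=> h1.
  pose Sk k := \sum_(i < k) (P i (z + h) - P i z - J i z h).
  have gz0 : 0 <= g (rn z + 1) by rewrite g0// addr_ge0 ?rn_ge0.
  apply: (@geometric_limit_bound _ _ Sk _
    (2 * g (rn (z + h)) + 2 * g (rn z) + 2 * (g (rn z) * rn h))) => k.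
    rewrite /Sk !sumrB [leRHS]mulrDl [X in _ <= X + _]mulrDl.
    have -> (A B c X Y Z : Cn R m) : A - B - c - (X - Y - Z) = (A - X) - (B - Y) - (c - Z).
      by rewrite !opprD [LHS]addrACA [A - B + _]addrACA.
    apply: le_trans (rnB _ _) _; apply: lerD; last exact: JP.
    by apply: le_trans (rnB _ _) _; apply: lerD; exact: fP.
  apply: le_trans (rn_sum _ _ _) _.
  apply: le_trans (_ : \sum_(i < k) (g (rn z + 1) * rn h ^+ 2) * (2 ^+ i.+1)^-1 <= _).
    apply: ler_sum => i _; have [_ _ _ Ji] := Pt i; apply: le_trans (Ji z h) _.
    rewrite [leRHS]mulrAC ler_wpM2r ?exprn_ge0 ?rn_ge0//.
    have zr0 : 0 <= rn z + 1 by pos.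
    apply: le_trans (small i zr0).
    rewrite ler_wpM2l//; first by apply: (@tame_K0 _ _ _ _ _ (P i)); exists (J i).
    by rewrite lerXn2r ?nnegrE; pos; rewrite addrA lerD2l.
  rewrite -mulr_sumr ler_piMr ?sum_half//.
  by rewrite mulr_ge0// exprn_ge0 ?rn_ge0.
have dP z : differentiable f z /\ 'd f z = Jf z :> (_ -> _).
  pose Jz := HB.pack_for {linear Cn R n -> Cn R m} (Jf z)
    (GRing.isLinear.Build _ _ _ _ (Jf z) (Jlin z)).
  apply: (@rn_differentiable _ _ _ f z Jz (g (rn z))) => [|h|d d0].
  - by rewrite g0 ?rn_ge0.
  - exact: Jb.
  have gz0 : 0 <= g (rn z + 1) by rewrite g0// addr_ge0 ?rn_ge0.
  have gz1 : 0 < g (rn z + 1) + 1 by rewrite ltr_wpDl.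
  exists (Num.min 1 (d / (g (rn z + 1) + 1))).
    by rewrite lt_min ltr01 divr_gt0.
  move=> h; rewrite lt_min => /andP[/ltW h1 hd].
  apply: le_trans (rem z h h1) _; rewrite expr2 mulrA ler_wpM2r ?rn_ge0//.
  move: hd; rewrite ltr_pdivlMr// => /ltW; apply: le_trans.
  by rewrite mulrC ler_wpM2l ?rn_ge0// lerDl.
exists f, Jf; split=> // z; first by have [] := dP z.
by have [] := dP z.
Qed.

End Series.

(** * The recursive construction *)

Section Recursion.
Variables (R : realType) (n m : nat).
Variables (th : nat -> Cn R n) (Q : nat -> Cn R n -> Cn R m) (g : R -> R).
Hypothesis th0 : forall i, th i != 0.
Hypothesis Qt : forall q, exists D K, tame D K (Q q).
Hypothesis gbig : forall D : nat, exists2 e : R, 0 < e &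
  forall r, 0 <= r -> e * (1 + r) ^+ D <= g r.

(** The sum of the corrections made so far, and a radius such that the ball of this
radius contains all the places where a target has been approximated. *)
Record state := State {
  part : Cn R n -> Cn R m;
  radius : R;
  part_tame : exists D K, tame D K part;
  radius_ge0 : 0 <= radius }.

Record choice_data := Choice_data {
  shift_nb : nat; corr : Cn R n -> Cn R m; dcorr : Cn R n -> Cn R n -> Cn R m;
  deg : nat; eps : R }.

(** The direction and the target treated at stage [k]. They are read off the exponent
of 2 in [k], so each pair comes back at arbitrarily late stages. *)
Definition task (k : nat) : nat * nat := odflt (0%N, 0%N) (unpickle (logn 2 k)).

(** The second condition keeps the final map below [g]; the third one protects the
approximations of the earlier stages. *)
Definition valid (kx : nat * state) (c : choice_data) : Prop :=
  let: (k, x) := kx in let t := th (task k).1 in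
  [/\ tame_diff (deg c) (eps c) (corr c) (dcorr c),
      forall r, 0 <= r -> eps c * (1 + r) ^+ deg c <= g r / 2 ^+ k.+1,
      eps c * (1 + radius x) ^+ deg c <= (2 ^+ k.+1)^-1
    & forall y, rn y <= k%:R ->
      rn (part x (y + t *+ shift_nb c) + corr c (y + t *+ shift_nb c)
          - Q (task k).2 y) <= (2 ^+ k)^-1].

Lemma valid_exists kx : exists c, valid kx c.
Proof.
case: kx => k x; rewrite /valid.
have [DS [KS St]] := part_tame x; have [DQ [KQ Qt']] := Qt (task k).2.
have dl0 : 0 < (2 ^+ k)^-1 :> R by rewrite invr_gt0 exprn_gt0.
have [D HD] := translation_step k%:R (th0 (task k).1) St Qt' dl0.
have [e e0 eg] := gbig D.
have r1 : 0 < (1 + radius x) ^+ D by rewrite exprn_gt0// ltr_wpDr ?radius_ge0.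
have k2 : 0 < 2 ^+ k.+1 :> R by rewrite exprn_gt0.
have [] := HD (Num.min (e / 2 ^+ k.+1) ((1 + radius x) ^- D / 2 ^+ k.+1)).
  by rewrite lt_min !divr_gt0// invr_gt0.
move=> N [P [[J PJ] Pc]].
exists (Choice_data N P J D (Num.min (e / 2 ^+ k.+1) ((1 + radius x) ^- D / 2 ^+ k.+1))).
split=> //= [r rp|].
  apply: le_trans (_ : e / 2 ^+ k.+1 * (1 + r) ^+ D <= _).
    by rewrite ler_wpM2r ?exprn_ge0 ?addr_ge0// ge_min lexx.
  by rewrite mulrAC ler_wpM2r ?invr_ge0 ?(ltW k2)// eg.
apply: le_trans (_ : (1 + radius x) ^- D / 2 ^+ k.+1 * (1 + radius x) ^+ D <= _).
  by rewrite ler_wpM2r ?(ltW r1)// ge_min lexx orbT.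
by rewrite mulrAC mulVf ?gt_eqF// mul1r.
Qed.

(** At a stage [k] devoted to the direction [i] and the target [q], the partial sum
is within 2^-k of the target, and all later corrections together move it by at
most 2^-(k+1) on the ball concerned. *)
Lemma slow_universal : exists f : Cn R n -> Cn R m,
  [/\ forall z, differentiable f z,
      forall z h rho, rn z <= rho -> rn ('d f z h) <= g rho * rn h
    & forall i q k0, exists k N, (k0 <= k)%N /\
      forall y, rn y <= k%:R -> rn (f (y + th i *+ N) - Q q y) <= 2 / 2 ^+ k].
Proof.
have [pick pickP] := choice valid_exists.
have next_tame k x : exists D K, tame D K (fun z => part x z + corr (pick (k, x)) z).
  have [DS [KS St]] := part_tame x; have [Pt _ _ _] := pickP (k, x).
  have {}Pt : tame (deg (pick (k, x))) (eps (pick (k, x))) (corr (pick (k, x))).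
    by exists (dcorr (pick (k, x))).
  exists (maxn DS (deg (pick (k, x)))), (KS + eps (pick (k, x))).
  apply: tame_add; first exact: tame_le (leq_maxl _ _) _ St.
  exact: tame_le (leq_maxr _ _) _ Pt.
have next_rad k x : 0 <= Num.max (radius x)
    (k%:R + rn (th (task k).1 *+ shift_nb (pick (k, x)))).
  by rewrite le_max radius_ge0.
pose next k x := State (next_tame k x) (next_rad k x).
have t0 : exists D K, tame D K (fun _ : Cn R n => 0 : Cn R m).
  by exists 0%N, (rn (0 : Cn R m)); exact: tame_cst.
pose st := fix F k := if k is k'.+1 then next k' (F k') else State t0 (lexx (0 : R)).
pose c k := pick (k, st k).
have cP k : valid (k, st k) (c k) by exact: pickP.
have partE k z : part (st k) z = \sum_(i < k) corr (c i) z.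
  by elim: k => [|k ih]; rewrite ?big_ord0// big_ord_recr /= -ih.
have Pt k : tame_diff (deg (c k)) (eps (c k)) (corr (c k)) (dcorr (c k)).
  by have [] := cP k.
have small k r : 0 <= r -> eps (c k) * (1 + r) ^+ deg (c k) <= g r / 2 ^+ k.+1.
  by have [_ + _ _] := cP k; apply.
have [f [Jf [fS _ Jb fd fJ]]] := tame_series Pt small.
exists f; split=> // [z h rho zr|i q k0]; first by rewrite fJ; exact: Jb.
pose p := pickle (i, q).
(* A number above k0 whose exponent of 2 encodes the pair (i, q). *)
pose k := (2 ^ p * 3 ^ k0)%N.
have tk : task k = (i, q).
  rewrite /task /k lognM ?expn_gt0// pfactorK//.
  by rewrite lognX (_ : logn 2 3 = 0)%N// muln0 addn0 pickleK.
exists k, (shift_nb (c k)); split.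
  apply: leq_trans (_ : 3 ^ k0 <= _)%N; first exact/ltnW/ltn_expl.
  by rewrite leq_pmull// expn_gt0.
move=> y yk; have [_ _ _ /(_ y yk)] := cP k; rewrite tk /=.
set z := y + _ => Sz.
have zr : rn z <= radius (st k.+1).
  rewrite /= le_max; apply/orP; right; rewrite tk /=.
  by apply: le_trans (rnD _ _) _; rewrite lerD2r.
have rmono (j : nat) : radius (st k.+1) <= radius (st (k.+1 + j)%N).
  elim: j => [|j ih]; first by rewrite addn0 lexx.
  by apply: le_trans ih _; rewrite addnS /= le_max lexx.
have corr_le (j : nat) : rn (corr (c (k.+1 + j)%N) z) <= (2 ^+ (k.+1 + j)%N.+1)^-1.
  have [[_ Pk _ _] _ cis_primitive _] := cP (k.+1 + j)%N; apply: le_trans cis_primitive.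
  apply: le_trans (Pk z) _; rewrite ler_wpM2l//.
    by apply: (@tame_K0 _ _ _ _ _ (corr (c (k.+1 + j)%N))); eexists; exact: Pt.
  rewrite lerXn2r ?nnegrE ?addr_ge0 ?rn_ge0 ?radius_ge0// lerD2l.
  exact: le_trans zr (rmono j).
have tail (j : nat) : rn (part (st (k.+1 + j)%N) z - part (st k.+1) z)
    <= (2 ^+ k.+1)^-1 - (2 ^+ (k.+1 + j)%N)^-1.
  elim: j => [|j ih]; first by rewrite addn0 !subrr rn0.
  rewrite addnS [part (st _.+1) z]/(part (st (k.+1 + j)%N) z + corr (c (k.+1 + j)%N) z).
  rewrite addrAC; apply: le_trans (rnD _ _) _.
  have E : (2 ^+ (k.+1 + j)%N)^-1 = (2 ^+ (k.+1 + j)%N.+1)^-1 + (2 ^+ (k.+1 + j)%N.+1)^-1 :> R.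
    by rewrite exprS invfM; lra.
  have := corr_le j; lra.
have fk : rn (f z - part (st k.+1) z) <= (2 ^+ k.+1)^-1.
  apply: (@le_geometric _ _ _ (2 * g (rn z))) => j.
  apply: le_trans (rn_tri (part (st (k.+1 + j)%N) z) _ _) _.
  rewrite addrC; apply: lerD.
    by apply: le_trans (tail j) _; rewrite gerBl invr_ge0 exprn_ge0.
  rewrite partE; apply: le_trans (fS z _) _.
  rewrite ler_wpM2l//.
    have gz := small 0%N _ (rn_ge0 z); rewrite mulr_ge0//.
    have := le_trans (mulr_ge0 (tame_K0 (ex_intro _ _ (Pt 0%N))) (exprn_ge0 _ _)) gz.
    rewrite pmulr_lge0 ?invr_gt0 ?exprn_gt0//; apply.
    by rewrite addr_ge0 ?rn_ge0.
  rewrite lef_pV2 ?posrE ?exprn_gt0// ler_weXn2l ?ler1n//.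
  exact: leq_addl.
apply: le_trans (rn_tri (part (st k.+1) z) _ _) _.
apply: le_trans (lerD fk Sz) _.
have : 0 <= (2 ^+ k)^-1 :> R by rewrite invr_ge0 exprn_ge0.
by rewrite exprS invfM; lra.
Qed.

End Recursion.

(** * Room between the powers and the prescribed growth *)

(** Take for g(r)^2 the quotient of r^psi(r) by c r^e. Once psi(r) exceeds 2 D + e,
this quotient is above r^(2 D) / c; on the remaining bounded interval it is
bounded below by a positive constant. *)
Lemma growth_majorant (R : realType) (psi : R -> R) (c : R) (e : nat) :
  (forall r, 1 <= r -> 0 < psi r) -> (psi r @[r --> +oo] --> +oo) -> 1 <= c ->
  exists g : R -> R,
    (forall r, 1 <= r -> c * r ^+ e * g r ^+ 2 = r `^ psi r) /\
    (forall D : nat, exists2 eps : R, 0 < eps &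
       forall r, 0 <= r -> eps * (1 + r) ^+ D <= g r).
Proof.
move=> psi0 psioo c1; have c0 := lt_le_trans ltr01 c1.
pose s (r : R) := Num.max 1 r.
have s1 r : 1 <= s r by rewrite le_max lexx.
have s0 r : 0 < s r := lt_le_trans ltr01 (s1 r).
pose q r := s r `^ psi (s r) / (c * s r ^+ e).
have q0 r : 0 <= q r by rewrite divr_ge0 ?powR_ge0// mulr_ge0 ?exprn_ge0 ?(ltW (s0 r)) ?(ltW c0).
exists (fun r => Num.sqrt (q r)); split=> [r r1|D].
  rewrite sqr_sqrtr// /q (_ : s r = r); last exact/max_idPr.
  by rewrite mulrC divfK// mulf_neq0 ?gt_eqF// exprn_gt0// (lt_le_trans _ r1).
pose M := (D + D + e)%N.
have [A A1 AM] : exists2 A : R, 1 <= A & forall r, A <= r -> M%:R <= psi r.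
  have /cvgryPge/(_ M%:R) [A [_ AP]] := psioo.
  exists (Num.max 1 (A + 1)); first by rewrite le_max lexx.
  move=> r; rewrite ge_max => /andP[_ Ar]; apply: AP.
  by apply: lt_le_trans Ar; rewrite ltrDl.
have A0 : 0 < A := lt_le_trans ltr01 A1.
pose B := 4 ^+ D * (c * A ^+ M).
have B1 : 1 <= B.
  rewrite -[1]mul1r ler_pM ?exprn_ege1//; first by rewrite ler1n.
  by rewrite -[1]mul1r ler_pM// exprn_ege1.
have B0 : 0 < B := lt_le_trans ltr01 B1.
exists B^-1; first by rewrite invr_gt0.
move=> r r0; rewrite -[leLHS]ger0_norm; last by rewrite mulr_ge0 ?invr_ge0 ?(ltW B0)// exprn_ge0// addr_ge0.
rewrite -sqrtr_sqr ler_wsqrtr// /q ler_pdivlMr; last by rewrite mulr_gt0// exprn_gt0.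
have rs : 1 + r <= 2 * s r.
  have rs : r <= s r by rewrite le_max lexx orbT.
  by have := s1 r; lra.
have key : s r ^+ M <= A ^+ M * s r `^ psi (s r).
  have [Ar|rA] := leP A (s r).
    apply: le_trans (_ : s r `^ psi (s r) <= _); last first.
      by rewrite ler_peMl ?powR_ge0// exprn_ege1.
    by rewrite -powR_mulrn ?(ltW (s0 r))// ler_powR// AM.
  apply: le_trans (_ : A ^+ M <= _).
    by rewrite lerXn2r ?nnegrE ?(ltW (s0 r)) ?(ltW A0)// ltW.
  rewrite ler_peMr ?exprn_ge0 ?(ltW A0)//.
  by rewrite -[leLHS](powRr0 (s r)) ler_powR// ltW// psi0.
have XY : (1 + r) ^+ D <= (2 * s r) ^+ D.
  by rewrite lerXn2r ?nnegrE ?addr_ge0 ?mulr_ge0 ?(ltW (s0 r)).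
have X0 : 0 <= (1 + r) ^+ D by rewrite exprn_ge0 ?addr_ge0.
have h1 : (B^-1 * (1 + r) ^+ D) ^+ 2 <= B^-1 * ((2 * s r) ^+ D * (2 * s r) ^+ D).
  rewrite exprMn !expr2 ler_pM ?mulr_ge0 ?invr_ge0 ?(ltW B0)//; last exact: ler_pM.
  by rewrite ler_piMl ?invr_ge0 ?(ltW B0)// invf_le1.
have cs0 : 0 <= c * s r ^+ e by rewrite mulr_ge0 ?exprn_ge0 ?(ltW (s0 r)) ?(ltW c0).
apply: le_trans (ler_wpM2r cs0 h1) _; rewrite -mulrA.
rewrite ler_pdivrMl// /B.
rewrite [leLHS](_ : _ = 4 ^+ D * (c * s r ^+ M)); last first.
  rewrite /M !exprMn !exprD (_ : 4 = 2 * 2); last by ring.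
  by rewrite exprMn; ring.
rewrite -!mulrA ler_wpM2l ?exprn_ge0// ler_wpM2l ?(ltW c0)//.
Qed.

(** * Complex curves, primitives and the bisection of rectangles *)

Section Curves.
Variables (R : realType) (A : R).
Local Notation C := (R[i]).
Implicit Types U u : R -> C.

(** Componentwise derivative on the half-line above [A], on which a primitive is
given by integration from [A]. *)
Definition cder U u := forall t, A < t ->
  is_derive t 1 (fun x => complex.Re (U x)) (complex.Re (u t)) /\
  is_derive t 1 (fun x => complex.Im (U x)) (complex.Im (u t)).

Lemma cder_ext U u u' : (forall t, A < t -> u t = u' t) -> cder U u -> cder U u'.
Proof. by move=> uu Uu t At; rewrite -uu//; exact: Uu. Qed.

Lemma cderD U V u v : cder U u -> cder V v ->
  cder (fun t => U t + V t) (fun t => u t + v t).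
Proof.
move=> Uu Vv t At; have [ur ui] := Uu t At; have [vr vi] := Vv t At.
split.
  have -> : (fun x => complex.Re (U x + V x)) =
    (fun x => complex.Re (U x)) + (fun x => complex.Re (V x)).
    by apply/funext => x; rewrite raddfD.
  by rewrite raddfD; exact: is_deriveD.
have -> : (fun x => complex.Im (U x + V x)) =
  (fun x => complex.Im (U x)) + (fun x => complex.Im (V x)).
  by apply/funext => x; rewrite raddfD.
by rewrite raddfD; exact: is_deriveD.
Qed.

Lemma complex_ReM (a b : C) : complex.Re (a * b) =
  complex.Re a * complex.Re b - complex.Im a * complex.Im b.
Proof. by case: a; case: b. Qed.

Lemma complex_ImM (a b : C) : complex.Im (a * b) =
  complex.Re a * complex.Im b + complex.Im a * complex.Re b.
Proof. by case: a => a1 a2; case: b => b1 b2 /=. Qed.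

Lemma cderZ (c : C) U u : cder U u -> cder (fun t => c * U t) (fun t => c * u t).
Proof.
move=> Uu t At; have [ur ui] := Uu t At; split.
  have -> : (fun x => complex.Re (c * U x)) =
    complex.Re c \*: (fun x => complex.Re (U x)) - complex.Im c \*: (fun x => complex.Im (U x)).
    by apply/funext => x; rewrite complex_ReM.
  by rewrite complex_ReM; exact: is_deriveB.
have -> : (fun x => complex.Im (c * U x)) =
  complex.Re c \*: (fun x => complex.Im (U x)) + complex.Im c \*: (fun x => complex.Re (U x)).
  by apply/funext => x; rewrite complex_ImM.
by rewrite complex_ImM; exact: is_deriveD.
Qed.

Lemma cderB U V u v : cder U u -> cder V v ->
  cder (fun t => U t - V t) (fun t => u t - v t).
Proof.
move=> Uu /(cderZ (-1)) Vv; have := cderD Uu Vv.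
have E (f g : R -> C) : (fun t => f t + -1 * g t) = (fun t => f t - g t).
  by apply/funext => t; rewrite mulN1r.
by rewrite !E.
Qed.

Lemma cder_cst (c : C) : cder (fun=> c) (fun=> 0).
Proof. by move=> t At; split; exact: is_derive_cst. Qed.

Lemma cder_sum (I : Type) (s : seq I) (U u : I -> R -> C) :
  (forall i, cder (U i) (u i)) ->
  cder (fun t => \sum_(i <- s) U i t) (fun t => \sum_(i <- s) u i t).
Proof.
move=> Uu; elim: s => [|i s ih].
  have E (f : I -> R -> C) : (fun t => \sum_(i <- [::]) f i t) = (fun=> 0).
    by apply/funext => t; rewrite big_nil.
  by rewrite !E; exact: cder_cst.
have E (f : I -> R -> C) : (fun t => \sum_(j <- i :: s) f j t) =
    (fun t => f i t + \sum_(j <- s) f j t).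
  by apply/funext => t; rewrite big_cons.
by rewrite !E; exact: cderD.
Qed.

(** Mean value theorem for each component, whence the factor 2. Integrals of complex
functions occur below only as increments of primitives, and this lemma is the
estimate for them. *)
Lemma cder_le U u (a b K : R) : A < a -> a <= b -> cder U u ->
  (forall t, a <= t <= b -> rn (u t) <= K) -> rn (U b - U a) <= 2 * K * (b - a).
Proof.
move=> Aa ab Uu uK.
have real (f df : R -> R) : (forall t, A < t -> is_derive t 1 f (df t)) ->
    (forall t, a <= t <= b -> `|df t| <= K) -> `|f b - f a| <= K * (b - a).
  move=> fdf dfK.
  have [t tab ->] : exists2 t, t \in `[a, b] & f b - f a = df t * (b - a).
    apply: MVT_segment => // [t|].
      by rewrite in_itv /= => /andP[/(lt_trans Aa) /fdf].
    apply: derivable_within_continuous => t; rewrite in_itv /= => /andP[ta _].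
    by have [] := fdf t (lt_le_trans Aa ta).
  rewrite normrM [X in _ * X]ger0_norm ?subr_ge0// ler_wpM2r ?subr_ge0// dfK//.
apply: le_trans (rn_le_ReIm _) _; rewrite !raddfB /= -mulrA mulr_natl mulr2n.
apply: lerD.
  apply: (real (fun t => complex.Re (U t)) (fun t => complex.Re (u t))).
    by move=> t /Uu[].
  by move=> t /uK; apply: le_trans; exact: Re_le_rn.
apply: (real (fun t => complex.Im (U t)) (fun t => complex.Im (u t))).
  by move=> t /Uu[].
by move=> t /uK; apply: le_trans; exact: Im_le_rn.
Qed.

Lemma real_primitive (f : R -> R) : continuous f ->
  exists F, forall t, A < t -> is_derive t 1 F (f t).
Proof.
move=> fc; exists (fun x => \int[lebesgue_measure]_(y in `[A, x]) f y)%R => t At.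
have [] := @continuous_FTC1_closed R f A t (t + 1) _ _ At (fc t).
- by rewrite ltrDl.
- apply: continuous_compact_integrable; first exact: segment_compact.
  exact: continuous_subspaceT.
by move=> d1 d2; apply: DeriveDef => //; rewrite -derive1E.
Qed.

Definition cont u := continuous (fun t => complex.Re (u t)) /\
                     continuous (fun t => complex.Im (u t)).

Lemma cder_primitive u : cont u -> exists U, cder U u.
Proof.
move=> [/real_primitive[Fr Frp] /real_primitive[Fi Fip]].
by exists (fun t => Fr t +i* Fi t) => t At; split; [exact: Frp|exact: Fip].
Qed.

Lemma cont_rn u : (forall t e, 0 < e -> exists2 d, 0 < d &
  forall t', `|t' - t| < d -> rn (u t' - u t) < e) -> cont u.
Proof.
move=> uc; split=> t; apply/cvgrPdist_lt => e e0; have [d d0 dP] := uc t e e0.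
  apply/nbhs_ballP; exists d => //= t' tt'.
  rewrite distrC -raddfB; apply: le_lt_trans (Re_le_rn _) _; apply: dP.
  by rewrite distrC.
apply/nbhs_ballP; exists d => //= t' tt'.
rewrite distrC -raddfB; apply: le_lt_trans (Im_le_rn _) _; apply: dP.
by rewrite distrC.
Qed.

End Curves.

Section Bisection.
Variables (R : realType).
Local Notation C := (R[i]).
Variable F : R -> R -> R -> R -> C.
Hypothesis Fs : forall a m b c d, F a b c d = F a m c d + F m b c d.
Hypothesis Ft : forall a b c m d, F a b c d = F a b c m + F a b m d.

(** Goursat's argument. Quarter the rectangle repeatedly, each time keeping a quarter
where [F] has at least one fourth of its norm. The quarters shrink to a point,
and the local bound there, quadratic in the size of the rectangle, leaves no
room for a nonzero value of [F] on the original one. *)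
Lemma rectangle_bisection (a b c d : R) : a <= b -> c <= d ->
  (forall s t e, a <= s <= b -> c <= t <= d -> 0 < e -> exists2 dl, 0 < dl &
     forall a' b' c' d', a <= a' -> a' <= s <= b' -> b' <= b ->
       c <= c' -> c' <= t <= d' -> d' <= d -> b' - a' < dl -> d' - c' < dl ->
       rn (F a' b' c' d') <= e * ((b' - a') + (d' - c')) ^+ 2) ->
  F a b c d = 0.
Proof.
move=> ab cd loc.
pose L := b - a; pose M := d - c.
have L0 : 0 <= L by rewrite subr_ge0.
have M0 : 0 <= M by rewrite subr_ge0.
pose G k (p : R * R) := F p.1 (p.1 + L / 2 ^+ k) p.2 (p.2 + M / 2 ^+ k).
have half x k : x / 2 ^+ k = x / 2 ^+ k.+1 + x / 2 ^+ k.+1 :> R.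
  by rewrite exprS invfM mulrCA [2^-1 * _]mulrC -splitr.
have stepE (kp : nat * (R * R)) : exists q : R * R,
    [/\ rn (G kp.1 kp.2) <= 4 * rn (G kp.1.+1 q),
        kp.2.1 <= q.1, q.1 + L / 2 ^+ kp.1.+1 <= kp.2.1 + L / 2 ^+ kp.1,
        kp.2.2 <= q.2 & q.2 + M / 2 ^+ kp.1.+1 <= kp.2.2 + M / 2 ^+ kp.1].
  case: kp => k [x y] /=.
  set Lk := L / 2 ^+ k.+1; set Mk := M / 2 ^+ k.+1.
  have Lk0 : 0 <= Lk by rewrite divr_ge0// exprn_ge0.
  have Mk0 : 0 <= Mk by rewrite divr_ge0// exprn_ge0.
  have LE : L / 2 ^+ k = Lk + Lk by exact: half.
  have ME : M / 2 ^+ k = Mk + Mk by exact: half.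
  have GE : G k (x, y) = G k.+1 (x, y) + G k.+1 (x, y + Mk) +
      (G k.+1 (x + Lk, y) + G k.+1 (x + Lk, y + Mk)).
    rewrite /G /= LE ME -/Lk -/Mk !addrA (Fs _ (x + Lk)).
    by rewrite (Ft x _ y (y + Mk)) (Ft (x + Lk) _ y (y + Mk)) !addrA.
  have tri : rn (G k (x, y)) <= rn (G k.+1 (x, y)) + rn (G k.+1 (x, y + Mk)) +
      (rn (G k.+1 (x + Lk, y)) + rn (G k.+1 (x + Lk, y + Mk))).
    rewrite GE; apply: le_trans (rnD _ _) _.
    by apply: lerD; exact: rnD.
  have [h1|h1] := leP (rn (G k (x, y))) (4 * rn (G k.+1 (x, y))).
    by exists (x, y); split=> //=; lra.
  have [h2|h2] := leP (rn (G k (x, y))) (4 * rn (G k.+1 (x, y + Mk))).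
    by exists (x, y + Mk); split=> //=; lra.
  have [h3|h3] := leP (rn (G k (x, y))) (4 * rn (G k.+1 (x + Lk, y))).
    by exists (x + Lk, y); split=> //=; lra.
  exists (x + Lk, y + Mk); split=> //=; lra.
have [next nextP] := choice stepE.
pose p := fix p k := if k is k'.+1 then next (k', p k') else (a, c).
have pP k := nextP (k, p k); rewrite /= in pP.
have norm k : rn (F a b c d) <= 4 ^+ k * rn (G k (p k)).
  elim: k => [|k ih].
    by rewrite expr0 mul1r /G /= !divr1 /L /M ![_ + (_ - _)]addrC !subrK.
  apply: le_trans ih _; rewrite exprSr -mulrA ler_wpM2l ?exprn_ge0//.
  by have [] := pP k.
have nest (q : nat -> R) W : 0 <= W -> (forall k, q k <= q k.+1 /\
     q k.+1 + W / 2 ^+ k.+1 <= q k + W / 2 ^+ k) ->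
   exists x, forall k, q 0%N <= q k /\ q k <= x <= q k + W / 2 ^+ k /\
     q k + W / 2 ^+ k <= q 0%N + W.
  move=> W0 qP.
  have [|x xP] := @real_geometric_limit R W q W0.
    move=> k; have [q1 q2] := qP k; rewrite ger0_norm ?subr_ge0//.
    by move: q2; rewrite (half W k) addrA lerD2r lerBlDl.
  have up k j : q k <= q (k + j)%N.
    by elim: j => [|j ih]; rewrite ?addn0// addnS (le_trans ih)//; have [] := qP (k + j)%N.
  have dn k : q k + W / 2 ^+ k <= q 0%N + W.
    by elim: k => [|k ih]; [rewrite divr1|apply: le_trans ih; have [] := qP k].
  exists x => k; split; first by rewrite -[k]add0n.
  split=> //; apply/andP; split; last first.
    by have := xP k; rewrite ler_distl => /andP[_].
  apply: (@le_geometric _ _ _ W) => j.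
  apply: le_trans (up k j) _.
  have := xP (k + j)%N; rewrite ler_distl => /andP[+ _].
  rewrite lerBlDr => /le_trans; apply; rewrite lerD2l ler_wpM2l//.
  by rewrite lef_pV2 ?posrE ?exprn_gt0// ler_weXn2l ?ler1n// leq_addl.
have [s sP] := nest (fun k => (p k).1) L L0 (fun k => let: And5 _ h1 h2 _ _ := pP k in conj h1 h2).
have [t tP] := nest (fun k => (p k).2) M M0 (fun k => let: And5 _ _ _ h1 h2 := pP k in conj h1 h2).
have aL : a + L = b by rewrite /L addrC subrK.
have cM : c + M = d by rewrite /M addrC subrK.
apply/rn0_eq0/eqP; rewrite eq_le rn_ge0 andbT.
apply/ler_addgt0Pr => e e0; rewrite add0r.
have LM0 : 0 < (L + M) ^+ 2 + 1 by apply: ltr_wpDl; rewrite ?sqr_ge0.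
have [|||dl dl0 dlP] := loc s t (e / ((L + M) ^+ 2 + 1)).
- by have [_ [+ _]] := sP 0%N; rewrite /= expr0 divr1 aL.
- by have [_ [+ _]] := tP 0%N; rewrite /= expr0 divr1 cM.
- by rewrite divr_gt0.
have [N N0 NP] := exists_nat_ge ((L + M + 1) / dl).
have N2 : (L + M + 1) / 2 ^+ N < dl.
  rewrite ltr_pdivrMr ?exprn_gt0// -ltr_pdivrMl// mulrC.
  by apply: le_lt_trans NP _; rewrite -natrX ltr_nat ltn_expl.
have LN : L / 2 ^+ N < dl.
  apply: le_lt_trans N2; rewrite ler_wpM2r ?invr_ge0 ?exprn_ge0//.
  by rewrite -addrA lerDl addr_ge0.
have MN : M / 2 ^+ N < dl.
  apply: le_lt_trans N2; rewrite ler_wpM2r ?invr_ge0 ?exprn_ge0//.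
  by rewrite addrAC lerDr addr_ge0.
have [s1 [s2 s3]] := sP N; have [t1 [t2 t3]] := tP N.
rewrite /= aL in s1 s3; rewrite /= cM in t1 t3.
apply: le_trans (norm N) _; rewrite /G.
have := dlP (p N).1 ((p N).1 + L / 2 ^+ N) (p N).2 ((p N).2 + M / 2 ^+ N) s1 s2 s3 t1 t2 t3.
rewrite ![_ + _ / _ - _]addrC !addKr => /(_ LN MN) GN.
apply: le_trans (ler_wpM2l _ GN) _; first by rewrite exprn_ge0.
have E4 : 4 ^+ N = (2 ^+ N) ^+ 2 :> R.
  by rewrite -exprM mulnC exprM (_ : 2 ^+ 2 = 4)//; ring.
have S0 : (2 ^+ N) ^+ 2 != 0 :> R by rewrite gt_eqF// !exprn_gt0.
rewrite -mulrDl expr_div_n E4 mulrCA [(2 ^+ N) ^+ 2 * _]mulrC divfK//.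
rewrite mulrAC ler_pdivrMr// ler_wpM2l ?(ltW e0)//.
by rewrite lerDl.
Qed.

End Bisection.

(** * The Cauchy formula on a circle *)

Section CurveContinuity.
Variable R : realType.
Local Notation C := (R[i]).
Implicit Types U u v : R -> C.

Lemma rn_cont u : cont u -> forall t e, 0 < e -> exists2 d, 0 < d &
  forall t', `|t' - t| < d -> rn (u t' - u t) < e.
Proof.
move=> [cr ci] t e e0; have e20 : 0 < e / 2 by rewrite divr_gt0.
have /cvgrPdist_lt /(_ _ e20) /nbhs_ballP[d1 /= d10 d1P] := cr t.
have /cvgrPdist_lt /(_ _ e20) /nbhs_ballP[d2 /= d20 d2P] := ci t.
exists (Num.min d1 d2); first by rewrite lt_min d10.
move=> t'; rewrite lt_min => /andP[t1 t2].
apply: le_lt_trans (rn_le_ReIm _) _; rewrite !raddfB [e]splitr /=.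
rewrite distrC [X in _ + X]distrC; apply: ltrD.
  by apply: d1P; rewrite /ball /= distrC.
by apply: d2P; rewrite /ball /= distrC.
Qed.

Lemma cder_cont U u : (forall A, cder A U u) -> cont U.
Proof.
move=> Uu.
have H t : derivable (fun x => complex.Re (U x)) t 1 /\
           derivable (fun x => complex.Im (U x)) t 1.
  have tt : t - 1 < t by rewrite gtrBl.
  by have [[dr _] [di _]] := Uu (t - 1) t tt.
by split=> t; apply/differentiable_continuous/derivable1_diffP; have [] := H t.
Qed.

Lemma cont_comp u (f : C -> C) : cont u ->
  (forall w e, 0 < e -> exists2 d, 0 < d &
    forall w', rn (w' - w) < d -> rn (f w' - f w) < e) ->
  cont (fun t => f (u t)).
Proof.
move=> /rn_cont uc fc; apply: cont_rn => t e e0.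
have [d d0 dP] := fc (u t) e e0; have [d' d'0 d'P] := uc t d d0.
by exists d' => // t' /d'P /dP.
Qed.

Lemma contM u v : cont u -> cont v -> cont (fun t => u t * v t).
Proof.
move=> [ur ui] [vr vi]; split.
  have -> : (fun t => complex.Re (u t * v t)) = (fun t => complex.Re (u t) * complex.Re (v t)
     - complex.Im (u t) * complex.Im (v t)) by apply/funext => t; exact: complex_ReM.
  by move=> t; apply: cvgB; apply: cvgM; [exact: ur|exact: vr|exact: ui|exact: vi].
have -> : (fun t => complex.Im (u t * v t)) = (fun t => complex.Re (u t) * complex.Im (v t)
   + complex.Im (u t) * complex.Re (v t)) by apply/funext => t; exact: complex_ImM.
by move=> t; apply: cvgD; apply: cvgM; [exact: ur|exact: vi|exact: ui|exact: vr].
Qed.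

Lemma contV u (m : R) : 0 < m -> (forall t, m <= rn (u t)) -> cont u ->
  cont (fun t => (u t)^-1).
Proof.
move=> m0 mu /rn_cont uc; apply: cont_rn => t e e0.
have u0 s : u s != 0.
  by apply/eqP => us; have := mu s; rewrite us rn0 leNgt m0.
have [d d0 dP] := uc t (e * m ^+ 2) (mulr_gt0 e0 (exprn_gt0 _ m0)).
exists d => // t' /dP tt'.
have -> : (u t')^-1 - (u t)^-1 = (u t - u t') * ((u t')^-1 * (u t)^-1).
  by field; rewrite !u0.
rewrite !rnM !rnV rn_distC -invfM ltr_pdivrMr; last first.
  by rewrite mulr_gt0// (lt_le_trans m0).
apply: lt_le_trans tt' _; rewrite ler_wpM2l ?(ltW e0)// expr2.
by apply: ler_pM; rewrite ?(ltW m0).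
Qed.

Lemma cont_cst (c : C) : cont (fun=> c).
Proof. by split=> t; exact: cvg_cst. Qed.

Definition cis (t : R) : C := cos t +i* sin t.

Lemma rn_cis t : rn (cis t) = 1.
Proof. by rewrite rn_normc /= cos2Dsin2 sqrtr1. Qed.

Lemma cder_cis A : cder A cis (fun t => 'i * cis t).
Proof.
move=> t _; split=> /=; rewrite ?mul0r ?mul1r ?sub0r ?add0r.
  exact: is_derive_cos.
exact: is_derive_sin.
Qed.

Lemma cder_real (A : R) (F f : R -> R) : (forall t : R, is_derive t 1 F (f t)) ->
  cder A (fun t => (F t)%:C) (fun t => (f t)%:C).
Proof. by move=> Ff t _; split=> //=; exact: is_derive_cst. Qed.

Lemma cder_lip U u (a b K : R) : (forall A, cder A U u) -> 
  (forall t, a <= t <= b -> rn (u t) <= K) ->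
  forall s t, a <= s <= b -> a <= t <= b -> rn (U s - U t) <= 2 * K * `|s - t|.
Proof.
move=> Uu uK s t; wlog st : s t / t <= s => [h|].
  have [st|/ltW ts] := leP t s; first exact: h.
  by move=> sab tab; rewrite rn_distC distrC; exact: h.
move=> /andP[as_ sb] /andP[at_ tb]; rewrite ger0_norm ?subr_ge0//.
apply: (cder_le (_ : t - 1 < t) st (Uu _)); first by rewrite gtrBl.
by move=> x /andP[tx xs]; apply: uK; rewrite (le_trans at_ tx) (le_trans xs sb).
Qed.

End CurveContinuity.

Section Cauchy.
Variable R : realType.
Local Notation C := (R[i]).
Variable f : C -> C.
Hypothesis fd : forall u, exists B : C, forall e, 0 < e -> exists2 d, 0 < d &
  forall w, rn (w - u) < d -> rn (f w - f u - B * (w - u)) <= e * rn (w - u).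

Lemma cdiff_cont w e : 0 < e -> exists2 d, 0 < d &
  forall w', rn (w' - w) < d -> rn (f w' - f w) < e.
Proof.
move=> e0; have [B /(_ 1 ltr01) [d d0 dP]] := fd w.
have B1 : 0 < 1 + rn B by rewrite ltr_wpDr ?rn_ge0.
exists (Num.min d (e / (1 + rn B))); first by rewrite lt_min d0 divr_gt0.
move=> w'; rewrite lt_min => /andP[/dP h]; rewrite ltr_pdivlMr//; apply: le_lt_trans.
rewrite -[f w' - f w](subrK (B * (w' - w))); apply: le_trans (rnD _ _) _.
by rewrite rnM [leRHS]mulrDr mulr1 [X in _ <= _ + X]mulrC lerD// -[leRHS]mul1r.
Qed.

Variables (r0 : R) (z : C).
Hypothesis zr : rn z < r0.
Let r00 : 0 < r0 := le_lt_trans (rn_ge0 z) zr.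

Definition circ t : C := r0%:C * cis t.

Lemma rn_circ t : rn (circ t) = r0.
Proof. by rewrite rnM rn_cis mulr1 rn_real gtr0_norm. Qed.

Lemma circ_dist t : r0 - rn z <= rn (circ t - z).
Proof. by rewrite -(rn_circ t) lerBlDr; apply: le_trans (rnD _ _); rewrite subrK. Qed.

Lemma circ_neq t : circ t - z != 0.
Proof.
apply/eqP => E; have := circ_dist t.
by rewrite E rn0 leNgt subr_gt0 zr.
Qed.

Lemma cder_circ A : cder A circ (fun t => 'i * circ t).
Proof.
have := cderZ r0%:C (@cder_cis R A); apply: cder_ext => t _.
by rewrite /circ mulrCA.
Qed.

Lemma circ_periodic : circ (pi *+ 2) = circ 0.
Proof. by rewrite /circ /cis cos2pi sin2pi cos0 sin0. Qed.

(** Along u(s, t) = z + e^s (circ t - z) the form du / (u - z) is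
ds + (dlog_circ t) dt. *)
Definition dlog_circ t : C := 'i * circ t / (circ t - z).
Let W := r0 / (r0 - rn z).

Lemma rn_dlog_circ t : rn (dlog_circ t) <= W.
Proof.
have rz : 0 < r0 - rn z by rewrite subr_gt0.
rewrite /dlog_circ rnM rnV rnM rn_i mul1r rn_circ /W ler_wpM2l ?(ltW r00)//.
by rewrite lef_pV2 ?posrE ?circ_dist// (lt_le_trans rz (circ_dist t)).
Qed.

Lemma cont_dlog_circ : cont dlog_circ.
Proof.
have cc := cder_cont cder_circ.
apply: contM; first by apply: contM cc; exact: cont_cst.
apply: (@contV _ _ (r0 - rn z)); first by rewrite subr_gt0.
  exact: circ_dist.
apply: (@cder_cont _ _ (fun t => 'i * circ t - 0)) => A.
exact: cderB (@cder_circ A) (@cder_cst _ A z).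
Qed.

Let u s t : C := z + (expR s)%:C * (circ t - z).

Let cder_us A t : cder A (u^~ t) (fun s => (expR s)%:C * (circ t - z)).
Proof.
have := cderD (@cder_cst _ A z) (cderZ (circ t - z) (@cder_real _ A _ _ (@is_derive_expR R))).
have -> : (fun s => z + (circ t - z) * (expR s)%:C) = u^~ t.
  by apply/funext => s; rewrite /u mulrC.
by apply: cder_ext => s _; rewrite add0r mulrC.
Qed.

Let cder_ut A s : cder A (u s) (fun t => (expR s)%:C * ('i * circ t)).
Proof.
have := cderD (@cder_cst _ A z) (cderZ (expR s)%:C (cderB (@cder_circ A) (@cder_cst _ A z))).
by apply: cder_ext => t _; rewrite add0r subr0.
Qed.

Let K := 2 * (r0 + rn z) + 2 * r0.

Let K0 : 0 < K.
Proof. by rewrite /K; have := rn_ge0 z; have := r00; lra. Qed.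

Let u_lip s t s' t' : s <= 0 -> s' <= 0 ->
  rn (u s t - u s' t') <= K * (`|s - s'| + `|t - t'|).
Proof.
move=> s0 s'0; apply: le_trans (rn_tri (u s' t) _ _) _.
have h1 : rn (u s t - u s' t) <= 2 * (r0 + rn z) * `|s - s'|.
  have := @cder_lip _ (u^~ t) _ (Num.min s s') 0 (r0 + rn z) (fun A => @cder_us A t).
  apply; last 2 first.
  - by rewrite ge_min lexx s0.
  - by rewrite ge_min lexx orbT s'0.
  - move=> x /andP[_ x0]; rewrite rnM rn_real ger0_norm ?expR_ge0//.
    rewrite -[leRHS]mul1r; apply: ler_pM; rewrite ?rn_ge0 ?expR_ge0//.
      by rewrite -expR0 ler_expR.
    by apply: le_trans (rnB _ _) _; rewrite rn_circ.
have h2 : rn (u s' t - u s' t') <= 2 * r0 * `|t - t'|.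
  have := @cder_lip _ (u s') _ (Num.min t t') (Num.max t t') r0 (fun A => @cder_ut A s').
  apply; last 2 first.
  - by rewrite ge_min lexx le_max lexx.
  - by rewrite ge_min lexx orbT le_max lexx orbT.
  - move=> x _; rewrite rnM rnM rn_i mul1r rn_circ rn_real ger0_norm ?expR_ge0//.
    by rewrite ler_piMl ?(ltW r00)// -expR0 ler_expR.
apply: le_trans (lerD h1 h2) _; rewrite /K.
have := rn_ge0 z; have := r00; have := normr_ge0 (s - s'); have := normr_ge0 (t - t').
set x := `|s - s'|; set y := `|t - t'|; set c := rn z => y0 x0 r cz.
have : 0 <= 2 * (r0 + c) * y by rewrite !mulr_ge0// addr_ge0// ltW.
have : 0 <= 2 * r0 * x by rewrite !mulr_ge0// ltW.
lra.
Qed.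

(** The Cauchy formula for f - f(z). Pull the form (f(u) - f(z)) du / (u - z) back by
u(s, t) = z + e^s (circ t - z), which contracts the circle to [z] when s goes to
-oo. Its integral around any rectangle in (s, t) is zero by bisection, so by
periodicity in t the integral over the circle s = const does not depend on s;
and it tends to 0 when s goes to -oo, because f is continuous at [z]. *)
Lemma cauchy_circle : exists Psi,
  cder (-1) Psi (fun t => (f (circ t) - f z) * (circ t / (circ t - z))) /\
  Psi (pi *+ 2) = Psi 0.
Proof.
pose f1 w := f w - f z.
have f1d w0 : exists B : C, forall e, 0 < e -> exists2 d, 0 < d &
    forall w, rn (w - w0) < d -> rn (f1 w - f1 w0 - B * (w - w0)) <= e * rn (w - w0).
  have [B BP] := fd w0; exists B => e /BP[d d0 dP]; exists d => // w /dP.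
  by rewrite /f1 opprB addrA subrK.
have f1c w e : 0 < e -> exists2 d, 0 < d &
    forall w', rn (w' - w) < d -> rn (f1 w' - f1 w) < e.
  move=> /(cdiff_cont w)[d d0 dP]; exists d => // w' /dP.
  by rewrite /f1 opprB addrA subrK.
have exQ s : exists Q, cder (-1) Q (fun t => f1 (u s t) * dlog_circ t).
  apply: cder_primitive; apply: contM; last exact: cont_dlog_circ.
  by apply: cont_comp f1c; exact: (cder_cont (fun A => @cder_ut A s)).
have [Q QP] := choice exQ.
have [La LaP] := @cder_primitive _ (-1) _ cont_dlog_circ.
have pi2 : 0 <= pi *+ 2 :> R by rewrite mulrn_wge0// pi_ge0.
have W0 : 0 <= W by apply: le_trans (rn_dlog_circ 0); exact: rn_ge0.
have const a : a < 0 -> Q 0 (pi *+ 2) - Q 0 0 = Q a (pi *+ 2) - Q a 0.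
  move=> a0.
  have exP t : exists P, cder (a - 1) P (fun s => f1 (u s t)).
    apply: cder_primitive.
    by apply: cont_comp f1c; exact: (cder_cont (fun A => @cder_us A t)).
  have [P PP] := choice exP.
  pose F a b c d := P c b - P c a + (Q b d - Q b c) - (P d b - P d a) - (Q a d - Q a c).
  have F0 : F a 0 0 (pi *+ 2) = 0.
    apply: rectangle_bisection => //.
    - by rewrite /F => *; ring.
    - by rewrite /F => *; ring.
    - exact: ltW.
    move=> s0 t0 e /andP[as0 s00] /andP[t00 t0p] e0.
    have [B BP] := f1d (u s0 t0).
    set u0 := u s0 t0 in BP *.
    (* Up to rho, f1 is affine near u0: f1(u) = A' + B (u - z) + rho(u). The
       affine part has explicit primitives; they are subtracted in P' and Q', and
       their contributions around a rectangle cancel. *)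
    pose A' := f1 u0 + B * (z - u0).
    have KW : 0 < 4 * K * (1 + W).
      by rewrite !mulr_gt0//; apply: ltr_wpDr.
    pose eps1 := e / (4 * K * (1 + W)).
    have eps10 : 0 < eps1 by rewrite divr_gt0.
    have [d d0 dP] := BP eps1 eps10.
    exists (d / (2 * K)) => [|a' b' c' d' aa' /andP[a's b's] b'0 cc' /andP[c't d't] d'p ba dc].
      by rewrite divr_gt0// mulr_gt0.
    set sg := (b' - a') + (d' - c').
    have sg0 : 0 <= sg by rewrite /sg; lra.
    have sgd : K * sg < d.
      have KK : 0 < 2 * K by rewrite mulr_gt0.
      by move: ba dc; rewrite !ltr_pdivlMr// /sg; lra.
    pose rho w := f1 w - f1 u0 - B * (w - u0).
    have rhoP s t : a' <= s <= b' -> c' <= t <= d' -> rn (rho (u s t)) <= eps1 * (K * sg).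
      move=> /andP[s1 s2] /andP[t1 t2].
      have us : rn (u s t - u0) <= K * sg.
        apply: le_trans (u_lip t t0 (le_trans s2 b'0) s00) _.
        rewrite ler_wpM2l ?(ltW K0)// lerD// ler_norml; apply/andP; split; lra.
      apply: le_trans (dP _ (le_lt_trans us sgd)) _.
      by rewrite ler_wpM2l// ltW.
    pose P' t s := P t s - (A' * s%:C + B * (circ t - z) * (expR s)%:C).
    pose Q' s t := Q s t - (A' * La t + B * (expR s)%:C * circ t).
    have PP' t : cder (a - 1) (P' t) (fun s => rho (u s t)).
      have := cderB (PP t) (cderD (cderZ A' (@cder_real _ (a - 1) _ _ (fun x => is_derive_id x 1)))
        (cderZ (B * (circ t - z)) (@cder_real _ (a - 1) _ _ (@is_derive_expR R)))).
      by apply: cder_ext => s _; rewrite /rho /A' /u; ring.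
    have QQ' s : cder (-1) (Q' s) (fun t => rho (u s t) * dlog_circ t).
      have := cderB (QP s) (cderD (cderZ A' LaP) (cderZ (B * (expR s)%:C) (@cder_circ (-1)))).
      apply: cder_ext => t _.
      have -> : 'i * circ t = dlog_circ t * (circ t - z) by rewrite /dlog_circ divfK// circ_neq.
      by rewrite /rho /A' /u; ring.
    have aa1 : a - 1 < a' by apply: lt_le_trans aa'; rewrite gtrBl.
    have c1 : -1 < c' by apply: lt_le_trans cc'; rewrite ltrN10.
    have a'b' := le_trans a's b's; have c'd' := le_trans c't d't.
    have b1 t : c' <= t <= d' -> rn (P' t b' - P' t a') <= 2 * (eps1 * (K * sg)) * (b' - a').
      by move=> tc; apply: cder_le aa1 a'b' (PP' t) _ => s sab; exact: rhoP.
    have b2 s : a' <= s <= b' -> rn (Q' s d' - Q' s c') <= 2 * (eps1 * (K * sg) * W) * (d' - c').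
      move=> sa; apply: cder_le c1 c'd' (QQ' s) _ => t tcd; rewrite rnM.
      by apply: ler_pM; rewrite ?rn_ge0 ?rn_dlog_circ// rhoP.
    have -> : F a' b' c' d' = P' c' b' - P' c' a' + (Q' b' d' - Q' b' c')
        - (P' d' b' - P' d' a') - (Q' a' d' - Q' a' c').
      by rewrite /F /P' /Q'; ring.
    apply: le_trans (rnB _ _) _; apply: le_trans (lerD (rnB _ _) (lexx _)) _.
    apply: le_trans (lerD (lerD (rnD _ _) (lexx _)) (lexx _)) _.
    have cc1 : c' <= c' <= d' by rewrite lexx.
    have dd1 : c' <= d' <= d' by rewrite lexx andbT.
    have aa2 : a' <= a' <= b' by rewrite lexx.
    have bb2 : a' <= b' <= b' by rewrite lexx andbT.
    apply: le_trans (lerD (lerD (lerD (b1 _ cc1) (b2 _ bb2)) (b1 _ dd1)) (b2 _ aa2)) _.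
    have -> : e = eps1 * (4 * K * (1 + W)) by rewrite /eps1 divfK// gt_eqF.
    have [e1 k1] := (ltW eps10, ltW K0).
    have ba0 : 0 <= b' - a' by rewrite subr_ge0.
    have dc0 : 0 <= d' - c' by rewrite subr_ge0.
    have E1 : 0 <= eps1 * K * sg * (b' - a') * W.
      by do 4![apply: mulr_ge0 => //].
    have E2 : 0 <= eps1 * K * sg * (d' - c').
      by do 3![apply: mulr_ge0 => //].
    rewrite -subr_ge0 [X in 0 <= X](_ : _ = 4 * (eps1 * K * sg * (b' - a') * W) +
      4 * (eps1 * K * sg * (d' - c'))); last by rewrite /sg; ring.
    by rewrite addr_ge0// mulr_ge0.
  have Pper : P 0 0 - P 0 a = P (pi *+ 2) 0 - P (pi *+ 2) a.
    have D := cderB (PP 0) (PP (pi *+ 2)).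
    have aa : a - 1 < a by rewrite gtrBl.
    have := cder_le aa (ltW a0) D (K := 0).
    rewrite mulr0 mul0r => h; apply/eqP; rewrite -subr_eq0; apply/eqP/rn0_eq0/eqP.
    rewrite eq_le rn_ge0 andbT.
    have -> : P 0 0 - P 0 a - (P (pi *+ 2) 0 - P (pi *+ 2) a) =
      (P 0 0 - P (pi *+ 2) 0) - (P 0 a - P (pi *+ 2) a) by ring.
    by apply: h => t _; rewrite /u circ_periodic subrr rn0.
  move: F0; rewrite /F Pper.
  rewrite [LHS](_ : _ = (Q 0 (pi *+ 2) - Q 0 0) - (Q a (pi *+ 2) - Q a 0)); last by ring.
  exact: subr0_eq.
have QE : Q 0 (pi *+ 2) = Q 0 0.
  apply/subr0_eq/rn0_eq0/eqP; rewrite eq_le rn_ge0 andbT.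
  apply/ler_addgt0Pr => e' e'0; rewrite add0r.
  pose c := 2 * W * (pi *+ 2); have c0 : 0 <= c by do 2![apply: mulr_ge0 => //].
  have c1 : 0 < c + 1 by rewrite ltr_wpDl.
  pose e := e' / (c + 1); have e0 : 0 < e by rewrite divr_gt0.
  have [d d0 dP] := f1c z e e0.
  pose M := (r0 + rn z) / d.
  have rz : 0 < r0 + rn z by rewrite ltr_wpDr ?rn_ge0.
  have M0 : 0 < M by rewrite divr_gt0.
  have eM : expR (- M) * (r0 + rn z) < d.
    rewrite expRN mulrC ltr_pdivrMr ?expR_gt0//.
    apply: lt_le_trans (_ : d * (1 + M) <= _); last by rewrite ler_wpM2l ?(ltW d0)// expR_ge1Dx.
    have dM : d * M = r0 + rn z by rewrite /M mulrC divfK// gt_eqF.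
    by rewrite mulrDr mulr1 dM ltrDr.
  have Ma : - M < 0 by rewrite oppr_lt0.
  rewrite (const _ Ma).
  have n1 : -1 < 0 :> R by rewrite ltrN10.
  apply: le_trans (cder_le n1 pi2 (QP (- M)) (K := e * W) _) _.
    move=> t _; rewrite rnM; apply: ler_pM; rewrite ?rn_ge0 ?rn_dlog_circ//.
    have := dP (u (- M) t); rewrite {2}/f1 subrr subr0 => h; apply/ltW/h.
    rewrite /u addrC addKr rnM rn_real ger0_norm ?expR_ge0//.
    apply: le_lt_trans eM; rewrite ler_wpM2l ?expR_ge0//.
    by apply: le_trans (rnB _ _) _; rewrite rn_circ.
  rewrite subr0 [leLHS](_ : _ = e * c); last by rewrite /c; ring.
  by rewrite /e mulrAC ler_pdivrMr// ler_wpM2l ?(ltW e'0)// lerDl.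
exists (fun t => - 'i * Q 0 t); split; last by rewrite QE.
apply: cder_ext (cderZ (- 'i) (QP 0)) => t _.
have -> : u 0 t = circ t by rewrite /u expR0 mul1r addrC subrK.
have ii : 'i * 'i = -1 :> C by rewrite -expr2 sqr_i.
rewrite /dlog_circ /f1 -[LHS](_ : - ('i * 'i) * ((f (circ t) - f z) * (circ t / (circ t - z))) = _); last by ring.
by rewrite ii opprK mul1r.
Qed.

End Cauchy.

(** * Discretisation of the Cauchy formula *)

Section Taylor.
Variable R : realType.
Local Notation C := (R[i]).

Lemma cisD (s t : R) : cis (s + t) = cis s * cis t :> C.
Proof. by rewrite /cis cosD sinD [sin s * cos t + _]addrC. Qed.

Lemma cisMn (k : nat) (t : R) : cis (k%:R * t) = cis t ^+ k :> C.
Proof.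
elim: k => [|k ih]; first by rewrite mul0r expr0 /cis cos0 sin0.
by rewrite -natr1 mulrDl mul1r cisD ih exprSr.
Qed.

Lemma cis_neq0 (t : R) : cis t != 0 :> C.
Proof. by apply/eqP => E; have := rn_cis t; rewrite E rn0 => /esym/eqP; rewrite oner_eq0. Qed.

Lemma cisN (t : R) : cis (- t) = (cis t)^-1 :> C.
Proof.
apply: (mulIf (cis_neq0 t)); rewrite -cisD mulVf ?cis_neq0// addNr.
by rewrite /cis cos0 sin0.
Qed.

Lemma cder_cisM (A c : R) :
  cder A (fun t => cis (c * t)) (fun t => c%:C * ('i * cis (c * t))).
Proof.
move=> t _.
have cd : is_derive t 1 ( *%R c) c.
  by have := @is_deriveZ R R R id c t 1 1 (is_derive_id t 1); rewrite [_ *: _]mulr1.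
split=> /=; rewrite !(mul0r, mul1r, subr0, addr0, sub0r, add0r) mulrC.
  exact: (is_derive1_comp (is_derive_cos _) cd).
exact: (is_derive1_comp (is_derive_sin _) cd).
Qed.

Definition cis_primitive (k : nat) (t : R) : C :=
  if k == 0%N then t%:C else 'i / k%:R * cis (- k%:R * t).

Lemma cder_cis_primitive A k : cder A (cis_primitive k) (fun t => cis (- k%:R * t)).
Proof.
rewrite /cis_primitive; case: eqP => [->|/eqP k0].
  have := @cder_real _ A id (fun=> 1) (fun x => is_derive_id x 1).
  by apply: cder_ext => t _; rewrite oppr0 mul0r /cis cos0 sin0.
have := cderZ ('i / k%:R) (@cder_cisM A (- k%:R)); apply: cder_ext => t _.
have ii : 'i * 'i = -1 :> C by rewrite -expr2 sqr_i.
have kC : k%:R != 0 :> C by rewrite pnatr_eq0.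
have -> : (- k%:R)%:C = - k%:R :> C by rewrite rmorphN rmorph_nat.
have -> : 'i / k%:R * (- k%:R * ('i * cis (- k%:R * t))) =
   - ('i * 'i) * cis (- k%:R * t) * (k%:R / k%:R) :> C by ring.
by rewrite ii opprK mul1r divff// mulr1.
Qed.

Lemma cis_primitive_period k : cis_primitive k (pi *+ 2) - cis_primitive k 0 = if k == 0%N then (pi *+ 2)%:C else 0.
Proof.
rewrite /cis_primitive; case: eqP => _; first by rewrite subr0.
rewrite mulr0 mulNr cisN cisMn.
by rewrite /cis cos2pi sin2pi cos0 sin0 expr1n invr1 subrr.
Qed.

Variable f : C -> C.
Hypothesis fd : forall u, exists B : C, forall e, 0 < e -> exists2 d, 0 < d &
  forall w, rn (w - u) < d -> rn (f w - f u - B * (w - u)) <= e * rn (w - u).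
Variables (r0 : R) (z : C) (Bd eta : R) (K M : nat).
Hypothesis r00 : 0 < r0.
Hypothesis zr : rn z <= r0 / 2.
Hypothesis fB : forall u, rn u <= r0 -> rn (f u) <= Bd.
Hypothesis K0 : (0 < K)%N.
Hypothesis M0 : (0 < M)%N.

Definition node (l : nat) : R := pi *+ 2 * l%:R / M%:R.

Hypothesis fosc : forall (l : nat) t, (l < M)%N -> node l <= t <= node l.+1 ->
  rn (f (circ r0 t) - f (circ r0 (node l))) <= eta.

(** The polynomial in z obtained by integrating, over the arc between two consecutive
nodes, the sum for k < K of the (z / circ t)^k, divided by 2 pi. *)
Definition weight (l : nat) : {poly C} :=
  \sum_(k < K) (((pi *+ 2)%:C * r0%:C ^+ k)^-1 *
     (cis_primitive k (node l.+1) - cis_primitive k (node l))) *: 'X^k.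

Let zr0 : rn z < r0.
Proof. by apply: le_lt_trans zr _; have := r00; lra. Qed.

Let w t := z / circ r0 t.

Let rnw t : rn (w t) <= 2^-1.
Proof.
rewrite /w rnM rnV (rn_circ zr0) ler_pdivrMr//.
by apply: le_trans zr _; rewrite mulrC.
Qed.

Let wX t k : w t ^+ k = (z / r0%:C) ^+ k * cis (- k%:R * t).
Proof. by rewrite /w /circ invfM mulrA exprMn mulNr cisN cisMn -exprVn. Qed.

Let kap t := \sum_(k < K) w t ^+ k.
Let Kap t := \sum_(k < K) (z / r0%:C) ^+ k * cis_primitive k t.

Let cder_Kap A : cder A Kap kap.
Proof.
have := cder_sum (index_enum 'I_K) (fun k : 'I_K => cderZ ((z / r0%:C) ^+ k) (@cder_cis_primitive A k)).
by apply: cder_ext => t _; rewrite /kap; apply: eq_bigr => k _; rewrite wX.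
Qed.

Let cder_kap A : cder A kap (fun t => \sum_(k < K) (z / r0%:C) ^+ k *
   ((- k%:R)%:C * ('i * cis (- k%:R * t)))).
Proof.
have := cder_sum (index_enum 'I_K) (fun k : 'I_K =>
  cderZ ((z / r0%:C) ^+ k) (@cder_cisM A (- k%:R))).
by rewrite /kap; under eq_fun do under eq_bigr do rewrite -wX.
Qed.

Let rn_kap t : rn (kap t) <= 2.
Proof.
apply: le_trans (rn_sum _ _ _) _.
apply: le_trans (_ : \sum_(k < K) 2 * (2 ^+ k.+1)^-1 <= _); last first.
  by rewrite -mulr_sumr ler_piMr// sum_half.
apply: ler_sum => k _; rewrite rnX exprS invfM mulrA divff// mul1r -exprVn.
by rewrite lerXn2r ?nnegrE ?rn_ge0.
Qed.

Let pi20 : 0 < pi *+ 2 :> R.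
Proof. by rewrite mulrn_wgt0// pi_gt0. Qed.

Let kernel t : circ r0 t / (circ r0 t - z) - kap t =
  w t ^+ K * (circ r0 t / (circ r0 t - z)).
Proof.
have cz := circ_neq zr0 t.
have c0 : circ r0 t != 0.
  by apply/eqP => E; have := rn_circ zr0 t; rewrite E rn0 => E'; have := r00; rewrite -E' ltxx.
have E : (1 - w t) * kap t = 1 - w t ^+ K.
  by rewrite -opprB mulNr -subrX1 opprB.
have E2 : (1 - w t) * (circ r0 t / (circ r0 t - z)) = 1.
  by rewrite /w; field; rewrite c0 cz.
have w1 : 1 - w t != 0.
  by apply/eqP => w0; move: E2; rewrite w0 mul0r => /esym/eqP; rewrite oner_eq0.
by apply: (mulfI w1); rewrite mulrBr E2 E mulrCA E2 mulr1 opprB addrCA subrr addr0.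
Qed.

Let rn_ker t : rn (circ r0 t / (circ r0 t - z)) <= 2.
Proof.
rewrite rnM rnV (rn_circ zr0) ler_pdivrMr; last first.
  by apply: lt_le_trans (circ_dist zr0 t); rewrite subr_gt0.
apply: le_trans (ler_wpM2l _ (circ_dist zr0 t)) => //.
by have := zr; lra.
Qed.

(** The first error term comes from the truncation of the geometric series of the
Cauchy kernel, whose ratio is at most 1/2; the second one from the replacement
of f by its value at a node on each arc. *)
Lemma taylor_step : rn (f z - \sum_(l < M) (weight l).[z] * f (circ r0 (node l)))
  <= 8 * Bd / 2 ^+ K + 4 * eta.
Proof.
have Bd0 : 0 <= Bd by apply: le_trans (fB (ltW zr0)); exact: rn_ge0.
have [Psi [PsiP PsiE]] := cauchy_circle fd zr0.
have fc := cdiff_cont fd.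
have cc : cont (circ r0) by apply: cder_cont => A; exact: cder_circ.
have [Phi PhiP] : exists Phi, cder (-1) Phi (fun t => f (circ r0 t) * kap t).
  apply: cder_primitive; apply: contM; first exact: cont_comp.
  by apply: cder_cont => A; exact: cder_kap.
have pi2c : (pi *+ 2)%:C != 0 :> C by apply/eqP => -[/eqP]; rewrite gt_eqF.
have r0c : r0%:C != 0 :> C by apply/eqP => -[/eqP]; rewrite gt_eqF.
have weightE l : (weight l).[z] = (pi *+ 2)%:C^-1 * (Kap (node l.+1) - Kap (node l)).
  rewrite /weight horner_sum /Kap -sumrB mulr_sumr; apply: eq_bigr => k _.
  rewrite !hornerE /= -mulrBr expr_div_n invfM.
  ring.
have KapP : Kap (pi *+ 2) - Kap 0 = (pi *+ 2)%:C.
  rewrite /Kap -sumrB (bigD1 (Ordinal K0)) //= big1 => [|k k0].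
    by rewrite expr0 !mul1r cis_primitive_period addr0.
  rewrite -mulrBr cis_primitive_period ifF ?mulr0//; apply: contraNF k0 => /eqP k0.
  exact/eqP/val_inj.
have D1 := cderB (cderZ (f z) (@cder_Kap (-1))) (cderB PhiP PsiP).
have n1 : -1 < 0 :> R by rewrite ltrN10.
have M0R : 0 < M%:R :> R by rewrite ltr0n.
have e1 : rn ((pi *+ 2)%:C * f z - (Phi (pi *+ 2) - Phi 0)) <= 8 * Bd / 2 ^+ K * (pi *+ 2).
  have -> : (pi *+ 2)%:C * f z - (Phi (pi *+ 2) - Phi 0) =
      f z * Kap (pi *+ 2) - (Phi (pi *+ 2) - Psi (pi *+ 2)) -
      (f z * Kap 0 - (Phi 0 - Psi 0)).
    by rewrite -KapP PsiE; ring.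
  apply: le_trans (cder_le n1 (ltW pi20) D1 (K := 4 * Bd / 2 ^+ K) _) _; last first.
    rewrite subr0 le_eqVlt; apply/orP; left; apply/eqP; ring.
  move=> t _.
  have -> : f z * kap t - (f (circ r0 t) * kap t -
      (f (circ r0 t) - f z) * (circ r0 t / (circ r0 t - z))) =
      (f (circ r0 t) - f z) * (circ r0 t / (circ r0 t - z) - kap t) by ring.
  rewrite kernel rnM rnM rnX.
  have h1 : rn (f (circ r0 t) - f z) <= 2 * Bd.
    apply: le_trans (rnB _ _) _; rewrite mulr_natl mulr2n lerD// fB ?(ltW zr0)//.
    by rewrite (rn_circ zr0).
  have h2 : rn (w t) ^+ K <= 2^-1 ^+ K by rewrite lerXn2r ?nnegrE ?rn_ge0.
  have h3 := ler_pM (exprn_ge0 _ (rn_ge0 _)) (rn_ge0 _) h2 (rn_ker t).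
  have h4 := ler_pM (rn_ge0 _) (mulr_ge0 (exprn_ge0 _ (rn_ge0 _)) (rn_ge0 _)) h1 h3.
  apply: le_trans h4 _; rewrite exprVn le_eqVlt; apply/orP; left; apply/eqP; ring.
have nodeS l : node l.+1 - node l = pi *+ 2 / M%:R.
  by rewrite /node -natr1 mulrDr mulr1 mulrDl addrAC subrr add0r.
have node0 l : -1 < node l.
  apply: lt_le_trans n1 _; rewrite /node.
  by do 2?apply: mulr_ge0; rewrite ?invr_ge0 ?ler0n// ltW.
have step l : (l < M)%N -> rn (Phi (node l.+1) - Phi (node l) -
    f (circ r0 (node l)) * (Kap (node l.+1) - Kap (node l))) <= 4 * eta * (pi *+ 2 / M%:R).
  move=> lM.
  have D2 := cderB PhiP (cderZ (f (circ r0 (node l))) (@cder_Kap (-1))).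
  have ll : node l <= node l.+1.
    by rewrite -subr_ge0 nodeS divr_ge0// ltW.
  rewrite -(nodeS l) (_ : 4 * eta = 2 * (eta * 2)); last by ring.
  have -> : Phi (node l.+1) - Phi (node l) -
      f (circ r0 (node l)) * (Kap (node l.+1) - Kap (node l)) =
    Phi (node l.+1) - f (circ r0 (node l)) * Kap (node l.+1) -
    (Phi (node l) - f (circ r0 (node l)) * Kap (node l)) by ring.
  apply: cder_le (node0 l) ll D2 _ => t tl.
  rewrite -mulrBl rnM; apply: ler_pM; rewrite ?rn_ge0//.
  exact: fosc.
have e2 : rn (Phi (pi *+ 2) - Phi 0 - \sum_(l < M) f (circ r0 (node l)) *
    (Kap (node l.+1) - Kap (node l))) <= 4 * eta * (pi *+ 2).
  have -> : Phi (pi *+ 2) - Phi 0 = \sum_(l < M) (Phi (node l.+1) - Phi (node l)).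
    rewrite -(big_mkord xpredT (fun l => Phi (node l.+1) - Phi (node l))).
    rewrite (telescope_sumr (fun l => Phi (node l)))//.
    by rewrite /node mulr0 mul0r mulfK ?gt_eqF.
  rewrite -sumrB; apply: le_trans (rn_sum _ _ _) _.
  apply: le_trans (_ : \sum_(l < M) 4 * eta * (pi *+ 2 / M%:R) <= _).
    by apply: ler_sum => l _; exact: step.
  by rewrite sumr_const card_ord -[_ *+ M]mulr_natr -[leLHS]mulrA divfK ?gt_eqF.
have -> : f z - \sum_(l < M) (weight l).[z] * f (circ r0 (node l)) =
   (pi *+ 2)%:C^-1 * (((pi *+ 2)%:C * f z - (Phi (pi *+ 2) - Phi 0)) +
     (Phi (pi *+ 2) - Phi 0 - \sum_(l < M) f (circ r0 (node l)) *
       (Kap (node l.+1) - Kap (node l)))).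
  rewrite addrA subrK mulrBr mulrA mulVf// mul1r mulr_sumr; congr (_ - _).
  by apply: eq_bigr => l _; rewrite weightE mulrAC mulrA.
rewrite rnM rnV rn_real ger0_norm ?(ltW pi20)// mulrC ler_pdivrMr//.
by apply: le_trans (rnD _ _) _; rewrite mulrDl lerD.
Qed.
End Taylor.

(** * Polynomial approximation in one coordinate *)

Section Density.
Variables (R : realType) (n : nat).
Local Notation C := (R[i]).
Implicit Types (z : Cn R n) (g f p : Cn R n -> C).

Definition subst_coord z (j : 'I_n) (c : C) : Cn R n := \row_k (if k == j then c else z ord0 k).

Lemma subst_coordE z j (u v : C) : subst_coord z j v = subst_coord z j u + (v - u) *: delta_mx ord0 j.
Proof.
apply/rowP => k; rewrite !mxE /= ?eqxx; case: eqP => _.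
  by rewrite mulr1 addrC subrK.
by rewrite mulr0 addr0.
Qed.

Lemma rn_subst_coord z j (u : C) M : rn z <= M -> rn u <= M -> rn (subst_coord z j u) <= M.
Proof.
move=> zM uM; apply: rn_rV_le => [|k]; first exact: le_trans (rn_ge0 _) zM.
by rewrite mxE; case: ifP => // _; exact: le_trans (rn_coord _ _ _) zM.
Qed.

Lemma rn_delta (j : 'I_n) : rn (delta_mx ord0 j : Cn R n) <= 1.
Proof.
apply: rn_rV_le => // k; rewrite !mxE /=.
by case: (k == j); rewrite ?rn1 ?rn0.
Qed.

Lemma diff_cont (V W : normedModType C) (h : V -> W) :
  (forall x, differentiable h x) -> continuous h.
Proof. by move=> hd x; exact: differentiable_continuous. Qed.

Lemma uniform_cont_ball (V : normedModType C) (h : Cn R n -> V) (M e : R) :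
  continuous h -> 0 < e -> exists2 d, 0 < d &
    forall z z', rn z <= M -> rn (z' - z) < d -> rn (h z' - h z) <= e.
Proof.
move=> hc e0; have [K cK KM] := @polydisc_compact R n M.
have [d d0 dP] : exists2 d : R, 0 < d & forall x, K x ->
    forall x', rn (x' - x) < d -> rn (h x' - h x) <= e.
  apply: compact_uniform cK _ _.
    by move=> d d' x d'd xd x' /lt_le_trans/(_ d'd); exact: xd.
  move=> x _; have e20 : 0 < e / 2 by rewrite divr_gt0.
  have [d d0 dP] := (continuous_rnP h x).1 (hc x) _ e20.
  have d20 : 0 < d / 2 by rewrite divr_gt0.
  exists (d / 2) => // y yx y' y'y.
  apply: le_trans (rn_tri (h x) _ _) _; rewrite [e]splitr; apply: lerD.
    apply/ltW/dP; apply: le_lt_trans (rn_tri y _ _) _; rewrite [d]splitr; exact: ltrD.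
  rewrite rn_distC; apply/ltW/dP; apply: lt_trans yx _.
  by rewrite ltr_pdivrMr// mulr_natr mulr2n ltrDl.
by exists d => // z z' /KM Kz; exact: dP Kz z'.
Qed.

Lemma bounded_ball (V : normedModType C) (h : Cn R n -> V) (M : R) :
  continuous h -> exists2 B, 0 <= B & forall z, rn z <= M -> rn (h z) <= B.
Proof.
move=> hc; have [K cK KM] := @polydisc_compact R n M.
have /compact_rn_bounded[B BP] : compact (h @` K).
  by apply: continuous_compact cK; exact: continuous_subspaceT.
by exists B%:R => // z /KM Kz; apply: BP; exists z.
Qed.

(** The nodes and the weights are the same for all values of the other coordinates,
because [g] is bounded and uniformly continuous on a larger ball. *)
Lemma coord_approx g (j : 'I_n) (M e : R) :
  (forall z, differentiable (g : Cn R n -> C^o) z) -> 0 < M -> 0 < e ->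
  exists (N : nat) (L : nat -> {poly C}) (x : nat -> C),
    (forall l, rn (x l) <= 2 * M) /\
    forall z, rn z <= M ->
      rn (g z - \sum_(l < N) (L l).[z ord0 j] * g (subst_coord z j (x l))) <= e.
Proof.
move=> gd M0 e0; have gc := diff_cont gd.
pose r0 := 2 * M; have r00 : 0 < r0 by rewrite mulr_gt0.
have [B B0 BP] := @bounded_ball _ (g : Cn R n -> C^o) r0 gc.
have e80 : 0 < e / 8 by rewrite divr_gt0.
have [d d0 dP] := @uniform_cont_ball _ (g : Cn R n -> C^o) r0 _ gc e80.
have [K K0 KP] := exists_nat_ge (16 * B / e).
have [N N0 NP] := exists_nat_ge ((2 * r0 * (pi *+ 2) + 1) / d).
exists N, (weight r0 K N), (fun l => circ r0 (node R N l)); split.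
  by move=> l; rewrite rnM rn_cis mulr1 rn_real gtr0_norm.
move=> z zM.
have zjM : rn (z ord0 j) <= r0 / 2.
  by rewrite /r0 mulrC mulKf//; exact: le_trans (rn_coord _ _ _) zM.
have zr0 : rn z <= r0 by apply: le_trans zM _; rewrite /r0; lra.
pose phi (u : C) := g (subst_coord z j u).
have phid u : exists Bu : C, forall e, 0 < e -> exists2 d, 0 < d &
    forall w, rn (w - u) < d -> rn (phi w - phi u - Bu * (w - u)) <= e * rn (w - u).
  exists ('d (g : Cn R n -> C^o) (subst_coord z j u) (delta_mx ord0 j)) => e' e'0.
  have [d' d'0 d'P] := differentiable_rn (gd (subst_coord z j u)) e'0.
  exists d' => // w wu.
  have hle : rn ((w - u) *: (delta_mx ord0 j : Cn R n)) <= rn (w - u).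
    by rewrite rnZ ler_piMr ?rn_ge0 ?rn_delta.
  have := d'P _ (le_lt_trans hle wu); rewrite -subst_coordE linearZ /= => h.
  rewrite /phi [_ * (w - u)]mulrC; apply: le_trans h _.
  by rewrite ler_wpM2l ?(ltW e'0).
have -> : g z = phi (z ord0 j).
  congr g; apply/rowP => k; rewrite mxE.
  by case: eqP => // ->.
have phiB u : rn u <= r0 -> rn (phi u) <= B.
  by move=> ur; apply: BP; exact: rn_subst_coord.
have N0R : 0 < N%:R :> R by rewrite ltr0n.
have pi20 : 0 < pi *+ 2 :> R by rewrite mulrn_wgt0// pi_gt0.
have osc (l : nat) t : (l < N)%N -> node R N l <= t <= node R N l.+1 ->
    rn (phi (circ r0 t) - phi (circ r0 (node R N l))) <= e / 8.
  move=> lN /andP[tl tl1]; apply: dP.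
    by apply: rn_subst_coord => //; rewrite rnM rn_cis mulr1 rn_real gtr0_norm.
  rewrite (subst_coordE _ _ (circ r0 (node R N l))) addrC addKr.
  rewrite rnZ; apply: le_lt_trans (ler_piMr (rn_ge0 _) (rn_delta j)) _.
  have lip := @cder_lip R (circ r0) _ (node R N l) (node R N l.+1) r0
    (fun A => @cder_circ R r0 A).
  apply: le_lt_trans (lip _ _ _ _ _) _.
  - by move=> s _; rewrite rnM rn_i mul1r rnM rn_cis mulr1 rn_real gtr0_norm.
  - by rewrite tl.
  - by rewrite lexx (le_trans tl tl1).
  rewrite ger0_norm ?subr_ge0//.
  have tn : t - node R N l <= pi *+ 2 / N%:R.
    rewrite lerBlDr; apply: le_trans tl1 _.
    by rewrite /node -natr1 mulrDr mulr1 mulrDl addrC.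
  apply: le_lt_trans (ler_wpM2l _ tn) _; first by rewrite mulr_ge0// ltW.
  rewrite mulrA ltr_pdivrMr//; have := NP; rewrite ler_pdivrMr// => NP'.
  by rewrite [ltRHS]mulrC; apply: lt_le_trans NP'; rewrite ltrDl.
have := @taylor_step R phi phid r0 (z ord0 j) B (e / 8) K N r00 zjM phiB K0 N0 osc.
move/le_trans; apply.
have : 8 * B / 2 ^+ K <= e / 2.
  rewrite ler_pdivrMr ?exprn_gt0//; move: KP; rewrite ler_pdivrMr// => h.
  have : K%:R <= 2 ^+ K :> R by rewrite -natrX ler_nat ltnW// ltn_expl.
  move=> h2; have := ler_wpM2r (ltW e0) h2; lra.
lra.
Qed.

End Density.

(** * A countable dense family of polynomial maps *)

Section Countable.
Variables (R : realType) (n : nat).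
Local Notation C := (R[i]).
Implicit Types (z : Cn R n) (f p : Cn R n -> C).

(** A monomial is a coefficient in Q(i) and the list of its variables, repeated
according to their exponents. This type is countable. *)
Definition poly_code : Type := seq ((rat * rat) * seq 'I_n).

Definition ratc (c : rat * rat) : C := ratr c.1 +i* ratr c.2.

Definition eval_poly (s : poly_code) z : C :=
  \sum_(m <- s) ratc m.1 * \prod_(j <- m.2) z ord0 j.

Lemma tame_prod_coord (l : seq 'I_n) :
  exists D K, tame D K (fun z => \prod_(j <- l) z ord0 j : C^o).
Proof.
elim: l => [|j l [D [K ih]]].
  exists 0%N, (rn (1 : C)).
  have -> : (fun z => \prod_(j <- [::]) z ord0 j : C^o) = (fun=> 1).
    by apply/funext => z; rewrite big_nil.
  exact: tame_cst.
exists (1 + D).+1, (4 * 1 * K).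
have -> : (fun z => \prod_(k <- j :: l) z ord0 k : C^o) =
    (fun z => z ord0 j *: (\prod_(k <- l) z ord0 k : C^o)).
  by apply/funext => z; rewrite big_cons.
apply: tame_mul ih; apply: tame_linear => // [a u v|z]; first by rewrite !mxE.
by rewrite mul1r rn_coord.
Qed.

Lemma tame_ex_add (V : normedModType C) (f g : Cn R n -> V) :
  (exists D K, tame D K f) -> (exists D K, tame D K g) ->
  exists D K, tame D K (fun z => f z + g z).
Proof.
move=> [D1 [K1 ft]] [D2 [K2 gt]]; exists (maxn D1 D2), (K1 + K2).
apply: tame_add; first exact: tame_le (leq_maxl _ _) _ ft.
exact: tame_le (leq_maxr _ _) _ gt.
Qed.

Lemma tame_ex_sum (V : normedModType C) (I : Type) (s : seq I) (f : I -> Cn R n -> V) :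
  (forall i, exists D K, tame D K (f i)) ->
  exists D K, tame D K (fun z => \sum_(i <- s) f i z).
Proof.
move=> ft; elim: s => [|i s ih].
  exists 0%N, (rn (0 : V)).
  have -> : (fun z => \sum_(i <- [::]) f i z) = (fun=> 0).
    by apply/funext => z; rewrite big_nil.
  exact: tame_cst.
have -> : (fun z => \sum_(j <- i :: s) f j z) = (fun z => f i z + \sum_(j <- s) f j z).
  by apply/funext => z; rewrite big_cons.
exact: tame_ex_add.
Qed.

Lemma tame_eval_poly s : exists D K, tame D K (eval_poly s : Cn R n -> C^o).
Proof.
apply: (@tame_ex_sum _ _ s (fun m z => ratc m.1 * \prod_(j <- m.2) z ord0 j : C^o)).
move=> [c l] /=; have [D [K lt]] := tame_prod_coord l.
by exists D, (rn (ratc c) * K); exact: (tame_scale (ratc c) lt).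
Qed.

Lemma eval_poly_cat s t z : eval_poly (s ++ t) z = eval_poly s z + eval_poly t z.
Proof. exact: big_cat. Qed.

Lemma eval_poly_coord j s z :
  eval_poly [seq (m.1, j :: m.2) | m <- s] z = z ord0 j * eval_poly s z.
Proof.
rewrite /eval_poly big_map mulr_sumr; apply: eq_bigr => m _ /=.
by rewrite big_cons mulrCA.
Qed.

Definition ratc_mul (c d : rat * rat) : rat * rat :=
  (c.1 * d.1 - c.2 * d.2, c.1 * d.2 + c.2 * d.1).

Lemma ratcM c d : ratc (ratc_mul c d) = ratc c * ratc d.
Proof. by rewrite /ratc /ratc_mul /= rmorphB rmorphD !rmorphM. Qed.

Lemma eval_poly_scale c s z : eval_poly [seq (ratc_mul c m.1, m.2) | m <- s] z = ratc c * eval_poly s z.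
Proof.
rewrite /eval_poly big_map mulr_sumr; apply: eq_bigr => m _ /=.
by rewrite ratcM mulrA.
Qed.

Lemma ratc_dense (c : C) (e : R) : 0 < e -> exists d, rn (c - ratc d) <= e.
Proof.
move=> e0.
have near (x : R) : exists q : rat, `|x - ratr q| <= e / 2.
  have [|q] := @rat_in_itvoo R (x - e / 2) (x + e / 2).
    by have := e0; lra.
  rewrite in_itv /= => /andP[q1 q2]; exists q.
  by rewrite ler_norml; apply/andP; split; lra.
have [a aP] := near (complex.Re c); have [b bP] := near (complex.Im c).
exists (a, b); apply: le_trans (rn_le_ReIm _) _; rewrite !raddfB /= [e]splitr.
exact: lerD.
Qed.

Definition approximable f := forall M e, 0 <= M -> 0 < e -> exists s, forall z, rn z <= M ->
  rn (f z - eval_poly s z) <= e.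

Lemma approximable_lim f : (forall M e, 0 <= M -> 0 < e -> exists2 f', approximable f' &
   forall z, rn z <= M -> rn (f z - f' z) <= e) -> approximable f.
Proof.
move=> fl M e M0 e0; have e20 : 0 < e / 2 by rewrite divr_gt0.
have [f' f'a ff'] := fl M _ M0 e20; have [s sP] := f'a M _ M0 e20.
exists s => z zM; apply: le_trans (rn_tri (f' z) _ _) _.
by rewrite [e]splitr lerD ?ff' ?sP.
Qed.

Lemma approximableD f g : approximable f -> approximable g ->
  approximable (fun z => f z + g z).
Proof.
move=> fa ga M e M0 e0; have e20 : 0 < e / 2 by rewrite divr_gt0.
have [s sP] := fa M _ M0 e20; have [t tP] := ga M _ M0 e20.
exists (s ++ t) => z zM; rewrite eval_poly_cat opprD addrACA.
by apply: le_trans (rnD _ _) _; rewrite [e]splitr lerD ?sP ?tP.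
Qed.

Lemma approximable0 : approximable (fun=> 0).
Proof. by move=> M e M0 e0; exists [::] => z _; rewrite /eval_poly big_nil subrr rn0 ltW. Qed.

Lemma approximable_sum (I : Type) (s : seq I) (f : I -> Cn R n -> C) :
  (forall i, approximable (f i)) -> approximable (fun z => \sum_(i <- s) f i z).
Proof.
move=> fa; elim: s => [|i s ih].
  have -> : (fun z => \sum_(i <- [::]) f i z) = (fun=> 0).
    by apply/funext => z; rewrite big_nil.
  exact: approximable0.
have -> : (fun z => \sum_(j <- i :: s) f j z) = (fun z => f i z + \sum_(j <- s) f j z).
  by apply/funext => z; rewrite big_cons.
exact: approximableD.
Qed.

Lemma approximable_coord j f : approximable f -> approximable (fun z => z ord0 j * f z).
Proof.
move=> fa M e M0 e0; have M1 : 0 < M + 1 by rewrite ltr_wpDl.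
have [||s sP] := fa M (e / (M + 1)) => //; first by rewrite divr_gt0.
exists [seq (m.1, j :: m.2) | m <- s] => z zM; rewrite eval_poly_coord -mulrBr rnM.
apply: le_trans (_ : (M + 1) * (e / (M + 1)) <= _); last by rewrite mulrC divfK ?gt_eqF.
apply: ler_pM; rewrite ?rn_ge0 ?sP//; apply: le_trans (rn_coord _ _ _) _.
by apply: le_trans zM _; rewrite lerDl.
Qed.

(** The constant [c] has to be replaced by one of Q(i); the error this makes is small
because a polynomial is bounded on balls. *)
Lemma approximable_scale (c : C) f : approximable f -> approximable (fun z => c * f z).
Proof.
move=> fa M e M0 e0; have e20 : 0 < e / 2 by rewrite divr_gt0.
have c1 : 0 < rn c + 1 by rewrite ltr_wpDl ?rn_ge0.
have [||s sP] := fa M (e / 2 / (rn c + 1)) => //; first by rewrite divr_gt0.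
have [D [K [J [_ sK _ _]]]] := tame_eval_poly s.
pose B := `|K * (1 + M) ^+ D| + 1.
have B0 : 0 < B by rewrite ltr_wpDl.
have [|d dP] := @ratc_dense c (e / 2 / B); first by rewrite divr_gt0.
exists [seq (ratc_mul d m.1, m.2) | m <- s] => z zM; rewrite eval_poly_scale.
have sB : rn (eval_poly s z) <= B.
  have K0 : 0 <= K.
    by have := sK 0; rewrite rn0 addr0 expr1n mulr1; exact: le_trans (rn_ge0 _).
  apply: le_trans (sK z) _; apply: le_trans (_ : K * (1 + M) ^+ D <= _).
    by rewrite ler_wpM2l// lerXn2r ?nnegrE ?addr_ge0 ?rn_ge0// lerD2l.
  by apply: le_trans (ler_norm _) _; rewrite lerDl.
have -> : c * f z - ratc d * eval_poly s z = c * (f z - eval_poly s z) + (c - ratc d) * eval_poly s z by ring.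
apply: le_trans (rnD _ _) _; rewrite !rnM [e]splitr; apply: lerD.
  apply: le_trans (_ : (rn c + 1) * (e / 2 / (rn c + 1)) <= _).
    by apply: ler_pM; rewrite ?rn_ge0 ?sP// lerDl.
  by rewrite mulrC divfK ?gt_eqF.
apply: le_trans (_ : e / 2 / B * B <= _); first by apply: ler_pM; rewrite ?rn_ge0.
by rewrite divfK ?gt_eqF.
Qed.

Lemma approximable_poly (q : {poly C}) j f : approximable f ->
  approximable (fun z => q.[z ord0 j] * f z).
Proof.
elim/poly_ind: q f => [|q c ih] f fa.
  have -> : (fun z => (0 : {poly C}).[z ord0 j] * f z) = (fun=> 0).
    by apply/funext => z; rewrite horner0 mul0r.
  exact: approximable0.
have -> : (fun z => (q * 'X + c%:P).[z ord0 j] * f z) =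
    (fun z => q.[z ord0 j] * (z ord0 j * f z) + c * f z).
  by apply/funext => z; rewrite hornerMXaddC mulrDl mulrA.
by apply: approximableD; [exact/ih/approximable_coord|exact: approximable_scale].
Qed.

Lemma approximable_bounded f M : approximable f ->
  exists2 B, 0 <= B & forall z, rn z <= M -> rn (f z) <= B.
Proof.
move=> fa; have [||s sP] := fa `|M| 1 => //.
have [D [K [J [_ sK _ _]]]] := tame_eval_poly s.
have K0 : 0 <= K.
  by have := sK 0; rewrite rn0 addr0 expr1n mulr1; exact: le_trans (rn_ge0 _).
exists (1 + K * (1 + `|M|) ^+ D).
  by rewrite addr_ge0// mulr_ge0// exprn_ge0// addr_ge0.
move=> z zM; have zM' : rn z <= `|M| by apply: le_trans zM (ler_norm _).
rewrite -[f z](subrK (eval_poly s z)); apply: le_trans (rnD _ _) _.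
apply: lerD; first exact: sP.
apply: le_trans (sK z) _.
by rewrite ler_wpM2l// lerXn2r ?nnegrE ?addr_ge0 ?rn_ge0// lerD2l.
Qed.

Definition freeze (j : nat) (c z : Cn R n) : Cn R n :=
  \row_k (if (k < j)%N then c ord0 k else z ord0 k).

(** Coordinates are frozen one at a time. By descending induction on the number [j] of
frozen coordinates, p(z) f(freeze j c z) is approximable for all approximable p:
if all coordinates are frozen it is a constant multiple of p, and [coord_approx]
expresses the case j by the case j + 1. For j = 0 and p = 1 this is f itself. *)
Lemma approximable_entire f :
  (forall z, differentiable (f : Cn R n -> C^o) z) -> approximable f.
Proof.
move=> fd.
have key k j : (j + k = n)%N -> forall c p, approximable p ->
    approximable (fun z => p z * f (freeze j c z)).
  elim: k j => [|k ih] j jk c p pa.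
    have -> : (fun z => p z * f (freeze j c z)) = (fun z => f c * p z).
      apply/funext => z; rewrite mulrC; congr (f _ * _).
      by apply/rowP => l; rewrite mxE -[j]addn0 jk ltn_ord.
    exact: approximable_scale.
  have jn : (j < n)%N by rewrite -jk addnS ltnS leq_addr.
  pose jo := Ordinal jn.
  apply: approximable_lim => M e M0 e0.
  have [B B0 BP] := approximable_bounded M pa.
  pose M' := Num.max (M + 1) (rn c).
  have M'0 : 0 < M' by rewrite lt_max ltr_wpDl.
  have [|N [L [x [xM' fa]]]] := @coord_approx R n f jo M' (e / (B + 1)) fd M'0.
    by rewrite divr_gt0// ltr_wpDl.
  have mixS z u : subst_coord (freeze j c z) jo u = freeze j.+1 (subst_coord c jo u) z.
    apply/rowP => l; rewrite !mxE [(l < j.+1)%N]ltnS [(l <= j)%N]leq_eqVlt.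
    have -> : (l == jo) = (l == j :> nat) by [].
    by case: (l == j :> nat).
  have mixj z : freeze j c z ord0 jo = z ord0 jo by rewrite mxE ltnn.
  exists (fun z => \sum_(l < N) (L l).[z ord0 jo] * p z * f (freeze j.+1 (subst_coord c jo (x l)) z)).
    apply: approximable_sum => l.
    apply: (ih j.+1 _ (subst_coord c jo (x l)) (fun z => (L l).[z ord0 jo] * p z)).
      by rewrite addSn -addnS.
    exact: approximable_poly.
  move=> z zM.
  have mM : rn (freeze j c z) <= M'.
    apply: rn_rV_le => [|l]; first exact: ltW.
    rewrite mxE; case: ifP => _; rewrite le_max; apply/orP; [right|left].
      exact: rn_coord.
    by apply: le_trans (rn_coord _ _ _) _; apply: le_trans zM _; rewrite lerDl.
  have := fa _ mM; rewrite mixj => h.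
  have -> : p z * f (freeze j c z) -
      \sum_(l < N) (L l).[z ord0 jo] * p z * f (freeze j.+1 (subst_coord c jo (x l)) z) =
    p z * (f (freeze j c z) - \sum_(l < N) (L l).[z ord0 jo] * f (subst_coord (freeze j c z) jo (x l))).
    rewrite mulrBr mulr_sumr; congr (_ - _); apply: eq_bigr => l _.
    by rewrite mixS mulrCA mulrA.
  rewrite rnM; apply: le_trans (_ : (B + 1) * (e / (B + 1)) <= _).
    apply: ler_pM; rewrite ?rn_ge0//.
    by apply: le_trans (BP z zM) _; rewrite lerDl.
  by rewrite mulrC divfK ?gt_eqF// ltr_wpDl.
have one : approximable (fun=> 1).
  move=> M e M0 e0; exists [:: ((1, 0), [::])] => z _.
  by rewrite /eval_poly big_seq1 big_nil mulr1 /ratc /= rmorph1 rmorph0 subrr rn0 ltW.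
have := key n 0%N (add0n n) 0 _ one.
have -> // : (fun z => 1 * f (freeze 0 0 z)) = f.
by apply/funext => z; rewrite mul1r; congr f; apply/rowP => l; rewrite mxE.
Qed.

End Countable.

Section VectorFamily.
Variables (R : realType) (n m : nat).
Local Notation C := (R[i]).

Definition poly_map (q : nat) (z : Cn R n) : Cn R m :=
  let s := odflt [::] (unpickle q : option (seq (seq ((rat * rat) * seq 'I_n)))) in
  \row_(i < m) eval_poly (nth [::] s i) z.

Lemma tame_poly_map q : exists D K, tame D K (poly_map q).
Proof.
rewrite /poly_map; set s := odflt _ _.
have -> : (fun z : Cn R n => \row_(i < m) eval_poly (nth [::] s i) z : Cn R m) =
   (fun z => \sum_(i < m) eval_poly (nth [::] s i) z *: (delta_mx ord0 i : Cn R m)).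
  apply/funext => z; apply/rowP => k; rewrite summxE mxE (bigD1 k)//= !mxE !eqxx mulr1.
  rewrite big1 ?addr0// => i /negPf ik.
  by rewrite !mxE eqxx eq_sym ik mulr0.
apply: tame_ex_sum => i; have [D [K st]] := tame_eval_poly R (nth [::] s i).
by have := tame_mul st (tame_cst n (delta_mx ord0 i : Cn R m)); do 2 eexists; eassumption.
Qed.

Lemma poly_map_dense (h : Cn R n -> Cn R m) (M e : R) :
  (forall z, differentiable h z) -> 0 <= M -> 0 < e ->
  exists q, forall z, rn z <= M -> rn (h z - poly_map q z) <= e.
Proof.
move=> hd M0 e0.
have ex (i : 'I_m) : exists s, forall z, rn z <= M -> rn (h z ord0 i - eval_poly s z) <= e.
  apply: (@approximable_entire R n (fun z => h z ord0 i)) => // z.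
  exact: (differentiable_comp (hd z) (differentiable_coord (h z) ord0 i)).
have [s sP] := choice ex.
exists (pickle ([seq s i | i <- enum 'I_m] : seq (seq ((rat * rat) * seq 'I_n)))) => z zM.
rewrite /poly_map pickleK /=; apply: rn_rV_le => [|i]; first exact: ltW.
rewrite !mxE (nth_map i) ?size_enum_ord// nth_ord_enum; exact: sP.
Qed.
End VectorFamily.

(** * Continuous maps into a lattice *)

Lemma countable_img (T U : Type) (f : T -> U) (A : set T) :
  countable A -> countable (f @` A).
Proof. by move=> cA; apply: sub_countable cA; exact: card_image_le. Qed.

Section Lattice.
Variables (R : realType) (m : nat) (L : lattice R m).
Local Notation C := (R[i]).

Lemma torus_projP (w w' : Cn R m) :
  torus_proj L w = torus_proj L w' <-> lattice_set L (w - w').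
Proof.
have -> : (torus_proj L w = torus_proj L w') =
  (\pi_({eq_quot lattice_equiv L}) w = \pi_({eq_quot lattice_equiv L}) w') by [].
split => [/eqmodP /asboolP //|h].
by apply/eqmodP/asboolP.
Qed.

Lemma torus_projD (w w' v : Cn R m) : lattice_set L v ->
  torus_proj L w = torus_proj L w' -> torus_proj L (w + v) = torus_proj L w'.
Proof.
move=> Lv <-; apply/torus_projP.
by rewrite addrAC subrr add0r.
Qed.

Lemma lattice_countable : countable (lattice_set L).
Proof.
have [b [_ ->]] := lattice_full_rank L.
have -> : [set \sum_i b i *~ k i | k in [set: 'I_(2 * m) -> int]] =
    [set \sum_i b i *~ k i | k in [set: {ffun 'I_(2 * m) -> int}]].
  apply/seteqP; split => [_ [k _ <-]|_ [k _ <-]]; last by exists k.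
  by exists [ffun i => k i] => //; apply: eq_bigr => i _; rewrite ffunE.
exact/countable_img/countableP.
Qed.

End Lattice.

Section Lift.
Variables (R : realType) (n : nat).
Local Notation C := (R[i]).
Implicit Types (B : set (Cn R n)) (z : Cn R n).

Definition contin_on (V : normedModType C) B (f : Cn R n -> V) := forall z, B z ->
  forall e : R, 0 < e -> exists2 d : R, 0 < d &
    forall z', B z' -> rn (z' - z) < d -> rn (f z' - f z) < e.

Lemma contin_onB (V : normedModType C) B (f g : Cn R n -> V) :
  contin_on B f -> contin_on B g -> contin_on B (fun z => f z - g z).
Proof.
move=> fc gc z Bz e e0; have e20 : 0 < e / 2 by rewrite divr_gt0.
have [d d0 dP] := fc z Bz _ e20; have [d' d'0 d'P] := gc z Bz _ e20.
exists (Num.min d d'); first by rewrite lt_min d0.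
move=> z' Bz'; rewrite lt_min => /andP[z1 z2].
rewrite opprD addrACA -opprD; apply: le_lt_trans (rnB _ _) _.
by rewrite [e]splitr; apply: ltrD; [exact: dP|exact: d'P].
Qed.

Lemma contin_onD_cst (V : normedModType C) B (f : Cn R n -> V) (c : V) :
  contin_on B f -> contin_on B (fun z => f z + c).
Proof.
move=> fc z Bz e e0; have [d d0 dP] := fc z Bz _ e0; exists d => // z' Bz' z'z.
by rewrite opprD addrACA subrr addr0; exact: dP.
Qed.

Lemma contin_onS (V : normedModType C) B B' (f : Cn R n -> V) : B' `<=` B ->
  contin_on B f -> contin_on B' f.
Proof.
move=> BB fc z /BB Bz e e0; have [d d0 dP] := fc z Bz _ e0; exists d => // z' /BB.
exact: dP.
Qed.

Definition seg (p q : Cn R n) (t : R) : Cn R n := p + t%:C *: (q - p).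

Definition convex_in B := forall p q t, B p -> B q -> 0 <= t <= 1 -> B (seg p q t).

Lemma convex_inI B B' : convex_in B -> convex_in B' -> convex_in (B `&` B').
Proof. by move=> cB cB' p q t [? ?] [? ?] t01; split; [exact: cB|exact: cB']. Qed.

Lemma countable_interval (a b : R) (D : set R) : a < b ->
  `[a, b]%classic `<=` D -> ~ countable D.
Proof.
move=> ab abD /(sub_countable (subset_card_le abD)) /countable_lebesgue_measure0.
rewrite lebesgue_measure_itv /= lte_fin ab -EFinB => /eqP.
by rewrite eqe subr_eq0 gt_eqF.
Qed.

(** If some real coordinate of [g] had different values at [p] and [q], it would take
all values in between along the segment, but a lattice is countable. *)
Lemma contin_lattice_const (m : nat) (L : lattice R m) B (g : Cn R n -> Cn R m) :
  convex_in B -> contin_on B g -> (forall z, B z -> lattice_set L (g z)) ->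
  forall p q, B p -> B q -> g p = g q.
Proof.
move=> cB gc gL p q Bp Bq.
(* Clamping the parameter extends the segment from p to q to the whole line. *)
pose cl (t : R) := Num.max 0 (Num.min 1 t).
have cl01 t : 0 <= cl t <= 1.
  by rewrite /cl le_max lexx /= ge_max ler01 ge_min lexx.
have clE t : (t <= 0 /\ cl t = 0) \/ (0 <= t <= 1 /\ cl t = t) \/ (1 <= t /\ cl t = 1).
  have [t0|t0] := leP t 0.
    left; split=> //; rewrite /cl min_r ?max_l//.
    exact: le_trans t0 ler01.
  right; have [t1|t1] := leP t 1.
    by left; rewrite (ltW t0); split=> //; rewrite /cl min_r ?max_r// ltW.
  by right; rewrite (ltW t1); split=> //; rewrite /cl min_l ?max_r// ltW.
have cl_lip s t : `|cl s - cl t| <= `|s - t|.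
  have := ler_norm (s - t); have := ler_norm (t - s); rewrite distrC => h1 h2.
  have := normr_ge0 (s - t).
  by case: (clE s) => [[? ->]|[[/andP[? ?] ->]|[? ->]]];
    case: (clE t) => [[? ->]|[[/andP[? ?] ->]|[? ->]]]; rewrite ler_norml;
    move=> ?; apply/andP; split; lra.
have main (phi : Cn R m -> R) : (forall v w, `|phi v - phi w| <= rn (v - w)) ->
    phi (g p) = phi (g q).
  move=> phil; apply/eqP/negPn/negP => neq.
  pose u t := phi (g (seg p q (cl t))).
  have uc : continuous u.
    move=> t; apply/cvgrPdist_lt => e e0.
    have [d d0 dP] := gc _ (cB _ _ _ Bp Bq (cl01 t)) _ e0.
    have K1 : 0 < rn (q - p) + 1 by rewrite ltr_wpDl ?rn_ge0.
    apply/nbhs_ballP; exists (d / (rn (q - p) + 1)); first by rewrite /= divr_gt0.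
    move=> s /=; rewrite /ball /= ltr_pdivlMr// => ts.
    apply: le_lt_trans (phil _ _) _; rewrite rn_distC; apply: dP; first exact: cB.
    rewrite /seg opprD addrACA subrr add0r -scalerBl rnZ -rmorphB rn_real.
    apply: le_lt_trans ts; rewrite [in leRHS]distrC.
    by apply: ler_pM; rewrite ?rn_ge0// lerDl.
  have u0 : u 0 = phi (g p).
    rewrite /u; case: (clE 0) => [[_ ->]|[[_ ->]|[]]]; last by rewrite ler10.
      by rewrite /seg scale0r addr0.
    by rewrite /seg scale0r addr0.
  have u1 : u 1 = phi (g q).
    rewrite /u; case: (clE 1) => [[]|[[_ ->]|[_ ->]]]; first by rewrite ler10.
      by rewrite /seg scale1r addrC subrK.
    by rewrite /seg scale1r addrC subrK.
  have sub : `[Num.min (u 0) (u 1), Num.max (u 0) (u 1)]%classic `<=` phi @` (lattice_set L).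
    move=> v /=; rewrite in_itv /= => vI.
    have [c c01 <-] := IVT ler01 (continuous_subspaceT uc) vI.
    by exists (g (seg p q (cl c))) => //; apply: gL; exact: cB.
  apply: countable_interval sub _; last exact/countable_img/lattice_countable.
  rewrite u0 u1 gt_min !lt_max !ltxx orbF /=.
  by move: neq; rewrite neq_lt => /orP[->|->]; rewrite ?orbT.
apply/rowP => j; rewrite [LHS]complexE [RHS]complexE.
rewrite (main (fun v => complex.Re (v ord0 j))); last first.
  move=> v w; rewrite -raddfB; apply: le_trans (Re_le_rn _) _.
  by have := rn_coord (v - w) ord0 j; rewrite !mxE.
rewrite (main (fun v => complex.Im (v ord0 j)))//.
move=> v w; rewrite -raddfB; apply: le_trans (Im_le_rn _) _.
by have := rn_coord (v - w) ord0 j; rewrite !mxE.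
Qed.

End Lift.

(** * Lifting maps from the torus *)

Section Liftable.
Variables (R : realType) (n m : nat) (L : lattice R m).
Local Notation C := (R[i]).
Implicit Types (B : set (Cn R n)) (z : Cn R n).
Variable F : Cn R n -> torus L.

Definition liftable B := exists f : Cn R n -> Cn R m,
  contin_on B f /\ forall z, B z -> F z = torus_proj L (f z).

Definition real_coord (i : 'I_n * bool) z : R :=
  if i.2 then complex.Re (z ord0 i.1) else complex.Im (z ord0 i.1).

Lemma real_coord_le i z : `|real_coord i z| <= rn z.
Proof.
rewrite /real_coord; case: i.2; apply: le_trans (rn_coord z ord0 i.1).
  exact: Re_le_rn.
exact: Im_le_rn.
Qed.

Lemma real_coordB i z w : real_coord i (z - w) = real_coord i z - real_coord i w.
Proof. by rewrite /real_coord; case: i.2; rewrite !mxE raddfB. Qed.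

Lemma real_coord_lip i z w : `|real_coord i z - real_coord i w| <= rn (z - w).
Proof. by rewrite -real_coordB real_coord_le. Qed.

Lemma real_coord_seg i p q t : real_coord i (seg p q t) = real_coord i p + t * (real_coord i q - real_coord i p).
Proof.
rewrite /real_coord /seg; case: i.2; rewrite !mxE; case: (p ord0 i.1) => a b;
  case: (q ord0 i.1) => c d /=; ring.
Qed.

Lemma rn_le_real_coord z M : 0 <= M -> (forall i, `|real_coord i z| <= M) -> rn z <= M + M.
Proof.
move=> M0 zM; apply: rn_rV_le => [|j]; first by rewrite addr_ge0.
apply: le_trans (rn_le_ReIm _) _.
by apply: lerD; [exact: (zM (j, true))|exact: (zM (j, false))].
Qed.

Lemma convex_in_le i c : convex_in [set z | real_coord i z <= c].
Proof.
move=> p q t /= pc qc /andP[t0 t1]; rewrite real_coord_seg.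
have : t * (real_coord i q - c) <= 0 by rewrite mulr_ge0_le0// subr_le0.
have : (1 - t) * (real_coord i p - c) <= 0 by rewrite mulr_ge0_le0 ?subr_ge0// subr_le0.
lra.
Qed.

Lemma convex_in_ge i c : convex_in [set z | c <= real_coord i z].
Proof.
move=> p q t /= pc qc /andP[t0 t1]; rewrite real_coord_seg.
have : 0 <= t * (real_coord i q - c) by rewrite mulr_ge0// subr_ge0.
have : 0 <= (1 - t) * (real_coord i p - c) by rewrite mulr_ge0 ?subr_ge0.
lra.
Qed.

Lemma convex_in_ball (x : Cn R n) d : convex_in [set z | rn (z - x) < d].
Proof.
move=> p q t /= pd qd /andP[t0 t1].
have -> : seg p q t - x = (1 - t)%:C *: (p - x) + t%:C *: (q - x).
  by apply/rowP => j; rewrite /seg !mxE rmorphB rmorph1; ring.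
apply: le_lt_trans (rnD _ _) _; rewrite !rnZ !rn_real !ger0_norm ?subr_ge0//.
have [t00|t00] := eqVneq t 0; first by rewrite t00 mul0r addr0 subr0 mul1r.
have : 0 < t * (d - rn (q - x)) by rewrite mulr_gt0 ?subr_gt0// lt_def t00.
have : 0 <= (1 - t) * (d - rn (p - x)) by rewrite mulr_ge0 ?subr_ge0// ltW.
lra.
Qed.

(** On the hyperplane where they meet, the two lifts differ by a lattice-valued
continuous function. It is constant because the section of [B] is convex, so one
lift can be translated to agree with the other one there. *)
Lemma liftable_glue B i c : convex_in B ->
  liftable (B `&` [set z | real_coord i z <= c]) -> liftable (B `&` [set z | c <= real_coord i z]) ->
  liftable B.
Proof.
move=> cB [f1 [f1c f1F]] [f2 [f2c f2F]].
have [f3 [f3c f3F f13]] : exists f3 : Cn R n -> Cn R m,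
    [/\ contin_on (B `&` [set z | c <= real_coord i z]) f3,
        forall z, (B `&` [set z | c <= real_coord i z]) z -> F z = torus_proj L (f3 z)
      & forall z, B z -> real_coord i z = c -> f1 z = f3 z].
  have [[p [Bp pc]]|nop] := pselect (exists p, B p /\ real_coord i p = c); last first.
    by exists f2; split=> // z Bz zc; exfalso; apply: nop; exists z.
  have both z : B z -> real_coord i z = c -> lattice_set L (f1 z - f2 z).
    move=> Bz zc; apply/torus_projP; rewrite -f1F; last by split=> //=; rewrite zc.
    by rewrite -f2F//; split=> //=; rewrite zc.
  exists (fun z => f2 z + (f1 p - f2 p)); split.
  - exact: contin_onD_cst.
  - move=> z Bz; rewrite f2F//; apply/esym; apply: torus_projD => //.
    exact: both.
  move=> z Bz zc; pose E := B `&` [set z | real_coord i z <= c] `&` [set z | c <= real_coord i z].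
  have Ez : E z by split; [split=> //=; rewrite zc|rewrite /= zc].
  have Ep : E p by split; [split=> //=; rewrite pc|rewrite /= pc].
  have : f1 z - f2 z = f1 p - f2 p.
    apply: (@contin_lattice_const _ _ _ L E (fun z => f1 z - f2 z)) => //.
    - by apply: convex_inI; [apply: convex_inI => //; exact: convex_in_le|exact: convex_in_ge].
    - apply: contin_onB.
        by apply: contin_onS f1c => x [].
      by apply: contin_onS f2c => x [[]].
    move=> x [[Bx x1] x2]; apply: both => //.
    by apply/eqP; rewrite eq_le; apply/andP.
  by move=> <-; rewrite addrC subrK.
exists (fun z => if real_coord i z <= c then f1 z else f3 z); split; last first.
  move=> z Bz; case: ifP => [zc|/negbT]; first exact: f1F.
  by rewrite -ltNge => /ltW zc; exact: f3F.
move=> z Bz e e0.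
have [zc|zc|zc] := ltgtP (real_coord i z) c.
- have [|d d0 dP] := f1c z _ e e0; first by split=> //; exact: ltW.
  exists (Num.min d (c - real_coord i z)); first by rewrite lt_min d0 subr_gt0.
  move=> z' Bz'; rewrite lt_min => /andP[z1 z2].
  have zc' : real_coord i z' <= c.
    by have := real_coord_lip i z' z; have := ler_norm (real_coord i z' - real_coord i z); lra.
  by rewrite zc'; apply: dP.
- have [|d d0 dP] := f3c z _ e e0; first by split=> //; exact: ltW.
  exists (Num.min d (real_coord i z - c)); first by rewrite lt_min d0 subr_gt0.
  move=> z' Bz'; rewrite lt_min => /andP[z1 z2].
  have zc' : c < real_coord i z'.
    by have := real_coord_lip i z z'; rewrite rn_distC; have := ler_norm (real_coord i z - real_coord i z'); lra.
  rewrite ifF; last by rewrite leNgt zc'.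
  by apply: dP => //; split=> //; exact: ltW.
have [|d d0 dP] := f1c z _ e e0; first by split=> //=; rewrite zc.
have [|d' d'0 d'P] := f3c z _ e e0; first by split=> //=; rewrite zc.
exists (Num.min d d'); first by rewrite lt_min d0.
move=> z' Bz'; rewrite lt_min => /andP[z1 z2].
case: ifP => [z'c|/negbT]; first by apply: dP.
rewrite -ltNge => /ltW z'c; rewrite f13//; exact: d'P.
Qed.

(** [K] counts the halvings, over all coordinates, that bring the widths down to
[dl]. *)
Lemma liftable_subdivide (dl : R) (Big : set (Cn R n)) : 0 < dl ->
  (forall B, convex_in B -> B `<=` Big ->
     (forall z w i, B z -> B w -> `|real_coord i z - real_coord i w| <= dl) -> liftable B) ->
  forall (K : nat) (k : 'I_n * bool -> nat), (\sum_i k i = K)%N ->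
  forall B, convex_in B -> B `<=` Big ->
   (forall i, exists a, forall z, B z -> a <= real_coord i z <= a + dl * 2 ^+ k i) -> liftable B.
Proof.
move=> dl0 base; elim=> [|K ih] k kK B cB BBig Bk.
  apply: base => // z w i Bz Bw; have [a aP] := Bk i.
  have ki : k i = 0%N.
    by move/eqP: kK; rewrite sum_nat_eq0 => /forallP/(_ i)/eqP.
  move: (aP z Bz) (aP w Bw); rewrite ki expr0 mulr1 => /andP[h1 h2] /andP[h3 h4].
  by rewrite ler_norml; apply/andP; split; lra.
have [i ki] : exists i, (0 < k i)%N.
  apply/existsP; apply: contraT; rewrite negb_exists => /forallP h.
  suff : (\sum_i k i = 0)%N by rewrite kK.
  by apply: big1 => i _; have := h i; rewrite -eqn0Ngt => /eqP.
pose k' j := if j == i then (k i).-1 else k j.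
have k'K : (\sum_j k' j = K)%N.
  have := kK; rewrite (bigD1 i)//= [in X in _ -> X](bigD1 i)//= /k' eqxx.
  rewrite -[k i]prednK// addSn => -[<-]; congr (_ + _)%N.
  by apply: eq_bigr => j /negPf ->.
have [a aP] := Bk i.
have k2 : dl * 2 ^+ k i = dl * 2 ^+ (k i).-1 + dl * 2 ^+ (k i).-1.
  by rewrite -{1}[k i]prednK// exprS; ring.
apply: (@liftable_glue B i (a + dl * 2 ^+ (k i).-1)) => //.
  apply: (ih k') => //.
  - by apply: convex_inI => //; exact: convex_in_le.
  - by move=> z [/BBig].
  move=> j; rewrite /k'; case: eqP => [->|_].
    by exists a => z [Bz /= ->]; have /andP[-> _] := aP z Bz.
  by have [b bP] := Bk j; exists b => z [/bP].
apply: (ih k') => //.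
- by apply: convex_inI => //; exact: convex_in_ge.
- by move=> z [/BBig].
move=> j; rewrite /k'; case: eqP => [->|_].
  exists (a + dl * 2 ^+ (k i).-1) => z [Bz /= ->].
  by have /andP[_] := aP z Bz; rewrite k2 addrA => ->.
by have [b bP] := Bk j; exists b => z [/bP].
Qed.

Hypothesis Fhol : holomorphic_torus F.

Let cube (k : nat) : set (Cn R n) := [set z | forall i, `|real_coord i z| <= k%:R].

Let cube_conv k : convex_in (cube k).
Proof.
move=> p q t pk qk t01 i; rewrite ler_norml.
have [p1 p2] := andP (eqbLR (ler_norml _ _) (pk i)).
have [q1 q2] := andP (eqbLR (ler_norml _ _) (qk i)).
apply/andP; split; first exact: (@convex_in_ge i (- k%:R) p q t).
exact: (@convex_in_le i k%:R p q t).
Qed.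

Lemma local_lift_contin x : exists2 d : R, 0 < d &
  exists f, [/\ forall z, rn (z - x) < d -> differentiable f z,
    forall z, rn (z - x) < d -> F z = torus_proj L (f z) &
    contin_on [set z | rn (z - x) < d] f].
Proof.
have [f [/near_rnP[d1 d10 d1P] /near_rnP[d2 d20 d2P]]] := Fhol x.
exists (Num.min d1 d2); first by rewrite lt_min d10.
exists f; split=> [z|z|z /=]; rewrite lt_min => /andP[z1 z2]; [exact: d1P|exact: d2P|].
have fc := differentiable_continuous (d1P z z1).
move=> e e0; have [d d0 dP] := (continuous_rnP f z).1 fc e e0.
by exists d => // z' _; exact: dP.
Qed.

Lemma liftable_cube k : liftable (cube k).
Proof.
have [K cK KM] := @polydisc_compact R n (k%:R + k%:R).
have [d d0 dP] : exists2 d : R, 0 < d & forall x, K x ->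
    forall B, B `<=` [set z | rn (z - x) < d] -> liftable B.
  apply: compact_uniform cK _ _.
    move=> d d' x d'd xd B BB; apply: xd => z /BB /= h; exact: lt_le_trans h d'd.
  move=> x _; have [d d0 [f [_ fF fc]]] := local_lift_contin x.
  exists (d / 2); first by rewrite divr_gt0.
  move=> x' xx' B BB; have BB' : B `<=` [set z | rn (z - x) < d].
    move=> z /BB /= zx'; apply: le_lt_trans (rn_tri x' _ _) _.
    by rewrite [d]splitr; exact: ltrD.
  by exists f; split=> [|z /BB' /fF//]; exact: contin_onS fc.
have dl0 : 0 < d / 4 by rewrite divr_gt0.
have base B : convex_in B -> B `<=` cube k ->
     (forall z w i, B z -> B w -> `|real_coord i z - real_coord i w| <= d / 4) -> liftable B.
  move=> cB Bk Bd; have [[x Bx]|Be] := pselect (exists x, B x); last first.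
    by exists (fun=> 0); split=> z Bz; exfalso; apply: Be; exists z.
  apply: (dP x).
    by apply: KM; apply: rn_le_real_coord => // i; exact: Bk.
  move=> z Bz /=; apply: le_lt_trans (_ : d / 4 + d / 4 < d); last by lra.
  by apply: rn_le_real_coord => [|i]; [exact: ltW|rewrite real_coordB; exact: Bd].
have [N N0 NP] := exists_nat_ge ((k%:R + k%:R) / (d / 4)).
apply: (liftable_subdivide dl0 base (erefl (\sum_(i : 'I_n * bool) N)%N)) => // i.
exists (- k%:R) => z /(_ i); rewrite ler_norml => /andP[-> h] /=.
apply: le_trans h _; rewrite -lerBlDl opprK.
apply: le_trans (_ : N%:R * (d / 4) <= _); first by rewrite -ler_pdivrMr.
by rewrite mulrC ler_wpM2l ?(ltW dl0)// -natrX ler_nat ltnW// ltn_expl.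
Qed.

(** The lifts on larger and larger cubes, normalised at 0, extend each other. Near each
point the resulting continuous map differs by a constant from a holomorphic local
lift, so it is differentiable. *)
Theorem lift_entire : exists h : Cn R n -> Cn R m,
  (forall z, differentiable h z) /\ (forall z, F z = torus_proj L (h z)).
Proof.
have [f fP] := choice liftable_cube.
have cube0 k : cube k 0.
  by move=> i; rewrite /real_coord; case: i.2; rewrite mxE normr0.
(* Translate all lifts to have the same value at 0. *)
pose f' k z := f k z + (f 0%N 0 - f k 0).
have L0 k : lattice_set L (f 0%N 0 - f k 0).
  by apply/torus_projP; have [_ <-] := fP 0%N => //; have [_ <-] := fP k.
have f'F k z : cube k z -> F z = torus_proj L (f' k z).
  have [_ fF] := fP k => zk; rewrite (fF z zk); apply/esym/torus_projD => //.
have f'c k : contin_on (cube k) (f' k) by apply: contin_onD_cst; have [] := fP k.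
have sub k l : (k <= l)%N -> cube k `<=` cube l.
  by move=> kl z zk i; apply: le_trans (zk i) _; rewrite ler_nat.
have agree0 k l z : (k <= l)%N -> cube k z -> f' k z = f' l z.
  move=> kl zk; apply/subr0_eq.
  have E j : f' j 0 = f 0%N 0 by rewrite /f' addrC subrK.
  have -> : 0 = f' k 0 - f' l 0 by rewrite !E subrr.
  apply: (@contin_lattice_const _ _ _ L (cube k) (fun z => f' k z - f' l z)) => //.
    by apply: contin_onB => //; apply: contin_onS (f'c l); exact: sub.
  by move=> x xk; apply/torus_projP; rewrite -f'F// -f'F//; exact: sub xk.
have agree k l z : cube k z -> cube l z -> f' k z = f' l z.
  move=> zk zl; have [kl|/ltnW lk] := leqP k l; first exact: agree0.
  exact/esym/agree0.
have exk z : exists k, cube k z.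
  have [k _ kP] := exists_nat_ge (rn z); exists k => i.
  exact: le_trans (real_coord_le i z) kP.
have [kk kkP] := choice exk.
pose h z := f' (kk z) z.
have hE k z : cube k z -> h z = f' k z by move=> zk; exact: agree.
have hF z : F z = torus_proj L (h z) by apply: f'F.
have hc z : exists2 d : R, 0 < d & forall z', rn (z' - z) < d -> cube (kk z).+1 z'.
  exists 1 => // z' zz' i; rewrite -natr1.
  have := real_coord_lip i z' z; have := kkP z i.
  have := ler_normD (real_coord i z) (real_coord i z' - real_coord i z); rewrite addrC subrK; lra.
exists h; split; last exact: hF.
move=> z.
have [d d0 [g [gd gF gc]]] := local_lift_contin z.
have [d' d'0 d'P] := hc z.
pose D : set (Cn R n) := [set x | rn (x - z) < d] `&` [set x | rn (x - z) < d'].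
have cD : convex_in D by apply: convex_inI; exact: convex_in_ball.
have Dz : D z by split; rewrite /= subrr rn0.
have hgc : contin_on D (fun x => h x - g x).
  apply: contin_onB; last by apply: contin_onS gc => x [].
  have : contin_on D (f' (kk z).+1) by apply: contin_onS (f'c _) => x [_ /d'P].
  move=> fc x Dx e e0; have [d1 d10 d1P] := fc x Dx e e0; exists d1 => // y Dy yx.
  rewrite (hE (kk z).+1 y); last by case: Dy => _ /d'P.
  by rewrite (hE (kk z).+1 x); [exact: d1P|case: Dx => _ /d'P].
have hgL x : D x -> lattice_set L (h x - g x).
  by move=> [xd _]; apply/torus_projP; rewrite -hF -gF.
have hg x : D x -> h x = g x + (h z - g z).
  move=> Dx; have := contin_lattice_const cD hgc hgL Dx Dz => <-.
  by rewrite addrC subrK.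
have zd : differentiable g z by apply: gd; rewrite subrr rn0.
suff [dh _] : differentiable h z /\ 'd h z = 'd g z :> (_ -> _) by exact: dh.
apply: rn_differentiable_continuous.
  exact: diff_continuous.
move=> e e0; have [d1 d10 d1P] := differentiable_rn zd e0.
exists (Num.min d1 (Num.min d d')); first by rewrite !lt_min d10 d0.
move=> k; rewrite !lt_min => /andP[k1 /andP[k2 k3]].
have Dk : D (z + k) by split; rewrite /= addrC addKr.
have -> : h (z + k) - h z = g (z + k) - g z.
  rewrite (hg _ Dk) -addrA; congr (_ + _).
  by rewrite addrAC subrr add0r.
exact: d1P.
Qed.

End Liftable.

(** * Upper bounds for integrals *)

Section IntegralBound.
Local Open Scope ereal_scope.
Context d (T : measurableType d) (R : realType) (mu : {measure set T -> \bar R}).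

(** The integral of a nonnegative function is a supremum over the simple functions
below it, so monotonicity holds for an arbitrary integrand [f]. *)
Lemma integral_le_cst (D E : set T) (f : T -> \bar R) (c : R) : (0 <= c)%R ->
  measurable E -> D `<=` E -> (forall x, D x -> f x <= c%:E) ->
  \int[mu]_(x in D) f x <= c%:E * mu E.
Proof.
move=> c0 mE DE fc; rewrite -integral_cst//.
have pos : \int[mu]_(x in D) f x <= \int[mu]_(x in D) f^\+ x.
  rewrite integralE -[leRHS]sube0; apply: leeB => //.
  by apply: integral_ge0 => x _; exact: funeneg_ge0.
apply: le_trans pos _.
rewrite !ge0_integralE//.
apply: ge_ereal_sup => _ [h hf <-]; apply: ereal_sup_ubound; exists h => //= x.
apply: le_trans (hf x) _; rewrite /patch; case: ifPn => [|_].
  rewrite inE => Dx; rewrite mem_set; last exact: DE.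
  by rewrite funeposE ge_max lee_fin c0 andbT; exact: fc.
by case: ifP => // _; rewrite lee_fin.
Qed.
End IntegralBound.

Section SigmaFiniteCopy.
Context d (T : measurableType d) (R : realType) (mu : {measure set T -> \bar R}).

(** The structure of a sigma-finite measure depends on a proof, so it is attached to a
constant that has this proof as an argument. *)
Definition sigma_finite_copy of sigma_finite setT mu : set T -> \bar R := mu.

Variable sf : sigma_finite setT mu.

HB.instance Definition _ := Measure.copy (sigma_finite_copy sf) mu.
HB.instance Definition _ :=
  @Measure_isSigmaFinite.Build d T R (sigma_finite_copy sf) sf.
End SigmaFiniteCopy.

Section CubeMeasure.
Local Open Scope ereal_scope.
Variable R : realType.

Definition tcube k (t : R) : set (k.-tuple (measurableTypeR R)) :=
  [set x | forall i, (- t <= tnth x i <= t)%R].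

Lemma measurable_tcube k t : measurable (@tcube k t).
Proof.
have -> : tcube t = \bigcap_(i in [set: 'I_k])
    ((fun x : k.-tuple (measurableTypeR R) => tnth x i) @^-1` `[(- t)%R, t]).
  apply/seteqP; split => [x xt i _|x xt i] /=; first by rewrite in_itv /=.
  by have := xt i I; rewrite /= in_itv.
apply: fin_bigcap_measurable => // i _.
rewrite -[X in measurable X]setTI; apply: measurable_tnth => //.
Qed.

(** The iterated product is a measure as soon as its last factor is sigma-finite,
which follows from the measure of the cubes; both facts are therefore proved by
the same induction. *)
Lemma lebesgue_tuple_cube k : exists mu : {measure set (k.-tuple (measurableTypeR R)) -> \bar R},
  (mu : set _ -> _) = @lebesgue_tuple R k /\
  forall t, (0 <= t)%R -> mu (tcube t) = ((t + t) ^+ k)%:E.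
Proof.
elim: k => [|k [mu [muE mut]]].
  exists (dirac [tuple]); split=> // t t0.
  by rewrite expr0 /= /dirac indicE mem_set// => -[].
have sf : sigma_finite setT mu.
  exists (fun i => tcube i%:R).
    apply/seteqP; split => // x _.
    have [N _ NP] : exists2 N : nat, (0 < N)%N & (\sum_i `|tnth x i| <= N%:R)%R.
      exact: exists_nat_ge.
    exists N => // i; rewrite -ler_norml; apply: le_trans NP.
    by rewrite (bigD1 i)//= lerDl sumr_ge0.
  by move=> i; split; [exact: measurable_tcube|rewrite mut ?ltry].
pose smu := [the {sigma_finite_measure set (k.-tuple (measurableTypeR R)) -> \bar R} of sigma_finite_copy sf].
pose f (p : measurableTypeR R * k.-tuple (measurableTypeR R)) := [the k.+1.-tuple _ of p.1 :: p.2].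
have mf : measurable_fun [set: measurableTypeR R * k.-tuple (measurableTypeR R)] f.
  exact: measurable_cons.
pose nu := [the {measure set (k.+1.-tuple (measurableTypeR R)) -> \bar R} of
   pushforward (lebesgue_measure \x smu) f].
exists (nu mf); split.
  by rewrite /= -muE.
move=> t t0.
have -> : nu mf (tcube t) = (lebesgue_measure \x smu) (`[(- t)%R, t] `*` tcube t).
  rewrite /nu /= /pushforward; congr (_ _).
  apply/seteqP; split => [[a x] /= h|[a x] /= [at_ xt] i].
    split; first by have := h ord0; rewrite in_itv.
    by move=> i; have := h (lift ord0 i); rewrite tnthS.
  have [->|i0] := eqVneq i ord0; first by move: at_; rewrite in_itv.
  have [j ->] : exists j, i = lift ord0 j.
    by case: (unliftP ord0 i) i0 => [j ->|-> /eqP//]; exists j.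
  by rewrite tnthS; exact: xt.
rewrite product_measure1E//; last exact: measurable_tcube.
rewrite /smu /= /sigma_finite_copy mut// exprS EFinM; congr (_ * _).
rewrite lebesgue_measure_itv /= lte_fin; case: ifPn => [_|].
  by rewrite -EFinB opprK.
by rewrite -leNgt => h; congr EFin; lra.
Qed.
End CubeMeasure.

(** * Bounds for the order function *)

Section Forms.
Variable R : realType.
Local Notation C := (R[i]).

Definition dot n (z v : Cn R n) : R :=
  \sum_(j < n) (complex.Re (z ord0 j) * complex.Re (v ord0 j) +
                complex.Im (z ord0 j) * complex.Im (v ord0 j)).

Lemma dot_le n (z v : Cn R n) : `|dot z v| <= (2 * n)%:R * rn z * rn v.
Proof.
apply: le_trans (ler_norm_sum _ _ _) _.
apply: le_trans (_ : \sum_(j < n) 2 * (rn z * rn v) <= _); last first.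
  by rewrite sumr_const card_ord -mulr_natr natrM le_eqVlt; apply/orP; left; apply/eqP; ring.
apply: ler_sum => j _; apply: le_trans (ler_normD _ _) _; rewrite !normrM mulr_natl mulr2n.
have zj := rn_coord z ord0 j; have vj := rn_coord v ord0 j.
apply: lerD; apply: ler_pM => //.
- exact: le_trans (Re_le_rn _) zj.
- exact: le_trans (Re_le_rn _) vj.
- exact: le_trans (Im_le_rn _) zj.
- exact: le_trans (Im_le_rn _) vj.
Qed.

Lemma derive1_quadratic (a b c : R) : derive1 (fun t => a + b * t + c * t ^+ 2) 0 = b.
Proof.
have idd : is_derive (0 : R) (1 : R) id 1 := is_derive_id _ _.
have h : is_derive (0 : R) (1 : R) (cst a + b *: id + c *: (id ^+ 2 : R -> R)) b.
  have h2 : is_derive (0:R) (1:R) (id ^+ 2 : R -> R) 0.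
    have := @is_deriveX R R id 2 (0 : R) 1 1 idd.
    by rewrite /= expr1 mulr0 scale0r.
  have := is_deriveD (is_deriveD (is_derive_cst a (0 : R) (1 : R)) (is_deriveZ b idd)) (is_deriveZ c h2).
  by rewrite scaler0 addr0 add0r [_ *: _]mulr1.
have -> : (fun t => a + b * t + c * t ^+ 2) = cst a + b *: id + c *: (id ^+ 2 : R -> R).
  by apply/funext => t; rewrite !fctE /= expr2.
by rewrite derive1E; exact: (@derive_val _ _ _ _ _ _ _ h).
Qed.

Lemma dot_shift n (z v w : Cn R n) t :
  dot (z + t%:C *: v) w = dot z w + t * dot v w.
Proof.
rewrite /dot mulr_sumr -big_split /=; apply: eq_bigr => j _; rewrite !mxE.
by case: (z ord0 j) => a b; case: (v ord0 j) => c d /=; ring.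
Qed.

Lemma dotC n (z v : Cn R n) : dot z v = dot v z.
Proof. by apply: eq_bigr => j _; ring. Qed.

Lemma sqnormE n (z : Cn R n) : sqnorm z = dot z z.
Proof. by apply: eq_bigr => j _; rewrite !expr2. Qed.

Lemma rderive_sqnorm n (z v : Cn R n) : rderive (@sqnorm R n) z v = 2 * dot z v.
Proof.
rewrite /rderive -(derive1_quadratic (dot z z) (2 * dot z v) (dot v v)).
congr (derive1 _ _); apply/funext => t.
by rewrite sqnormE dot_shift dotC dot_shift (dotC v (z + _)) dot_shift (dotC v z); ring.
Qed.

Lemma rderive_dot n (c : R) (z v w : Cn R n) :
  rderive (fun x => c * dot x w) z v = c * dot v w.
Proof.
rewrite /rderive -[RHS](derive1_quadratic (c * dot z w) (c * dot v w) 0).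
by congr (derive1 _ _); apply/funext => t; rewrite dot_shift; ring.
Qed.

Lemma dc_sqnorm n (z : Cn R n) v :
  dc (@sqnorm R n) z v = - (2 * pi)^-1 * dot z ('i *: v ord0).
Proof.
rewrite /dc /delbar /del !rderive_sqnorm.
set a := (2 * dot z (v ord0))%:C; set b := 2 * dot z ('i *: v ord0).
have -> : (a + 'i * b%:C) / 2%:R - (a - 'i * b%:C) / 2%:R = 'i * b%:C.
  by field.
have gen (P : R) : 'i / P%:C * ('i * b%:C) = (- (b / P))%:C :> C.
  have ii : 'i * 'i = -1 :> C by rewrite -expr2 sqr_i.
  have E : (b / P)%:C = b%:C * P%:C^-1 :> C by rewrite rmorphM fmorphV.
  by rewrite rmorphN /= E mulrAC mulrA ii; ring.
rewrite gen.
rewrite /= /b; move: (@pi R) (@pi_gt0 R) => p p0.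
by field; rewrite gt_eqF.
Qed.

(** At x, d^c of the squared norm sends v to -<x, i v> / (2 pi), which is linear in x. *)
Lemma ddc_sqnorm n (z : Cn R n) v : ddc (@sqnorm R n) z v =
  - (2 * pi)^-1 * (dot (v ord0) ('i *: v ord_max) - dot (v ord_max) ('i *: v ord0)).
Proof.
have E (i : 'I_2) : (fun x => dc (@sqnorm R n) x (fun j => v (lift i j))) =
    (fun x => - (2 * pi)^-1 * dot x ('i *: v (lift i ord0))).
  by apply/funext => x; rewrite dc_sqnorm.
have l0 : lift ord0 ord0 = ord_max :> 'I_2 by apply/val_inj.
have l1 : lift ord_max ord0 = ord0 :> 'I_2 by apply/val_inj.
have E' (i : 'I_2) : rderive (fun x => dc (@sqnorm R n) x (fun j => v (lift i j))) z (v i) =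
    - (2 * pi)^-1 * dot (v i) ('i *: v (lift i ord0)) by rewrite E rderive_dot.
transitivity (\sum_(i < 2) (-1) ^+ i * (- (2 * pi)^-1 * dot (v i) ('i *: v (lift i ord0)))).
  by apply: eq_bigr => i _; rewrite E'.
rewrite big_ord_recl big_ord1 !l0 l1.
move: (- (2 * pi)^-1) (dot _ _) (dot _ _) => a b c.
by rewrite /= expr0 expr1; ring.
Qed.

Lemma ddc_sqnorm_le n (z : Cn R n) v A : 0 <= A -> (forall i, rn (v i) <= A) ->
  `|ddc (@sqnorm R n) z v| <= (2 * n)%:R * A ^+ 2.
Proof.
move=> A0 vA; rewrite ddc_sqnorm normrM.
have pi2 : 2 <= pi :> R := pi_ge2 R.
have h1 : `|- (2 * pi)^-1| <= 2^-1 :> R.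
  rewrite normrN ger0_norm; last by rewrite invr_ge0; lra.
  by rewrite lef_pV2 ?posrE; lra.
have d i j : `|dot (v i) ('i *: v j)| <= (2 * n)%:R * A ^+ 2.
  apply: le_trans (dot_le _ _) _; rewrite rnZ rn_i mul1r -mulrA ler_wpM2l//.
  by rewrite expr2 ler_pM ?rn_ge0.
apply: le_trans (ler_pM (normr_ge0 _) (normr_ge0 _) h1 (ler_normB _ _)) _.
have half_sum (x y c : R) : x <= c -> y <= c -> 2^-1 * (x + y) <= c by lra.
by apply: half_sum; exact: d.
Qed.

(** A bound on the arguments of norm at most 1. This condition on the arguments is
inherited by the selections that occur in a wedge product. *)
Definition form_bounded n k (eta : Defs.form R n k) (z : Cn R n) (A : R) :=
  forall w, (forall i, rn (w i) <= 1) -> `|eta z w| <= A.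

Lemma wedge_bounded n k l (eta : Defs.form R n k) (zeta : Defs.form R n l) z A B : 0 <= A -> 0 <= B ->
  form_bounded eta z A -> form_bounded zeta z B ->
  form_bounded (wedge eta zeta) z (#|{: 'S_(k + l)}|%:R * A * B).
Proof.
move=> A0 B0 eA zB w w1; rewrite /wedge normrM.
have h : `|(k`! * l`!)%:R^-1| <= 1 :> R.
  rewrite ger0_norm ?invr_ge0// invf_le1 ?ltr0n ?ler1n ?muln_gt0 ?fact_gt0//.
apply: le_trans (ler_pM (normr_ge0 _) (normr_ge0 _) h (lexx _)) _; rewrite mul1r.
apply: le_trans (ler_norm_sum _ _ _) _.
apply: le_trans (_ : \sum_(s : 'S_(k + l)) A * B <= _); last first.
  by rewrite sumr_const -mulrA mulr_natl.
apply: ler_sum => s _; rewrite !normrM normrX normrN1 expr1n mul1r.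
by apply: ler_pM => //; [apply: eA|apply: zB] => i.
Qed.

Lemma wedge_exp_bounded n p : exists2 K : R, 0 <= K &
  forall z, form_bounded (wedge_exp (ddc (@sqnorm R n)) p) z K.
Proof.
elim: p => [|p [K K0 KP]].
  by exists 1 => // z w _; rewrite /= normr1.
exists (#|{: 'S_(2 + p * 2)}|%:R * (2 * n)%:R * K); first by rewrite !mulr_ge0.
move=> z; apply: wedge_bounded => // w w1.
by apply: le_trans (ddc_sqnorm_le _ ler01 w1) _; rewrite expr1n mulr1.
Qed.

Lemma real_frame_le n i : rn (@real_frame R n i) <= 1.
Proof.
apply: rn_rV_le => // j; rewrite mxE.
by case: ifP => _; [case: ifP => _; rewrite ?rn_i ?rn1|rewrite rn0].
Qed.

End Forms.

Section Characteristic.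
Variables (R : realType) (n m : nat) (L : lattice R m).
Local Notation C := (R[i]).

(** The chosen local lift differs from [f] by a constant of the lattice near [z]. *)
Lemma local_lift_diff (F : Cn R n -> torus L) (f : Cn R n -> Cn R m) :
  (forall z, differentiable f z) -> (forall z, F z = torus_proj L (f z)) ->
  forall z, 'd (local_lift F z) z = 'd f z :> (_ -> _).
Proof.
move=> fd fF z; rewrite /local_lift; set fl := xget _ _.
have [/near_rnP[d d0 dP] /near_rnP[d' d'0 d'P]] : lift_near F z fl.
  apply: (@xgetPex _ (fun=> 0) [set f | lift_near F z f]).
  by exists f; split; near=> x.
pose D : set (Cn R n) := [set x | rn (x - z) < d] `&` [set x | rn (x - z) < d'].
have cD : convex_in D by apply: convex_inI; exact: convex_in_ball.
have Dz : D z by split; rewrite /= subrr rn0.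
have gc (g : Cn R n -> Cn R m) : (forall x, D x -> differentiable g x) -> contin_on D g.
  move=> gd x Dx e e0.
  have [d1 d10 d1P] := (continuous_rnP g x).1 (differentiable_continuous (gd x Dx)) e e0.
  by exists d1 => // y _; exact: d1P.
have const x : D x -> fl x - f x = fl z - f z.
  move=> Dx; apply: (@contin_lattice_const _ _ _ L D (fun x => fl x - f x)) => //.
    apply: contin_onB; apply: gc => y [yd _]; [exact: dP|exact: fd].
  by move=> y [_ yd]; apply/torus_projP; rewrite -fF -d'P.
suff [_ dfl] : differentiable fl z /\ 'd fl z = 'd f z :> (_ -> _) by exact: dfl.
apply: rn_differentiable_continuous.
  exact: diff_continuous.
move=> e e0; have [d1 d10 d1P] := differentiable_rn (fd z) e0.
exists (Num.min d1 (Num.min d d')); first by rewrite !lt_min d10 d0.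
move=> k; rewrite !lt_min => /andP[k1 /andP[k2 k3]].
have Dk : D (z + k) by split; rewrite /= addrC addKr.
have -> : fl (z + k) - fl z = f (z + k) - f z.
  have /(congr1 (fun v => v + f (z + k))) := const _ Dk; rewrite subrK => ->.
  by rewrite addrAC [fl z - f z]addrC addrK addrC.
exact: d1P.
Unshelve. all: by end_near. Qed.

Lemma rn_le_enorm k (z : Cn R k) : rn z <= enorm z.
Proof.
apply: rn_rV_le => [|j]; first exact: sqrtr_ge0.
rewrite rn_normc ler_wsqrtr// /sqnorm (bigD1 j)//= lerDl.
by apply: sumr_ge0 => i _; rewrite addr_ge0// sqr_ge0.
Qed.

End Characteristic.

Section CharacteristicBound.
Variables (R : realType) (n m : nat) (L : lattice R m).
Local Notation C := (R[i]).

Lemma ball_sub_cube (t : R) :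
  real_point n.+1 @^-1` (@eball R n.+1 t) `<=` @tcube R (n.+1 * 2) t.
Proof.
move=> x /= xt i; rewrite -ler_norml.
have i2 : (i./2 < n.+1)%N by rewrite ltn_half_double -muln2.
have := le_lt_trans (le_trans (rn_coord _ ord0 (Ordinal i2)) (rn_le_enorm _)) xt.
rewrite mxE /= => /ltW h; rewrite (tnth_nth 0).
have := odd_double_half i; case: (odd i) => /= E.
  by rewrite -E add1n; apply: le_trans h; exact: (Im_le_rn (_ +i* _)).
by rewrite -E add0n; apply: le_trans h; exact: (Re_le_rn (_ +i* _)).
Qed.

(** On the unit frame the integrand is at most c1 B^2, the ball of radius t lies in a
cube of volume (2 t)^(2 N) <= (2 r)^(2 N) where N = n + 1, and the factor
t^-(2 N - 1) is at most 1 since t >= 1. *)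
Lemma characteristic_le : exists2 c : R, 1 <= c &
  forall (F : Cn R n.+1 -> torus L) (f : Cn R n.+1 -> Cn R m) (r B : R),
    (forall z, differentiable f z) -> (forall z, F z = torus_proj L (f z)) ->
    1 <= r -> 0 <= B ->
    (forall z h, rn z <= r -> rn ('d f z h) <= B * rn h) ->
    (characteristic F r <= (c * r ^+ (n.+1 * 2).+1 * B ^+ 2)%:E)%E.
Proof.
have [K K0 KP] := wedge_exp_bounded R n.+1 n.
pose c1 := #|{: 'S_(2 + n * 2)}|%:R * (2 * m)%:R * K.
have c10 : 0 <= c1 by rewrite !mulr_ge0.
exists (1 + c1 * 2 ^+ (n.+1 * 2)).
  by rewrite lerDl mulr_ge0// exprn_ge0.
move=> F f r B fd fF r1 B0 dB; have r0 : 0 <= r := le_trans ler01 r1.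
have pw z : rn z <= r -> form_bounded (wedge (pullback_omega_std F)
    (wedge_exp (ddc (@sqnorm R n.+1)) n)) z (c1 * B ^+ 2).
  move=> zr; have -> : c1 * B ^+ 2 = #|{: 'S_(2 + n * 2)}|%:R * ((2 * m)%:R * B ^+ 2) * K.
    by rewrite /c1; ring.
  apply: wedge_bounded => //; first by rewrite mulr_ge0// exprn_ge0.
  move=> w w1; rewrite /pullback_omega_std /pullback.
  apply: ddc_sqnorm_le => // i; rewrite (local_lift_diff fd fF).
  by apply: le_trans (dB z _ zr) _; rewrite ler_piMr.
have [mu [muE muC]] := @lebesgue_tuple_cube R (n.+1 * 2).
pose Y := c1 * B ^+ 2 * (r + r) ^+ (n.+1 * 2).
have Y0 : 0 <= Y.
  by rewrite /Y; apply: mulr_ge0; [rewrite mulr_ge0 ?exprn_ge0|rewrite exprn_ge0 ?addr_ge0].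
have inner t : 0 <= t -> t <= r ->
    (form_integral (@eball R n.+1 t) (wedge (pullback_omega_std F)
      (wedge_exp (ddc (@sqnorm R n.+1)) n)) <= Y%:E)%E.
  move=> t0 tr; rewrite /form_integral -muE.
  have c0 : 0 <= c1 * B ^+ 2 by rewrite mulr_ge0// exprn_ge0.
  have mc := @measurable_tcube R (n.+1 * 2) t.
  apply: le_trans (@integral_le_cst _ _ _ mu _ _ _ _ c0 mc (@ball_sub_cube t) _) _.
    move=> x /= xt; rewrite lee_fin; apply: le_trans (ler_norm _) _.
    apply: pw; last by move=> i; exact: real_frame_le.
    exact: le_trans (rn_le_enorm _) (le_trans (ltW xt) tr).
  rewrite muC// -EFinM lee_fin /Y ler_wpM2l// lerXn2r ?nnegrE ?addr_ge0//.
  exact: lerD.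
rewrite /characteristic.
have mi : measurable (`[1%R, r]%classic : set (measurableTypeR R)) by exact: measurable_itv.
apply: le_trans (@integral_le_cst _ _ _ (@lebesgue_measure R) _ _ _ Y Y0 mi (@subset_refl _ _) _) _.
  move=> t /=; rewrite in_itv /= => /andP[t1 tr].
  have t0 : 0 < t := lt_le_trans ltr01 t1.
  apply: le_trans (lee_wpmul2l _ (inner t (ltW t0) tr)) _.
    by rewrite lee_fin invr_ge0 exprn_ge0// ltW.
  by rewrite -EFinM lee_fin ler_piMl// invf_le1 ?exprn_gt0// exprn_ege1.
have := @lebesgue_measure_itv R `[1%R, r]; rewrite /= lte_fin => ->.
case: ifPn => _; last first.
  rewrite mule0 lee_fin; apply: mulr_ge0; last by rewrite exprn_ge0.
  by apply: mulr_ge0; [rewrite addr_ge0// mulr_ge0// exprn_ge0|rewrite exprn_ge0].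
rewrite -EFinB -EFinM lee_fin /Y.
apply: le_trans (_ : c1 * B ^+ 2 * (r + r) ^+ (n.+1 * 2) * r <= _).
  by rewrite ler_wpM2l// gerBl.
rewrite (_ : r + r = 2 * r); last by ring.
rewrite exprMn [r ^+ _.+1]exprS; clearbody c1.
rewrite [leRHS](_ : _ = r * r ^+ (n.+1 * 2) * B ^+ 2 +
  c1 * B ^+ 2 * (2 ^+ (n.+1 * 2) * r ^+ (n.+1 * 2)) * r); last by ring.
rewrite lerDr; apply: mulr_ge0; last by rewrite exprn_ge0.
by apply: mulr_ge0 => //; rewrite exprn_ge0.
Qed.

End CharacteristicBound.

(** * Universality and hypercyclicity of the projection *)

Section Dense.
Variables (R : realType) (n m : nat) (L : lattice R m).
Local Notation C := (R[i]).
Variables (f : Cn R n -> Cn R m) (a : Cn R n).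
Hypothesis fd : forall z, differentiable f z.
Let F : Cn R n -> torus L := fun z => torus_proj L (f z).
Hypothesis fapp : forall (h : Cn R n -> Cn R m) (j : nat),
  (forall z, differentiable h z) ->
  exists N, forall y, rn y <= j%:R -> rn (f (y + a *+ N) - h y) <= 3 / 2 ^+ j.

Lemma Hol_proj : Hol F.
Proof. by move=> z0; exists f; split; near=> z. Unshelve. all: by end_near. Qed.

Lemma iter_translate N (G : Cn R n -> torus L) z :
  iter N (translate a) G z = G (z + a *+ N).
Proof.
elim: N z => [|N ih] z; first by rewrite mulr0n addr0.
by rewrite iterS /translate ih mulrS addrA.
Qed.

Lemma enorm_le k (w : Cn R k) : enorm w <= (2 * k).+1%:R * rn w.
Proof.
have w0 : 0 <= (2 * k).+1%:R * rn w by rewrite mulr_ge0 ?rn_ge0.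
rewrite -[leRHS]ger0_norm// -sqrtr_sqr ler_wsqrtr// sqnormE.
apply: le_trans (ler_norm _) _; apply: le_trans (dot_le _ _) _.
rewrite exprMn -mulrA -expr2 ler_wpM2r ?exprn_ge0 ?rn_ge0//.
by rewrite -natrX ler_nat -mulnn; apply: leq_trans (leqnSn _) _; exact: leq_pmulr.
Qed.

Lemma torus_dist_le (w w' : Cn R m) :
  torus_dist (torus_proj L w) (torus_proj L w') <= enorm (w - w').
Proof.
apply: ge_inf; last by exists w, w'.
by exists 0 => _ [v [v' [_ _ ->]]]; exact: sqrtr_ge0.
Qed.

Lemma geometric_small (c e : R) : 0 < e -> exists N : nat,
  forall j, (N <= j)%N -> c / 2 ^+ j < e.
Proof.
move=> e0; have [N N0 NP] := exists_nat_ge (`|c| / e); exists N => j Nj.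
rewrite ltr_pdivrMr ?exprn_gt0// mulrC -ltr_pdivrMr//.
apply: le_lt_trans (_ : N%:R < _).
  by apply: le_trans NP; rewrite ler_pM2r ?invr_gt0// ler_norm.
by rewrite -natrX ltr_nat; apply: leq_ltn_trans Nj _; exact: ltn_expl.
Qed.

(** The projection does not increase distances. *)
Lemma universal_proj : universal F.
Proof.
move=> H HH; have [h [hd hH]] := lift_entire HH.
have [N NP] := choice (fun j => fapp j hd).
exists (fun j => a *+ N j) => K cK e e0.
have [M MP] := compact_rn_bounded cK.
have [N0 N0P] := @geometric_small ((2 * m).+1%:R * 3) e e0.
exists (maxn M N0) => // j /= ; rewrite geq_max => /andP[Mj Nj] z Kz.
rewrite /translate hH; apply: le_lt_trans (torus_dist_le _ _) _.
apply: le_lt_trans (enorm_le _) _; apply: le_lt_trans (N0P j Nj).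
rewrite -mulrA ler_wpM2l//; apply: NP.
by apply: le_trans (MP z Kz) _; rewrite ler_nat.
Qed.

(** If a compact set is mapped by H into an open set O, the lift maps it into the
inverse image of O, together with a uniform neighbourhood of its image. *)
Lemma hypercyclic_proj : hypercyclic a F.
Proof.
split; first exact: Hol_proj.
move=> H HH; have [h [hd hH]] := lift_entire HH.
have [N NP] := choice (fun j => fapp j hd).
pose G j : {compact-open, Cn R n -> torus L} := iter (N j) (translate a) F.
have GH : G @ \oo --> (H : {compact-open, Cn R n -> torus L}).
  apply/compact_open_cvgP => K O cK oO HO.
  have [M MP] := compact_rn_bounded cK.
  have oU : open [set w : Cn R m | O (torus_proj L w)] by exact: oO.
  have [d d0 dP] : exists2 d : R, 0 < d & forall x, K x ->
      forall w, rn (w - h x) < d -> O (torus_proj L w).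
    apply: compact_uniform cK _ _.
      by move=> d d' x d'd xd w wd; apply: xd; exact: lt_le_trans wd d'd.
    move=> x Kx.
    have /near_rnP[d d0 dP] : nbhs (h x) [set w : Cn R m | O (torus_proj L w)].
      apply: open_nbhs_nbhs; split=> //=; apply: HO; exists x => //; exact: hH.
    have d20 : 0 < d / 2 by rewrite divr_gt0.
    have [d' d'0 d'P] := (continuous_rnP h x).1 (differentiable_continuous (hd x)) _ d20.
    exists (Num.min d' (d / 2)); first by rewrite lt_min d'0.
    move=> x' xx' w; rewrite lt_min => /andP[_ wx]; apply: dP.
    apply: le_lt_trans (rn_tri (h x') _ _) _; rewrite [d]splitr; apply: ltrD => //.
    by apply: d'P; move: xx'; rewrite lt_min => /andP[].
  have [N0 N0P] := @geometric_small 3 d d0.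
  exists (maxn M N0) => // j /=; rewrite geq_max => /andP[Mj Nj] _ [z Kz <-].
  rewrite /G iter_translate; apply: (dP z Kz).
  apply: le_lt_trans (N0P j Nj); apply: NP.
  by apply: le_trans (MP z Kz) _; rewrite ler_nat.
move=> B /GH [j _ /(_ j (leqnn j)) BG].
by exists (G j); split => //; exists (N j).
Qed.

End Dense.


(* The dimensions are n.+1 and m.+1, for arbitrary natural numbers n and m. *)
Theorem theoremC (R : realType) (n m : nat) (Gamma : lattice R m.+1)
    (psi : R -> R)
    (psi_pos : forall r, 1 <= r -> 0 < psi r)
    (psi_cont : {within `[1, +oo[, continuous psi})
    (psi_ndecr : forall r s, 1 <= r -> r <= s -> psi r <= psi s)
    (psi_infty : psi r @[r --> +oo] --> +oo)
    (theta : nat -> Cn R n.+1)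
    (theta_sphere : forall i, enorm (theta i) = 1) :
  exists F : Cn R n.+1 -> torus Gamma,
    [/\ Hol F,
        universal F,
        (forall r, 1 <= r -> (characteristic F r <= (r `^ psi r)%:E)%E)
      & [set theta i | i in [set: nat]] `<=` hypercyclic_directions F].
Proof.
have [c c1 cle] := characteristic_le n Gamma.
have [g [gE gbig]] := growth_majorant (n.+1 * 2).+1 psi_pos psi_infty c1.
have th0 i : theta i != 0.
  apply/eqP => ti; have := theta_sphere i; rewrite ti /enorm /sqnorm big1 ?sqrtr0.
    by move=> /esym/eqP; rewrite oner_eq0.
  by move=> j _; rewrite mxE /= expr0n addr0.
have [f [fd fg fQ]] := slow_universal th0 (@tame_poly_map R n.+1 m.+1) gbig.
have fapp i (h : Cn R n.+1 -> Cn R m.+1) (j : nat) : (forall z, differentiable h z) ->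
    exists N, forall y, rn y <= j%:R -> rn (f (y + theta i *+ N) - h y) <= 3 / 2 ^+ j.
  move=> hd; have j2 : 0 < (2 ^+ j)^-1 :> R by rewrite invr_gt0 exprn_gt0.
  have [q qP] := poly_map_dense hd (ler0n R j) j2.
  have [k [N [jk kP]]] := fQ i q j; exists N => y yj.
  apply: le_trans (rn_tri (poly_map m.+1 q y) _ _) _.
  have yk : rn y <= k%:R by apply: le_trans yj _; rewrite ler_nat.
  apply: le_trans (lerD (kP y yk) (_ : _ <= (2 ^+ j)^-1)) _.
    by rewrite rn_distC; exact: qP.
  have : 2 / 2 ^+ k <= 2 / 2 ^+ j :> R.
    by rewrite ler_wpM2l// lef_pV2 ?posrE ?exprn_gt0// ler_weXn2l ?ler1n.
  lra.
exists (fun z => torus_proj Gamma (f z)); split.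
- exact: Hol_proj.
- exact: (@universal_proj _ _ _ Gamma f (theta 0%N) (fapp 0%N)).
- move=> r r1; rewrite -(gE r r1).
  have r0 : 0 <= r := le_trans ler01 r1.
  apply: (cle _ f) => //.
    have [e e0 eg] := gbig 0%N.
    by apply: le_trans (eg r r0); rewrite expr0 mulr1 ltW.
  by move=> z h zr; exact: fg.
move=> _ [i _ <-]; split; first exact: theta_sphere.
exact: (@hypercyclic_proj _ _ _ Gamma f (theta i) fd (fapp i)).
Qed.
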